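(* Let $-1<\beta<\infty$, let $\varphi:\mathbb{D}\to\mathbb{D}$ be an analytic self-map and let $w\in H^\infty$. Suppose that there is an increasing sequence $(n_k)_{k\in\mathbb{N}}$ of positive integers such that (i) $\lim_{k\to\infty}\|w^{(n_k)}\|_2=0$, and (ii) $\sup\{\|w^{(n)}\|_{\beta_2}:n\in\mathbb{N}\}=\infty$. Then the weighted composition operator $C_{w,\varphi}$ is densely Li--Yorke chaotic on both $H^2$ and $A^2_\beta$.
   Context: $\mathbb{D}$ is the open unit disk in $\mathbb{C}$, $\mathbb{T}$ the unit circle, $\mathbb{N}=\{1,2,\dots\}$, and $H^\infty$ the space of bounded analytic functions on $\mathbb{D}$. The weighted composition operator is $C_{w,\varphi}f=w\cdot(f\circ\varphi)$; it is bounded on the spaces below. $\varphi^n$ is the $n$-fold iterate of $\varphi$; $w^{(1)}=w$ and $w^{(n)}=(w\circ\varphi^{n-1})\cdots(w\circ\varphi)\cdot w$ for $n\ge2$. $H^2$ is the Hardy space of analytic $f$ on $\mathbb{D}$ with $\|f\|_2^2=\sup_{0<r<1}\int_{\mathbb{T}}|f(rz)|^2\,dm(z)<\infty$, with $m$ normalized Lebesgue measure on $\mathbb{T}$. $A^2_\beta$ is the weighted Bergman space of analytic $f$ on $\mathbb{D}$ with $\|f\|_{\beta_2}^2=\int_{\mathbb{D}}|f(z)|^2\,dA_\beta(z)<\infty$, where $dA_\beta(z)=(\beta+1)(1-|z|^2)^\beta\,dA(z)$ and $dA$ is normalized area measure on $\mathbb{D}$. A bounded operator $T$ on a Banach space $X$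 is densely Li--Yorke chaotic if there is an uncountable dense set $S\subset X$ such that for all distinct $x,y\in S$, $\liminf_{n\to\infty}\|T^nx-T^ny\|=0$ and $\limsup_{n\to\infty}\|T^nx-T^ny\|>0$. *)

(* Defs.v *)
From HB Require Import structures.
From mathcomp Require Export all_boot all_order all_algebra.
From mathcomp Require Export all_classical all_reals all_analysis.
From mathcomp Require Export complex.
Export Order.TTheory GRing.Theory Num.Theory.
Export numFieldNormedType.Exports.
Export Normc.

Set Implicit Arguments.
Unset Strict Implicit.
Unset Printing Implicit Defensive.

Local Open Scope classical_set_scope.
Local Open Scope ring_scope.
Local Open Scope complex_scope.

Section LiYorke.
Context {R : realType} {V : lmodType R[i]}.

(* A normed space is given here as a linear subspace X of V together with an
   extended-real-valued norm N on V that is finite on X. *)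
Definition bounded_operator (X : set V) (N : V -> \bar R) (T : V -> V) : Prop :=
  [/\ forall f, X f -> X (T f),
      forall (a : R[i]) f g, X f -> X g -> T (a *: f + g) = a *: T f + T g
    & exists M : R, forall f, X f -> (N (T f) <= M%:E * N f)%E].

Definition densely_Li_Yorke_chaotic
    (X : set V) (N : V -> \bar R) (T : V -> V) : Prop :=
  bounded_operator X N T /\
  exists S : set V,
    [/\ S `<=` X,
        ~ countable S,
        forall f (e : R), X f -> 0 < e ->
          exists2 g, S g & (N (f - g)%R < e%:E)%E
      & forall f g, S f -> S g -> f <> g ->
          limn_einf (fun n => N (iter n T f - iter n T g)%R) = 0%E /\
          (0 < limn_esup (fun n => N (iter n T f - iter n T g)%R))%E].

End LiYorke.

Section Spaces.
Context {R : realType}.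
Local Notation C := (R[i]).

Definition disk : set C := [set z | `|z| < 1].

(* Complex differentiability at every point; C^o is C as a normed space over
   itself. *)
Definition analytic_on_disk (f : C -> C) : Prop :=
  forall z, disk z -> derivable (f : C^o -> C^o) z 1.

Definition Hinfty (f : C -> C) : Prop :=
  analytic_on_disk f /\ exists M : R, forall z, disk z -> normc (f z) <= M.

Definition hardy_norm (f : C -> C) : \bar R :=
  sqrte (ereal_sup
    [set ((2 * pi)^-1)%:E *
         \int[lebesgue_measure]_(t in `[0%R, (2 * pi)%R])
           (normc (f ((r * cos t) +i* (r * sin t))) ^+ 2)%:E
    | r in `]0%R, 1%R[ ]%E).

Definition bergman_norm (beta : R) (f : C -> C) : \bar R :=
  sqrte (
    (pi^-1)%:E *
    \int[lebesgue_measure \x lebesgue_measure]_(p in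
          [set p : R * R | disk (p.1 +i* p.2)])
      (normc (f (p.1 +i* p.2)) ^+ 2 *
       ((beta + 1) * (1 - normc (p.1 +i* p.2) ^+ 2) `^ beta))%:E)%E.

(* A function on the disk is represented by its extension by zero to the whole
   plane, so that Leibniz equality of representatives is equality on the
   disk. *)
Definition disk_function (f : C -> C) : Prop :=
  forall z, ~ disk z -> f z = 0.

Definition hardy : set (C -> C^o) :=
  [set f | [/\ disk_function f, analytic_on_disk f & (hardy_norm f < +oo)%E]].

Definition bergman (beta : R) : set (C -> C^o) :=
  [set f | [/\ disk_function f, analytic_on_disk f
             & (bergman_norm beta f < +oo)%E]].

(* w \o phi is only meaningful on the disk; the result is again extended by
   zero. *)
Definition wcomp (w phi : C -> C) (f : C -> C^o) : C -> C^o :=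
  fun z => if `|z| < 1 then w z * f (phi z) else 0.

Definition weight (w phi : C -> C) (n : nat) : C -> C :=
  fun z => \prod_(j < n) w (iter j phi z).

End Spaces.

(* Main.v *)
(** Since C_(w,phi)^n h = w^(n) (h o phi^n),
    hypothesis (i) sends the orbit of each bounded analytic h to 0 along (n_k), and
    (ii) prevents the orbit of a nonzero constant from tending to 0.  Let Z be the
    space of bounded h whose whole orbit tends to 0: it contains no nonzero
    constant, so modulo Z the constants form a line, and each affine line
    h + R.1 meets Z in at most one point.  With (p_n) the polynomials with
    coefficients in Q[i], each repeated infinitely often, all but countably many t
    make the s_n = p_n + t/(n+1) pairwise distinct modulo Z, and all but countably
    many constants c differ from every s_n modulo Z.  These s_n and c form the
    required set.

    Both norms are monotone functionals of the means of |f|^2 over circles (a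
    supremum for H^2, a weighted integral for A^2_beta).  Boundedness of
    composition then follows from Littlewood subordination on circles, obtained
    from the Poisson formula, and density of the polynomials from Parseval. *)

(* Analyticity means pointwise complex differentiability only, with no continuity of the derivative,
   so the function theory has to start from Goursat's bisection. It is run in the parameters (l, t)
   of the rays joining a point zeta to a circle; the Cauchy formula then comes from shrinking the
   circle to zeta.

   The hypotheses speak of different norms, yet each space needs both. Any norm that is monotone in
   the circular means and bounded on constant means is at most a constant times the Hardy norm, so
   (i) passes down to A^2_beta and (ii) passes up to H^2. [radial_gauge] collects what the chaos
   argument uses, and that argument runs once for both spaces.

   Means are indexed by the squared radius because |z|^2 carries area measure to a multiple of
   Lebesgue measure on the half-line; with averaging over rotations, this takes the place of polar
   coordinates.

   Two rational polynomials may well differ by an element of Z, whence the perturbation t/(n+1). The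
   s_n supply density, the constants supply uncountability. *)
From HB Require Import structures.
Require Import Defs.
From mathcomp Require Import measurable_realfun ring lra.
Set Implicit Arguments.
Unset Strict Implicit.
Unset Printing Implicit Defensive.
Local Open Scope classical_set_scope.
Local Open Scope ring_scope.
Local Open Scope complex_scope.
Local Notation Re := (@complex.Re _).
Local Notation Im := (@complex.Im _).

(** * Complex numbers as real pairs *)

Section ComplexDisk.
Context {R : realType}.
Local Notation C := (R[i]).
Implicit Types (z u v : C) (f g : C -> C).

Lemma norm_normc z : `|z| = (normc z)%:C.
Proof. by case: z. Qed.

Lemma normc_ge0 z : 0 <= normc z.
Proof. by case: z => a b; exact: sqrtr_ge0. Qed.

Lemma diskE z : disk z <-> normc z < 1.
Proof. by rewrite /disk /= norm_normc (_ : 1 = 1%:C) // ltcR. Qed.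

Lemma sqr_normcE z : normc z ^+ 2 = Re z ^+ 2 + Im z ^+ 2.
Proof. by case: z => a b /=; rewrite sqr_sqrtr // addr_ge0 ?sqr_ge0. Qed.

Lemma Re_le_normc z : `|Re z| <= normc z.
Proof.
rewrite -(ler_pXn2r (n := 2)) ?nnegrE ?normc_ge0 // sqr_normcE.
by rewrite real_normK ?num_real // lerDl sqr_ge0.
Qed.

Lemma Im_le_normc z : `|Im z| <= normc z.
Proof.
rewrite -(ler_pXn2r (n := 2)) ?nnegrE ?normc_ge0 // sqr_normcE.
by rewrite real_normK ?num_real // lerDr sqr_ge0.
Qed.

Lemma normc_le_ReIm z : normc z <= `|Re z| + `|Im z|.
Proof.
rewrite -(ler_pXn2r (n := 2)) ?nnegrE ?normc_ge0 ?addr_ge0 // sqr_normcE.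
rewrite sqrrD !real_normK ?num_real // addrAC lerDl.
by rewrite mulrn_wge0 // mulr_ge0.
Qed.

Lemma gt0_complexP (e : C) : 0 < e -> exists2 r : R, 0 < r & e = r%:C.
Proof.
case: e => a b; rewrite ltcE /= => /andP[/eqP-> a0]; by exists a.
Qed.

(** The form of the derivative that Goursat's argument consumes: an affine approximation with error
    o(|h|) and real epsilons, [h = 0] included. *)
Lemma derivable_linear_approx f z : derivable (f : C^o -> C^o) z 1 ->
  exists d : C, forall e : R, 0 < e -> exists2 del : R, 0 < del &
    forall h : C, normc h < del -> normc (f (z + h) - f z - d * h) <= e * normc h.
Proof.
move=> /cvg_ex[/= d fd]; exists d => e e0.
move/(@cvgrPdist_le _ C^o): fd => H.
have := H e%:C; rewrite ltcR => /(_ e0).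
move=> /nbhs_ballP[/= del' /gt0_complexP[del del0 ->]] B.
exists del => // h hd.
have [->|h0] := eqVneq h 0.
  by rewrite addr0 subrr mulr0 subr0 normc0 mulr0.
have /= := B h; rewrite /ball /= sub0r normrN norm_normc ltcR => /(_ hd h0).
rewrite norm_normc lecR => le.
have -> : f (z + h) - f z - d * h = - (h * (d - h^-1 * (f (h * 1 + z) - f z))).
  by rewrite mulr1 (addrC h z); field.
by rewrite normcN normcM mulrC ler_wpM2r ?normc_ge0 //; exact: le.
Qed.

Lemma continuous_Re : continuous (Re : C^o -> R).
Proof.
move=> z; apply/(@cvgrPdist_le _ R^o _ (nbhs (z : C^o)))=> e e0; near=> y.
have /le_trans-> // : `|Re z - Re y| <= normc (z - y).
  by have := Re_le_normc (z - y); case: (z) (y) => [? ?] [? ?].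
rewrite -lecR -norm_normc; near: y.
by apply: (@cvgr_dist_le _ C^o); [exact: cvg_id|rewrite ltcR].
Unshelve. all: by end_near. Qed.

Lemma continuous_Im : continuous (Im : C^o -> R).
Proof.
move=> z; apply/(@cvgrPdist_le _ R^o _ (nbhs (z : C^o)))=> e e0; near=> y.
have /le_trans-> // : `|Im z - Im y| <= normc (z - y).
  by have := Im_le_normc (z - y); case: (z) (y) => [? ?] [? ?].
rewrite -lecR -norm_normc; near: y.
by apply: (@cvgr_dist_le _ C^o); [exact: cvg_id|rewrite ltcR].
Unshelve. all: by end_near. Qed.

Lemma cvg_complex (T : Type) (F : set_system T) (FF : Filter F) (x y : T -> R) (a b : R) :
  x @ F --> a -> y @ F --> b -> (fun t => x t +i* y t : C^o) @ F --> (a +i* b : C^o).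
Proof.
move=> xa yb; apply/cvgrPdist_le => _ /gt0_complexP[e e0 ->]; near=> t.
rewrite norm_normc lecR; apply: le_trans (normc_le_ReIm _) _ => /=.
rewrite (splitr e) lerD //.
- by near: t; apply: cvgr_dist_le xa _ _; rewrite divr_gt0.
- by near: t; apply: cvgr_dist_le yb _ _; rewrite divr_gt0.
Unshelve. all: by end_near. Qed.

Definition circ (r t : R) : C := (r * cos t) +i* (r * sin t).

Lemma continuous_circ r : continuous (circ r : R -> C^o).
Proof.
move=> t; apply: cvg_complex; apply: cvgM; try exact: cvg_cst.
- exact: continuous_cos.
- exact: continuous_sin.
Qed.

Lemma normc_circ r t : normc (circ r t) = `|r|.
Proof.
by rewrite /circ /= !exprMn -mulrDr cos2Dsin2 mulr1 sqrtr_sqr.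
Qed.

Lemma normc_real (x : R) : normc x%:C = `|x|.
Proof. by rewrite /= expr0n addr0 sqrtr_sqr. Qed.

Lemma normc_conj z : normc z^*%C = normc z.
Proof. by case: z => a b /=; rewrite sqrrN. Qed.

Lemma normcB_ge z u : normc z - normc u <= normc (z - u).
Proof. by rewrite lerBlDr; apply: le_trans (le_normcD _ _); rewrite subrK. Qed.

End ComplexDisk.

(** * Cauchy and Poisson formulas *)

Section Bisection.
Context {R : realType}.

(** The common point is the supremum of the left endpoints, each of which lies below every right
    endpoint. *)
Lemma nested_intervals (x h : nat -> R) (a b : R) :
  (forall n, 0 <= h n) -> (forall n, x n <= x n.+1) ->
  (forall n, x n.+1 + h n.+1 <= x n + h n) ->
  exists y : R, forall n, x n <= y <= x n + h n.
Proof.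
move=> h0 xS xhS.
have xm n m : (n <= m)%N -> x n <= x m.
  by move=> /subnK<-; elim: (m - n)%N => // k; move/le_trans; apply.
have xhm n m : (n <= m)%N -> x m + h m <= x n + h n.
  move=> /subnK<-; elim: (m - n)%N => // k IH.
  by apply: le_trans IH; exact: xhS.
have xle n m : x n <= x m + h m.
  case: (leqP n m) => nm.
    by apply: le_trans (xm _ _ nm) _; rewrite lerDl.
  by apply: le_trans (xhm _ _ (ltnW nm)); rewrite lerDl.
exists (sup (range x)) => n; apply/andP; split.
  apply: ub_le_sup; last by exists n.
  by exists (x 0%N + h 0%N) => _ [m _ <-].
by apply: ge_sup => [|_ [m _ <-]//]; exists (x 0%N); exists 0%N.
Qed.

(* The bisection step of Goursat's theorem, for an abstract rectangle function. *)
Lemma bisection_eq0 (Phi : R -> R -> R -> R -> R) (a b c d : R) :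
  a <= b -> c <= d ->
  (forall l t h k : R, a <= l -> c <= t -> 0 <= h -> 0 <= k ->
    l + (h + h) <= b -> t + (k + k) <= d ->
    Phi l (l + (h + h)) t (t + (k + k)) =
    Phi l (l + h) t (t + k) + Phi (l + h) (l + h + h) t (t + k) +
    (Phi l (l + h) (t + k) (t + k + k) +
     Phi (l + h) (l + h + h) (t + k) (t + k + k))) ->
  (forall l0 t0 e : R, a <= l0 <= b -> c <= t0 <= d -> 0 < e ->
    exists2 del : R, 0 < del & forall l t h k : R, a <= l -> c <= t ->
      l + h <= b -> t + k <= d -> 0 <= h < del -> 0 <= k < del ->
      l <= l0 <= l + h -> t <= t0 <= t + k ->
      `|Phi l (l + h) t (t + k)| <= e * (h + k) ^+ 2) ->
  Phi a b c d = 0.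
Proof.
move=> ab cd Padd Ploc; apply/eqP/negP => /negP P0.
pose H n : R := (b - a) / 2 ^+ n; pose K n : R := (d - c) / 2 ^+ n.
have H0 n : 0 <= H n by rewrite divr_ge0 ?subr_ge0 ?exprn_ge0.
have K0 n : 0 <= K n by rewrite divr_ge0 ?subr_ge0 ?exprn_ge0.
have HS n : H n = H n.+1 + H n.+1.
  by rewrite /H exprS; field; rewrite expf_neq0.
have KS n : K n = K n.+1 + K n.+1.
  by rewrite /K exprS; field; rewrite expf_neq0.
pose P n (p : R * R) := Phi p.1 (p.1 + H n) p.2 (p.2 + K n).
pose good n (p : R * R) := [/\ a <= p.1, p.1 + H n <= b, c <= p.2, p.2 + K n <= d &
   `|Phi a b c d| <= 4 ^+ n * `|P n p|].
have step n p : good n p -> {q | good n.+1 q /\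
    [/\ p.1 <= q.1, q.1 + H n.+1 <= p.1 + H n, p.2 <= q.2 &
     q.2 + K n.+1 <= p.2 + K n]}.
  case: p => l t [/= al lb ct td le]; apply: cid.
  have := Padd l t (H n.+1) (K n.+1) al ct (H0 _) (K0 _).
  rewrite -HS -KS => /(_ lb td) E.
  have hH := H0 n.+1; have hK := K0 n.+1.
  have := HS n; have := KS n => eK eH.
  pose Q q := `|P n.+1 q|.
  have S4 : `|P n (l, t)| <= Q (l, t) + Q (l + H n.+1, t) +
       (Q (l, t + K n.+1) + Q (l + H n.+1, t + K n.+1)).
    rewrite /P /= E; apply: le_trans (ler_normD _ _) _; apply: lerD;
    exact: ler_normD.
  (* One of the four quarters carries at least a quarter of the value; that quarter is kept. *)
  have : [\/ `|P n (l, t)| <= 4 * Q (l, t), `|P n (l, t)| <= 4 * Q (l + H n.+1, t),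
       `|P n (l, t)| <= 4 * Q (l, t + K n.+1)
      | `|P n (l, t)| <= 4 * Q (l + H n.+1, t + K n.+1)].
    have [h1|h1] := lerP `|P n (l, t)| (4 * Q (l, t)); first by constructor 1.
    have [h2|h2] := lerP `|P n (l, t)| (4 * Q (l + H n.+1, t)); first by constructor 2.
    have [h3|h3] := lerP `|P n (l, t)| (4 * Q (l, t + K n.+1)); first by constructor 3.
    by constructor 4; lra.
  have fin q : `|P n (l, t)| <= 4 * Q q ->
     `|Phi a b c d| <= 4 ^+ n.+1 * `|P n.+1 q|.
    move=> hq; apply: le_trans le _; rewrite exprSr -mulrA ler_wpM2l ?exprn_ge0 //.
  by case=> /fin hq;
    [exists (l, t)|exists (l + H n.+1, t)|exists (l, t + K n.+1)|
     exists (l + H n.+1, t + K n.+1)]; split; split => //=;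
    clear -al lb ct td hH hK eK eH; clearbody H K; lra.
have good0 : good 0%N (a, c).
  by rewrite /good /P /H /K /= expr0 !divr1 mul1r; split => //; rewrite ?subrKC// ; lra.
pose s := fix s n : {p | good n p} := if n is m.+1 then
   let q := step _ _ (svalP (s m)) in exist _ (sval q) (proj1 (svalP q))
   else exist _ (a, c) good0.
pose x n := sval (s n).
have xg n : good n (x n) := svalP (s n).
have xS n : [/\ (x n).1 <= (x n.+1).1, (x n.+1).1 + H n.+1 <= (x n).1 + H n,
     (x n).2 <= (x n.+1).2 & (x n.+1).2 + K n.+1 <= (x n).2 + K n].
  by rewrite /x /=; case: (step _ _ _) => q [].
have [l0 Hl0] : exists y : R, forall n, (x n).1 <= y <= (x n).1 + H n.
  by apply: (nested_intervals a b H0) => n; case: (xS n).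
have [t0 Ht0] : exists y : R, forall n, (x n).2 <= y <= (x n).2 + K n.
  by apply: (nested_intervals a b K0) => n; case: (xS n).
pose A := b - a + (d - c).
have A0 : 0 <= A by rewrite /A; lra.
(* At every stage 4^n e (H n + K n)^2 equals e A^2, so the local estimate would give |Phi a b c d|
   <= e A^2, which this [e] makes strictly smaller than |Phi a b c d|. The 1 guards against A =
   0. *)
pose e := `|Phi a b c d| / (A ^+ 2 + 1).
have e0 : 0 < e by rewrite divr_gt0 ?normr_gt0 // ltr_wpDl ?sqr_ge0.
have [||del del0 Hd] := Ploc l0 t0 e _ _ e0.
- have := Hl0 0%N; have [? ? _ _ _] := xg 0%N; move=> /andP[? ?]; apply/andP; split; lra.
- have := Ht0 0%N; have [_ _ ? ? _] := xg 0%N; move=> /andP[? ?]; apply/andP; split; lra.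
have [n An] : exists n, A < del * 2 ^+ n.
  exists (Num.bound (A / del)); rewrite mulrC -ltr_pdivrMr //.
  apply: lt_trans (archi_boundP (divr_ge0 A0 (ltW del0))) _.
  by rewrite -natrX ltr_nat ltn_expl.
have [g1 g2 g3 g4 g5] := xg n.
have Hn : 0 <= H n < del.
  rewrite H0 /= ltr_pdivrMr ?exprn_gt0 //; apply: le_lt_trans An; rewrite /A; lra.
have Kn : 0 <= K n < del.
  rewrite K0 /= ltr_pdivrMr ?exprn_gt0 //; apply: le_lt_trans An; rewrite /A; lra.
have := Hd _ _ _ _ g1 g3 g2 g4 Hn Kn (Hl0 n) (Ht0 n).
rewrite -/(P n (x n)) => lePe.
have : `|Phi a b c d| <= e * A ^+ 2.
  apply: le_trans g5 _.
  have -> : e * A ^+ 2 = 4 ^+ n * (e * (H n + K n) ^+ 2).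
    rewrite /H /K -mulrDl -/A exprMn exprVn -exprM mulnC exprM.
    rewrite (_ : 2 ^+ 2 = 4) ?expr2 -?natrM //; field; rewrite expf_neq0 //.
  by rewrite ler_wpM2l ?exprn_ge0.
rewrite /e -mulrA leNgt => /negP; apply.
rewrite -[ltRHS]mulr1 ltr_pM2l ?normr_gt0 // mulrC ltr_pdivrMr ?mul1r; first by rewrite ltrDl.
by rewrite ltr_wpDl ?sqr_ge0.
Qed.
End Bisection.

(** * Integrals of continuous functions over a segment *)

Section SegmentIntegral.
Context {R : realType}.
Local Notation mu := (@lebesgue_measure R).
Implicit Types (f g : R -> R) (a b c : R).

Definition segint a b f : R := \int[mu]_(x in `[a, b]) f x.
Definition segcont a b f := forall x, a <= x <= b -> {for x, continuous f}.

Lemma segcont_integrable a b f : segcont a b f -> mu.-integrable `[a, b] (EFin \o f).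
Proof.
move=> fc; apply: continuous_compact_integrable; first exact: segment_compact.
apply: continuous_in_subspaceT => x; rewrite inE /= in_itv /=; exact: fc.
Qed.

Lemma eq_segint a b f g : (forall x, a <= x <= b -> f x = g x) ->
  segint a b f = segint a b g.
Proof.
move=> fg; apply: eq_Rintegral => x; rewrite inE /= in_itv /=; exact: fg.
Qed.

Lemma segint_cst a b (k : R) : a <= b -> segint a b (fun=> k) = k * (b - a).
Proof.
move=> ab; rewrite /segint Rintegral_cst //; congr (_ * _).
have := @lebesgue_measure_itv R `[a, b]; rewrite /= lte_fin => ->.
case: ltP => //= ba.
by apply/eqP; rewrite eq_sym subr_eq0 eq_le ab ba.
Qed.

Lemma segintD a b f g : segcont a b f -> segcont a b g ->
  segint a b (fun x => f x + g x) = segint a b f + segint a b g.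
Proof. by move=> fc gc; apply: RintegralD => //; exact: segcont_integrable. Qed.

Lemma segintB a b f g : segcont a b f -> segcont a b g ->
  segint a b (fun x => f x - g x) = segint a b f - segint a b g.
Proof. by move=> fc gc; apply: RintegralB => //; exact: segcont_integrable. Qed.

Lemma segintZ a b (k : R) f : segcont a b f ->
  segint a b (fun x => k * f x) = k * segint a b f.
Proof. by move=> fc; apply: RintegralZl => //; exact: segcont_integrable. Qed.

Lemma segint_cat a b c f : a <= b -> b <= c -> segcont a c f ->
  segint a c f = segint a b f + segint b c f.
Proof.
move=> ab bc fc.
have I := segcont_integrable fc.
have := @Rintegral_itvB R f (BLeft a) (BRight c) b I.
rewrite !bnd_simp => /(_ ab bc) /eqP; rewrite subr_eq => /eqP.
rewrite -/(segint a c f) -/(segint a b f) => ->; rewrite addrC; congr (_ + _).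
apply: Rintegral_itv_obnd_cbnd.
apply: integrableS I => //; apply: subset_itvr; rewrite bnd_simp //.
Qed.

Lemma le_segint a b f g : segcont a b f -> segcont a b g ->
  (forall x, a <= x <= b -> f x <= g x) -> segint a b f <= segint a b g.
Proof.
move=> fc gc fg; apply: le_Rintegral => //; exact: segcont_integrable.
Qed.

Lemma segint_norm_le a b f (M : R) : a <= b -> segcont a b f ->
  (forall x, a <= x <= b -> `|f x| <= M) -> `|segint a b f| <= M * (b - a).
Proof.
move=> ab fc fM; have kc k : segcont a b (fun=> k) by move=> x _; exact: cvg_cst.
rewrite ler_norml -mulNr -!segint_cst //; apply/andP; split; apply: le_segint => // x /fM;
by rewrite ler_norml => /andP[].
Qed.

Lemma segint_FTC a b f (F : R -> R) : a <= b -> (forall x : R, is_derive x (1:R) F (f x)) ->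
  segcont a b f -> segint a b f = F b - F a.
Proof.
rewrite le_eqVlt => /orP[/eqP -> _ _|ab dF fc].
  by rewrite /segint set_itv1 Rintegral_set1 subrr.
rewrite /segint /Rintegral (@continuous_FTC2 _ f F) //.
- apply: continuous_in_subspaceT => x; rewrite inE /= in_itv /=; exact: fc.
- have cF x : {for x, continuous F}.
    by apply: differentiable_continuous; apply/derivable1_diffP; case: (dF x).
  split; first by move=> x _; case: (dF x).
  + by apply: cvg_at_right_filter; exact: cF.
  + by apply: cvg_at_left_filter; exact: cF.
- by move=> x _; rewrite derive1E; apply: derive_val.
Qed.

End SegmentIntegral.

(** * Lipschitz bounds and derivatives along circles *)

Section Trig.
Context {R : realType}.

Lemma cos_lipschitz (x y : R) : `|cos x - cos y| <= `|x - y|.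
Proof.
wlog yx : x y / y <= x.
  by move=> W; case: (leP y x) => [|/ltW] /W //; rewrite distrC (distrC y).
rewrite -(@segint_FTC _ y x (fun t => - sin t) _ yx).
- rewrite [leRHS]ger0_norm ?subr_ge0 // -[leRHS]mul1r; apply: segint_norm_le; first exact: yx.
    by move=> t _; apply: cvgN; exact: continuous_sin.
  by move=> t _; rewrite normrN ler_norml sin_geN1 sin_le1.
- by move=> t _; apply: cvgN; exact: continuous_sin.
Qed.

Lemma sin_lipschitz (x y : R) : `|sin x - sin y| <= `|x - y|.
Proof.
wlog yx : x y / y <= x.
  by move=> W; case: (leP y x) => [|/ltW] /W //; rewrite distrC (distrC y).
rewrite -(@segint_FTC _ y x (fun t => cos t) _ yx).
- rewrite [leRHS]ger0_norm ?subr_ge0 // -[leRHS]mul1r; apply: segint_norm_le; first exact: yx.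
    by move=> t _; exact: continuous_cos.
  by move=> t _; rewrite ler_norml cos_geN1 cos_le1.
- by move=> t _; exact: continuous_cos.
Qed.

Lemma circ_lipschitz (r x y : R) : normc (circ r x - circ r y) <= 2 * `|r| * `|x - y|.
Proof.
apply: le_trans (normc_le_ReIm _) _ => /=.
rewrite -!mulrBr !normrM -mulrDr -mulrA mulrCA ler_wpM2l // mulr_natl mulr2n.
by rewrite lerD ?cos_lipschitz ?sin_lipschitz.
Qed.

Lemma circ2pi (r : R) : circ r (2 * pi) = circ r 0.
Proof. by rewrite /circ mulr_natl cos2pi sin2pi cos0 sin0. Qed.

Lemma is_derive_Im_circ (b : R[i]) (r t : R) :
  is_derive t (1 : R) (fun t => Im (b * circ r t)) (Re (b * circ r t)).
Proof.
case: b => x y /=; apply: is_derive_eq.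
by rewrite /GRing.scale /=; ring.
Qed.

End Trig.

Lemma continuous_affine {R : realType} (a b u : R[i]) :
  continuous ((fun z => a + b * (z - u)) : R[i]^o -> R[i]^o).
Proof.
move=> z; apply: (@cvgD _ R[i]^o _ (nbhs z)); first exact: cvg_cst.
apply: (@cvgM R[i]^o _ (nbhs z)); first exact: cvg_cst.
by apply: (@cvgB _ R[i]^o _ (nbhs z)); [exact: cvg_id|exact: cvg_cst].
Qed.

(** * Goursat's theorem on the rays from a point to a circle *)

Section Goursat.
Context {R : realType}.
Local Notation C := (R[i]).
Context (zeta : C) (r : R).
Context (zr : normc zeta < r).

Let r0 : 0 < r. Proof. by apply: le_lt_trans zr; exact: normc_ge0. Qed.
Let c := circ r.
Let ray (l t : R) : C := zeta + l%:C * (c t - zeta).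
(** Since the derivative of [c] is i [c], the kernel times dt is dz / (i (z - zeta)) along the
    circle. *)
Definition cauchy_kernel (t : R) : C := c t / (c t - zeta).
Local Notation k := cauchy_kernel.

Let cz_ge t : r - normc zeta <= normc (c t - zeta).
Proof. by have := normcB_ge (c t) zeta; rewrite normc_circ gtr0_norm. Qed.

Let cz_neq0 t : c t - zeta != 0.
Proof.
by apply/eqP => h; have := cz_ge t; rewrite h normc0 leNgt subr_gt0 zr.
Qed.

Let normc_k t : normc (k t) <= r / (r - normc zeta).
Proof.
rewrite normcM normcV normc_circ gtr0_norm // ler_pM2l //.
by rewrite lef_pV2 ?cz_ge // posrE ?subr_gt0 // (lt_le_trans _ (cz_ge t)) // subr_gt0.
Qed.

Let ray_lipschitz (l t l0 t0 : R) : 0 <= l0 <= 1 ->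
  normc (ray l t - ray l0 t0) <= 2 * r * (`|l - l0| + `|t - t0|).
Proof.
move=> /andP[l00 l01].
have -> : ray l t - ray l0 t0 = (l - l0)%:C * (c t - zeta) + l0%:C * (c t - c t0).
  by rewrite /ray rmorphB /=; ring.
apply: le_trans (le_normcD _ _) _; rewrite (mulrDr (2 * r)) !normcM !normc_real lerD //.
  rewrite mulrC ler_wpM2r //; apply: le_trans (le_normcD _ _) _.
  by rewrite normcN normc_circ gtr0_norm // mulr_natl mulr2n lerD2l ltW.
have := circ_lipschitz r t t0; rewrite (gtr0_norm r0) => h.
apply: le_trans h; rewrite ger0_norm // ler_piMl ?normc_ge0 //.
Qed.

Let cont_c t : {for t, continuous (c : R -> C^o)}.
Proof. exact: continuous_circ. Qed.

Let cont_k t : {for t, continuous (k : R -> C^o)}.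
Proof.
apply: cvgM; first exact: cont_c.
apply: (@cvgV C^o); first exact: cz_neq0.
by apply: cvgB; [exact: cont_c|exact: cvg_cst].
Qed.

Let cont_ray_t l t : {for t, continuous (ray l : R -> C^o)}.
Proof.
apply: cvgD; first exact: cvg_cst; apply: cvgM; first exact: cvg_cst.
by apply: cvgB; [exact: cont_c|exact: cvg_cst].
Qed.

Let cont_ray_l l t : {for l, continuous ((fun l => ray l t) : R -> C^o)}.
Proof.
apply: cvgD; first exact: cvg_cst; apply: cvgM; last exact: cvg_cst.
by apply: cvg_complex; [exact: cvg_id|exact: cvg_cst].
Qed.

Let P (g : C -> C) l t1 t2 := segint t1 t2 (fun t => Re (g (ray l t) * k t)).
Let Q (g : C -> C) t l1 l2 := segint l1 l2 (fun l => l^-1 * Im (g (ray l t))).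
Let Phi g l1 l2 t1 t2 := P g l2 t1 t2 - P g l1 t1 t2 - (Q g t2 l1 l2 - Q g t1 l1 l2).

Let rcont (g : C -> C) := forall l t, 0 < l <= 1 -> {for ray l t, continuous (g : C^o -> C^o)}.

Let contP g l t1 t2 : rcont g -> 0 < l <= 1 ->
  segcont t1 t2 (fun t => Re (g (ray l t) * k t)).
Proof.
move=> gc l01 t _.
apply: (@continuous_comp _ _ _ (fun t => g (ray l t) * k t : C^o)); last exact: continuous_Re.
apply: cvgM; last exact: cont_k.
by apply: (@continuous_comp _ _ _ (ray l : R -> C^o)); [exact: cont_ray_t|exact: gc].
Qed.

Let contQ g t l1 l2 : rcont g -> 0 < l1 -> l2 <= 1 ->
  segcont l1 l2 (fun l => l^-1 * Im (g (ray l t))).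
Proof.
move=> gc l10 l21 l /andP[l1l ll2].
have l0 : 0 < l by apply: lt_le_trans l1l.
apply: cvgM; first by apply: cvgV; [rewrite gt_eqF|exact: cvg_id].
apply: (@continuous_comp _ _ _ (fun l => g (ray l t) : C^o)); last exact: continuous_Im.
apply: (@continuous_comp _ _ _ ((fun l => ray l t) : R -> C^o)); first exact: cont_ray_l.
by apply: gc; rewrite l0 (le_trans ll2).
Qed.

Let PhiD g h (l1 l2 t1 t2 : R) : rcont g -> rcont h -> 0 < l1 -> l1 <= l2 -> l2 <= 1 ->
  Phi (fun z => g z + h z) l1 l2 t1 t2 = Phi g l1 l2 t1 t2 + Phi h l1 l2 t1 t2.
Proof.
move=> gc hc l10 l12 l21.
have PD l : 0 < l <= 1 -> P (fun z => g z + h z) l t1 t2 = P g l t1 t2 + P h l t1 t2.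
  move=> l01; rewrite -segintD; try exact: contP.
  by apply: eq_segint => t _; rewrite mulrDl; case: (g _ * _) (h _ * _) => ? ? [].
have QD t : Q (fun z => g z + h z) t l1 l2 = Q g t l1 l2 + Q h t l1 l2.
  rewrite -segintD; try exact: contQ.
  by apply: eq_segint => l _; rewrite -mulrDr; case: (g _) (h _) => ? ? [].
rewrite /Phi !PD ?QD; first by ring.
- by rewrite l10 (le_trans l12).
- by rewrite (lt_le_trans l10).
Qed.

(** The [a] part is independent of l on circular sides and of t on radial sides, so opposite sides
    cancel. The [b] part has the primitive Im (b c t) along circular sides, which the radial sides
    compensate exactly. *)
Let Phi_affine (a b : C) (l1 l2 t1 t2 : R) : 0 < l1 -> l1 <= l2 -> l2 <= 1 -> t1 <= t2 ->
  Phi (fun z => a + b * (z - zeta)) l1 l2 t1 t2 = 0.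
Proof.
move=> l10 l12 l21 t12.
have kc : segcont t1 t2 (fun t => Re (a * k t)).
  move=> t _; apply: (@continuous_comp _ _ _ (fun t => a * k t : C^o)); last exact: continuous_Re.
  by apply: cvgM; [exact: cvg_cst|exact: cont_k].
have bc : segcont t1 t2 (fun t => Re (b * c t)).
  move=> t _; apply: (@continuous_comp _ _ _ (fun t => b * c t : C^o)); last exact: continuous_Re.
  by apply: cvgM; [exact: cvg_cst|exact: cont_c].
have PE l : P (fun z => a + b * (z - zeta)) l t1 t2 =
    segint t1 t2 (fun t => Re (a * k t)) + l * segint t1 t2 (fun t => Re (b * c t)).
  rewrite -segintZ // -segintD //.
    apply: eq_segint => t _.
    have -> : (a + b * (ray l t - zeta)) * k t = a * k t + l%:C * (b * c t).
      by rewrite /ray /k; field.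
    by case: (a * k t) (b * c t) => ? ? [? ?] /=; ring.
  by move=> t tt; apply: cvgM; [exact: cvg_cst|exact: bc].
have lc (A : R) : segcont l1 l2 (fun l => l^-1 * A).
  move=> l /andP[l1l _]; apply: cvgM; last exact: cvg_cst.
  by apply: cvgV; [rewrite gt_eqF // (lt_le_trans l10)|exact: cvg_id].
have QE t : Q (fun z => a + b * (z - zeta)) t l1 l2 =
    segint l1 l2 (fun l => l^-1 * Im a) + Im (b * (c t - zeta)) * (l2 - l1).
  rewrite -segint_cst // -segintD //; last by move=> l _; exact: cvg_cst.
  apply: eq_segint => l /andP[l1l _].
  have l0 : l != 0 by rewrite gt_eqF // (lt_le_trans l10).
  have -> : a + b * (ray l t - zeta) = a + l%:C * (b * (c t - zeta)).
    by rewrite /ray; ring.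
  by case: (a) (b * (c t - zeta)) => ? ? [? ?] /=; field.
have F : segint t1 t2 (fun t => Re (b * c t)) = Im (b * c t2) - Im (b * c t1).
  apply: (@segint_FTC _ _ _ _ (fun t => Im (b * c t))) => //.
  by move=> t; exact: is_derive_Im_circ.
rewrite /Phi !PE !QE F.
move: (c t1) (c t2) => [? ?] [? ?]; case: (b) (zeta) => ? ? [? ?] /=; ring.
Qed.

(** By [Phi_affine], the affine approximation of [g] at [ray l0 t0] can be subtracted. What remains
    is of size e (h + kk) on a boundary of length of order h + kk. The bound a <= l controls the
    factor 1 / l in [Q]. *)
Let Phi_small g (l0 t0 a : R) : 0 < a -> a <= l0 <= 1 ->
  rcont g -> derivable (g : C^o -> C^o) (ray l0 t0) 1 ->
  forall e : R, 0 < e -> exists2 del : R, 0 < del &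
    forall l t h kk : R, a <= l -> l + h <= 1 -> 0 <= h < del -> 0 <= kk < del ->
      l <= l0 <= l + h -> t <= t0 <= t + kk ->
      `|Phi g l (l + h) t (t + kk)| <= e * (h + kk) ^+ 2.
Proof.
move=> a0 /andP[al0 l01] gc /derivable_linear_approx[d Hd] e e0.
(* Two circular sides cost the kernel bound r / (r - |zeta|) each, two radial sides cost 1 / a each,
   and distances are at most 2 r (h + kk); hence 4 r. *)
pose M := 4 * r * (r / (r - normc zeta) + a^-1).
have M0 : 0 < M.
  by rewrite mulr_gt0 ?mulr_gt0 ?addr_gt0 ?divr_gt0 ?invr_gt0 ?subr_gt0.
have [|del del0 {}Hd] := Hd (e / M); first by rewrite divr_gt0.
(* Then h + kk < del / (2 r), so the whole rectangle lies within [del] of [ray l0 t0]. *)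
exists (del / (4 * r)); first by rewrite divr_gt0 ?mulr_gt0.
move=> l t h kk al lh1 /andP[h0 hdel] /andP[k0 kdel] /andP[ll0 l0h] /andP[tt0 t0k].
pose z0 := ray l0 t0.
pose A z := (g z0 + d * (zeta - z0)) + d * (z - zeta).
pose E z := g z - A z.
have Ac : rcont A.
  by move=> l' t' _; exact: continuous_affine.
have Ec : rcont E by move=> l' t' l'01; apply: (@cvgB _ C^o _ (nbhs (ray l' t' : C^o))); [exact: gc|exact: Ac].
have -> : Phi g l (l + h) t (t + kk) = Phi E l (l + h) t (t + kk).
  have := @PhiD E A l (l + h) t (t + kk) Ec Ac.
  rewrite (_ : (fun z => E z + A z) = g); last by apply/funext => z; rewrite /E subrK.
  rewrite Phi_affine ?addr0; [apply=> //| | | |]; lra.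
have Eb (l' t' : R) : l <= l' <= l + h -> t <= t' <= t + kk ->
    normc (E (ray l' t')) <= e / M * (2 * r * (h + kk)).
  move=> /andP[l1 l2] /andP[t1 t2].
  have dist : normc (ray l' t' - z0) <= 2 * r * (h + kk).
    apply: le_trans (ray_lipschitz _ _ _ _) _; first by apply/andP; split; lra.
    rewrite ler_pM2l ?mulr_gt0 // lerD // ler_norml; apply/andP; split; lra.
  have := Hd (ray l' t' - z0); rewrite -/z0 (addrC z0) subrK => Hd'.
  have -> : E (ray l' t') = g (ray l' t') - g z0 - d * (ray l' t' - z0).
    by rewrite /E /A; ring.
  apply: le_trans (Hd' _) _; last by rewrite ler_pM2l ?divr_gt0.
  apply: le_lt_trans dist _.
  have : h + kk < 2 * (del / (4 * r)) by lra.
  have -> : 2 * (del / (4 * r)) = del / (2 * r) by field; rewrite gt_eqF.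
  by rewrite ltr_pdivlMr ?mulr_gt0 // mulrC.
have Pb (l' : R) : l <= l' <= l + h ->
    `|P E l' t (t + kk)| <= e / M * (2 * r * (h + kk)) * (r / (r - normc zeta)) * kk.
  move=> l'b; rewrite -[X in _ * X](addKr t kk) (addrC (- t)).
  apply: segint_norm_le; first lra.
    by apply: contP => //; case/andP: l'b => ? ?; apply/andP; split; lra.
  move=> t' t'b; apply: le_trans (Re_le_normc _) _; rewrite normcM.
  by apply: ler_pM (Eb _ _ l'b t'b) (normc_k t'); exact: normc_ge0.
have Qb (t' : R) : t <= t' <= t + kk ->
    `|Q E t' l (l + h)| <= a^-1 * (e / M * (2 * r * (h + kk))) * h.
  move=> t'b; rewrite -[X in _ * X](addKr l h) (addrC (- l)).
  apply: segint_norm_le; first lra.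
    by apply: contQ => //; lra.
  move=> l' l'b; rewrite normrM; apply: ler_pM => //.
    case/andP: l'b => ? ?.
    have l'0 : 0 < l' by lra.
    rewrite ger0_norm; last by rewrite invr_ge0 ltW.
    by rewrite lef_pV2 ?posrE //; lra.
  by apply: le_trans (Im_le_normc _) _; exact: Eb.
have -> : e * (h + kk) ^+ 2 =
   2 * (e / M * (2 * r * (h + kk)) * (r / (r - normc zeta)) * (h + kk)) +
   2 * (a^-1 * (e / M * (2 * r * (h + kk))) * (h + kk)).
  have : e / M * M = e by rewrite divfK // gt_eqF.
  set X := e / M => <-; rewrite /M; set K := r / _; set ia := a^-1.
  by ring.
have X0 : 0 <= e / M * (2 * r * (h + kk)).
  apply: mulr_ge0; first by rewrite ltW // divr_gt0.
  by rewrite !mulr_ge0 ?addr_ge0 // ltW.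
have K0 : 0 <= r / (r - normc zeta) by rewrite divr_ge0 ?subr_ge0 // ltW.
have ia0 : 0 <= a^-1 by rewrite invr_ge0 ltW.
have tr1 : e / M * (2 * r * (h + kk)) * (r / (r - normc zeta)) * kk <=
   e / M * (2 * r * (h + kk)) * (r / (r - normc zeta)) * (h + kk).
  by rewrite ler_wpM2l ?lerDr // mulr_ge0.
have tr2 : a^-1 * (e / M * (2 * r * (h + kk))) * h <=
   a^-1 * (e / M * (2 * r * (h + kk))) * (h + kk).
  by rewrite ler_wpM2l ?lerDl // mulr_ge0.
have tl : t <= t <= t + kk by apply/andP; split; lra.
have tr : t <= t + kk <= t + kk by apply/andP; split; lra.
have ll : l <= l <= l + h by apply/andP; split; lra.
have lr : l <= l + h <= l + h by apply/andP; split; lra.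
have p1 := Pb _ ll; have p2 := Pb _ lr; have q1 := Qb _ tl; have q2 := Qb _ tr.
rewrite /Phi; apply: le_trans (ler_normB _ _) _; apply: lerD;
  apply: le_trans (ler_normB _ _) _; rewrite mulr_natl mulr2n; apply: lerD.
- exact: le_trans p2 tr1.
- exact: le_trans p1 tr1.
- exact: le_trans q2 tr2.
- exact: le_trans q1 tr2.
Qed.

(** Contributions of the inner sides cancel in pairs; the outer sides are concatenated. *)
Let Phi_split g (l t h k : R) : rcont g -> 0 < l -> 0 <= h -> 0 <= k -> l + (h + h) <= 1 ->
  Phi g l (l + (h + h)) t (t + (k + k)) =
    Phi g l (l + h) t (t + k) + Phi g (l + h) (l + h + h) t (t + k) +
    (Phi g l (l + h) (t + k) (t + k + k) +
     Phi g (l + h) (l + h + h) (t + k) (t + k + k)).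
Proof.
move=> gc l0 h0 k0 lh1.
have PS l' : 0 < l' <= 1 ->
   P g l' t (t + k + k) = P g l' t (t + k) + P g l' (t + k) (t + k + k).
  by move=> l'b; apply: segint_cat; rewrite ?lerDl //; exact: contP.
have QS t' : Q g t' l (l + h + h) = Q g t' l (l + h) + Q g t' (l + h) (l + h + h).
  by apply: segint_cat; rewrite ?lerDl //; apply: contQ => //; lra.
have alg (a a' b b' m m' q q' u u' x x' : R) :
    a + a' - (b + b') - (q + q' - (x + x')) =
    (m - b - (u - x)) + (a - m - (u' - x')) + ((m' - b' - (q - u)) + (a' - m' - (q' - u'))).
  by ring.
rewrite (addrA l) (addrA t) /Phi !QS !PS; first exact: alg.
all: apply/andP; split; lra.
Qed.

(* With z = zeta + l (circ r t - zeta), the 1-form g(z) dz / (i (z - zeta)) reads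
   g(z) (k t dt + dl / (i l)); Phi is, up to orientation, the real part of its
   integral along the boundary of a rectangle in the (l, t) plane. *)
Lemma cauchy_kernel_homotopy (g : C -> C) (a : R) : 0 < a <= 1 ->
  (forall l t : R, 0 < l <= 1 -> derivable (g : C^o -> C^o) (zeta + l%:C * (circ r t - zeta)) 1) ->
  segint 0 (2 * pi) (fun t => Re (g (zeta + a%:C * (circ r t - zeta)) * k t)) =
  segint 0 (2 * pi) (fun t => Re (g (circ r t) * k t)).
Proof.
move=> /andP[a0 a1] gd.
have gc : rcont g.
  by move=> l t l01; apply: differentiable_continuous; apply/derivable1_diffP; exact: gd.
have : Phi g a 1 0 (2 * pi) = 0.
  apply: bisection_eq0 => //; first by rewrite mulr_ge0 ?pi_ge0.
  - by move=> l t h k' al _ h0 k0 lh _; apply: Phi_split => //; exact: lt_le_trans al.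
  - move=> l0 t0 e l0b _ e0.
    have [|del del0 Hd] := @Phi_small g l0 t0 a a0 l0b gc _ e e0.
      by apply: gd; case/andP: l0b => ? ?; apply/andP; split; lra.
    by exists del => // l t h k' al _ lh _ hb kb ? ?; exact: Hd.
rewrite /Phi /P /Q.
(* The radial sides t = 0 and t = 2 pi coincide by periodicity and cancel, leaving the two circular
   sides l = a and l = 1. *)
rewrite (_ : segint a 1 (fun l => l^-1 * Im (g (ray l (2 * pi)))) =
   segint a 1 (fun l => l^-1 * Im (g (ray l 0)))); last first.
  by apply: eq_segint => l _; rewrite /ray /c circ2pi.
rewrite subrr subr0 => /eqP; rewrite subr_eq0 => /eqP <-.
by apply: eq_segint => t _; rewrite /ray rmorph1 mul1r addrC subrK.
Qed.

End Goursat.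

(** * The Cauchy and Poisson formulas *)

Section Cauchy.
Context {R : realType}.
Local Notation C := (R[i]).
Implicit Types (z u v zeta : C) (f g : C -> C) (r t : R).

Lemma continuous_normc f z : {for z, continuous (f : C^o -> C^o)} ->
  forall e : R, 0 < e -> exists2 del : R, 0 < del &
    forall h : C, normc h < del -> normc (f (z + h) - f z) <= e.
Proof.
move=> /(@cvgrPdist_le _ C^o _ (nbhs (z : C^o))) fc e e0.
have := fc e%:C; rewrite ltcR => /(_ e0) /nbhs_ballP[/= _ /gt0_complexP[del del0 ->]] B.
exists del => // h hd; have := B (z + h).
rewrite /ball /= opprD addNKr !norm_normc ltcR lecR normcN => /(_ hd).
by rewrite -normcN opprB.
Qed.

Lemma derivable_continuous_circ r g : (forall t, derivable (g : C^o -> C^o) (circ r t) 1) ->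
  forall t, {for t, continuous ((fun t => g (circ r t)) : R -> C^o)}.
Proof.
move=> gd t; apply: (@continuous_comp _ _ _ (circ r : R -> C^o)); first exact: continuous_circ.
by apply: differentiable_continuous; apply/derivable1_diffP; exact: gd.
Qed.

Section Kernel.
Context (zeta : C) (r : R).
Context (zr : normc zeta < r).

Let r0 : 0 < r. Proof. by apply: le_lt_trans zr; exact: normc_ge0. Qed.

Lemma circB_neq0 t : circ r t - zeta != 0.
Proof.
apply/eqP => h; have := normcB_ge (circ r t) zeta.
by rewrite h normc0 normc_circ gtr0_norm // leNgt subr_gt0 zr.
Qed.

Lemma normc_cauchy_kernel t : normc (cauchy_kernel zeta r t) <= r / (r - normc zeta).
Proof.
rewrite normcM normcV normc_circ gtr0_norm // ler_pM2l // lef_pV2.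
- by have := normcB_ge (circ r t) zeta; rewrite normc_circ gtr0_norm.
- by rewrite posrE lt_neqAle normc_ge0 eq_sym andbT; apply: contraNneq (circB_neq0 t) => /eq0_normc ->.
- by rewrite posrE subr_gt0.
Qed.

Lemma continuous_cauchy_kernel : continuous (cauchy_kernel zeta r : R -> C^o).
Proof.
move=> t; apply: cvgM; first exact: continuous_circ.
apply: (@cvgV C^o); first exact: circB_neq0.
by apply: cvgB; [exact: continuous_circ|exact: cvg_cst].
Qed.

(** By [cauchy_kernel_homotopy] the circle may be contracted towards zeta by any factor [a] without
    changing the integral, and continuity at zeta makes [g] nearly constant on the contracted
    circle. *)
Lemma cauchy_kernel_center g :
  (forall z, normc z <= r -> derivable (g : C^o -> C^o) z 1) ->
  segint 0 (2 * pi) (fun t => Re (g (circ r t) * cauchy_kernel zeta r t)) =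
  segint 0 (2 * pi) (fun t => Re (g zeta * cauchy_kernel zeta r t)).
Proof.
move=> gd.
pose K := r / (r - normc zeta) * (2 * pi).
have K0 : 0 < K by rewrite !mulr_gt0 ?invr_gt0 ?subr_gt0 ?pi_gt0.
have ray_in (l t : R) : 0 < l <= 1 -> normc (zeta + l%:C * (circ r t - zeta)) <= r.
  move=> /andP[l0 l1].
  have -> : zeta + l%:C * (circ r t - zeta) = (1 - l)%:C * zeta + l%:C * circ r t.
    by rewrite rmorphB rmorph1; ring.
  apply: le_trans (le_normcD _ _) _; rewrite !normcM !normc_real normc_circ.
  rewrite (gtr0_norm r0) (gtr0_norm l0) (@ger0_norm _ (1 - l)) ?subr_ge0 //.
  have : (1 - l) * normc zeta <= (1 - l) * r by rewrite ler_wpM2l ?subr_ge0 // ltW.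
  by lra.
apply/eqP; rewrite -subr_eq0 -normr_eq0 eq_le normr_ge0 andbT; apply/ler_addgt0Pr => /= e e0.
rewrite add0r.
have gz : {for zeta, continuous (g : C^o -> C^o)}.
  by apply: differentiable_continuous; apply/derivable1_diffP; apply: gd; exact: ltW.
have [del del0 Hd] := continuous_normc gz (divr_gt0 e0 K0).
(* Points of the contracted circle are within 2 a r of zeta, and 2 a r < del. *)
pose a := Num.min 1 (del / (4 * r)).
have a0 : 0 < a by rewrite /a lt_min ltr01 divr_gt0 ?mulr_gt0.
have a1 : a <= 1 by rewrite /a ge_min lexx.
have adel : a * (2 * r) < del.
  apply: (@le_lt_trans _ _ (del / (4 * r) * (2 * r))).
    by rewrite ler_pM2r ?mulr_gt0 // /a ge_min lexx orbT.
  have -> : del / (4 * r) * (2 * r) = del / 2 by field; rewrite gt_eqF.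
  by lra.
have a01 : 0 < a <= 1 by rewrite a0 a1.
rewrite -(@cauchy_kernel_homotopy _ zeta r zr g a a01); last first.
  by move=> l t lb; apply: gd; exact: ray_in.
have cont1 : segcont 0 (2 * pi) (fun t => Re (g (zeta + a%:C * (circ r t - zeta)) * cauchy_kernel zeta r t)).
  move=> t _; apply: (@continuous_comp _ _ _ (fun t => _ : C^o)); last exact: continuous_Re.
  apply: cvgM; last exact: continuous_cauchy_kernel.
  apply: (@continuous_comp _ _ _ (fun t => zeta + a%:C * (circ r t - zeta) : C^o)).
    apply: cvgD; first exact: cvg_cst; apply: cvgM; first exact: cvg_cst.
    by apply: cvgB; [exact: continuous_circ|exact: cvg_cst].
  by apply: differentiable_continuous; apply/derivable1_diffP; apply: gd; apply: ray_in; rewrite a0.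
have cont2 : segcont 0 (2 * pi) (fun t => Re (g zeta * cauchy_kernel zeta r t)).
  move=> t _; apply: (@continuous_comp _ _ _ (fun t => _ : C^o)); last exact: continuous_Re.
  by apply: cvgM; [exact: cvg_cst|exact: continuous_cauchy_kernel].
rewrite -segintB //.
have -> : e = e / K * (r / (r - normc zeta)) * (2 * pi - 0).
  by rewrite subr0 -mulrA -/K divfK // gt_eqF.
apply: segint_norm_le; first by rewrite mulr_ge0 ?pi_ge0.
  by move=> t tt; apply: cvgB; [exact: cont1|exact: cont2].
move=> t _; set k := cauchy_kernel _ _ _.
have -> : Re (g (zeta + a%:C * (circ r t - zeta)) * k) - Re (g zeta * k) =
   Re ((g (zeta + a%:C * (circ r t - zeta)) - g zeta) * k).
  by rewrite mulrBl; case: (_ * k) (_ * k) => ? ? [].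
apply: le_trans (Re_le_normc _) _; rewrite normcM; apply: ler_pM; rewrite ?normc_ge0 //.
  apply: Hd; rewrite normcM normc_real gtr0_norm //; apply: le_lt_trans adel.
  rewrite ler_pM2l //; apply: le_trans (le_normcD _ _) _.
  by rewrite normcN normc_circ gtr0_norm // mulr_natl mulr2n lerD2l ltW.
exact: normc_cauchy_kernel.
Qed.

End Kernel.

Lemma mean_value g r : 0 < r ->
  (forall z, normc z <= r -> derivable (g : C^o -> C^o) z 1) ->
  segint 0 (2 * pi) (fun t => Re (g (circ r t))) = 2 * pi * Re (g 0).
Proof.
move=> r0 gd; have zr : normc (0 : C) < r by rewrite normc0.
have k1 t : cauchy_kernel 0 r t = 1.
  by rewrite /cauchy_kernel subr0 divff //; have := circB_neq0 zr t; rewrite subr0.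
have := cauchy_kernel_center zr gd.
under eq_segint do rewrite k1 mulr1.
under [RHS]eq_segint do rewrite k1 mulr1.
by rewrite segint_cst ?mulr_ge0 ?pi_ge0 // subr0 => ->; rewrite mulrC.
Qed.

Lemma circ_conj r t : circ r t * (circ r t)^*%C = (r ^+ 2)%:C.
Proof.
apply/eqP; rewrite eq_complex /circ /=; apply/andP; split; apply/eqP; last by ring.
by rewrite -[RHS]mulr1 -(cos2Dsin2 t); ring.
Qed.

Lemma mulc_conj z : z * z^*%C = (normc z ^+ 2)%:C.
Proof.
apply/eqP; rewrite eq_complex sqr_normcE; case: z => a b /=.
by apply/andP; split; apply/eqP; ring.
Qed.

Lemma Re_conj z : Re (z^*%C) = Re z. Proof. by case: z. Qed.

Lemma derivable_mobius (a b u z : C) : b - u * z != 0 ->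
  derivable ((fun z => a / (b - u * z)) : C^o -> C^o) z 1.
Proof.
move=> nz.
have d1 : derivable ((fun z => b - u * z) : C^o -> C^o) z 1.
  apply: (@derivableB _ C^o C^o); first exact: derivable_cst.
  by apply: (@derivableM _ C^o); [exact: derivable_cst|exact: derivable_id].
apply: (@derivableM _ C^o); first exact: derivable_cst.
by apply: (@derivableV _ C^o).
Qed.

(** The zero of this expression in [z] is the reflection of zeta in the circle, which lies outside
    the closed disk of radius [r]. *)
Lemma conj_mul_neq (zeta z : C) r : normc zeta < r -> normc z <= r ->
  (r ^+ 2)%:C - zeta^*%C * z != 0.
Proof.
move=> zr zr'; apply/eqP => /eqP; rewrite subr_eq0 => /eqP /(congr1 (@normc _)).
have r0 : 0 < r by apply: le_lt_trans zr; exact: normc_ge0.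
rewrite normcM normc_conj normc_real ger0_norm ?sqr_ge0 // => E.
have : normc zeta * normc z < r ^+ 2.
  rewrite expr2; apply: (@le_lt_trans _ _ (normc zeta * r)).
    by rewrite ler_wpM2l ?normc_ge0.
  by rewrite ltr_pM2r.
by rewrite -E ltxx.
Qed.

(** On the circle the conjugate of z is r^2 / z, so the conjugate of the kernel is r^2 / (r^2 -
    conj(zeta) z), analytic up to the circle with value 1 at the origin. Conjugation preserves real
    parts, and the mean value property concludes. *)
Lemma segint_cauchy_kernel (zeta u : C) r : normc zeta < r ->
  segint 0 (2 * pi) (fun t => Re (u * cauchy_kernel zeta r t)) = 2 * pi * Re u.
Proof.
move=> zr; have r0 : 0 < r by apply: le_lt_trans zr; exact: normc_ge0.
have E t : Re (u * cauchy_kernel zeta r t) =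
    Re ((u^*%C * (r ^+ 2)%:C) / ((r ^+ 2)%:C - zeta^*%C * circ r t)).
  rewrite -[LHS]Re_conj; congr (Re _).
  have c0 : circ r t != 0 by have := @circB_neq0 0 r _ t; rewrite subr0 normc0; apply.
  have cz := circB_neq0 zr t.
  have ccz : (circ r t)^*%C - zeta^*%C != 0 by rewrite -rmorphB conjc_eq0.
  rewrite -(circ_conj r t) /cauchy_kernel; move: (circ r t) c0 cz ccz => c c0 cz ccz.
  rewrite rmorphM /= fmorph_div rmorphB /=.
  field; apply/andP; split; last exact: ccz.
  have -> : c * c^*%C - zeta^*%C * c = c * (c^*%C - zeta^*%C) by ring.
  exact: mulf_neq0.
under eq_segint do rewrite E.
have -> := @mean_value (fun z => (u^*%C * (r ^+ 2)%:C) / ((r ^+ 2)%:C - zeta^*%C * z)) r r0.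
  rewrite mulr0 subr0 mulfK ?Re_conj //.
  by rewrite -(rmorph0 (@real_complex R)) (inj_eq (@complexI R)) expf_neq0 // gt_eqF.
by move=> z zle; apply: derivable_mobius; exact: conj_mul_neq.
Qed.

Theorem cauchy_formula (zeta : C) r g : normc zeta < r ->
  (forall z, normc z <= r -> derivable (g : C^o -> C^o) z 1) ->
  segint 0 (2 * pi) (fun t => Re (g (circ r t) * cauchy_kernel zeta r t)) =
  2 * pi * Re (g zeta).
Proof. by move=> zr gd; rewrite cauchy_kernel_center // segint_cauchy_kernel. Qed.

Definition poisson_kernel r (zeta : C) t : R :=
  (r ^+ 2 - normc zeta ^+ 2) / normc (circ r t - zeta) ^+ 2.

(** The Cauchy formula is applied to [g] times the auxiliary [G], which is analytic up to the
    circle, equals 1 at zeta, and turns the Cauchy kernel into the real Poisson kernel on the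
    circle. *)
Theorem poisson_formula (zeta : C) r g : normc zeta < r ->
  (forall z, normc z <= r -> derivable (g : C^o -> C^o) z 1) ->
  segint 0 (2 * pi) (fun t => poisson_kernel r zeta t * Re (g (circ r t))) =
  2 * pi * Re (g zeta).
Proof.
move=> zr gd; have r0 : 0 < r by apply: le_lt_trans zr; exact: normc_ge0.
pose G z := (r ^+ 2 - normc zeta ^+ 2)%:C / ((r ^+ 2)%:C - zeta^*%C * z).
have Gz : G zeta = 1.
  rewrite /G (mulrC zeta^*%C) mulc_conj -rmorphB divff //.
  rewrite -(rmorph0 (@real_complex R)) (inj_eq (@complexI R)) subr_eq0.
  by rewrite gt_eqF // ltr_pXn2r // nnegrE ?normc_ge0 // ltW.
have := @cauchy_formula zeta r (fun z => g z * G z) zr.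
rewrite Gz mulr1 => <-; last first.
  move=> z zle; apply: (@derivableM _ C^o); first exact: gd.
  by apply: derivable_mobius; exact: conj_mul_neq.
apply: eq_segint => t _.
have c0 : circ r t != 0 by have := @circB_neq0 0 r _ t; rewrite subr0 normc0; apply.
have cz := circB_neq0 zr t.
have ccz : (circ r t)^*%C - zeta^*%C != 0 by rewrite -rmorphB conjc_eq0.
have -> : g (circ r t) * G (circ r t) * cauchy_kernel zeta r t =
   (poisson_kernel r zeta t)%:C * g (circ r t).
  rewrite /poisson_kernel rmorphM /= fmorphV /= -mulc_conj rmorphB /= /G /cauchy_kernel.
  rewrite [X in _ / (X - _)](_ : _ = circ r t * (circ r t)^*%C); last by rewrite circ_conj.
  field; apply/and3P; split; [exact: ccz|exact: cz|].
  have -> : circ r t * (circ r t)^*%C - zeta^*%C * circ r t =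
    circ r t * ((circ r t)^*%C - zeta^*%C) by ring.
  exact: mulf_neq0.
by case: (g _) => x y /=; ring.
Qed.

End Cauchy.

(** * Littlewood subordination *)

Section Analytic.
Context {R : realType}.
Local Notation C := (R[i]).
Implicit Types (z u v zeta : C) (f g : C -> C) (r t : R).

Lemma disk_circ r t : 0 <= r < 1 -> disk (circ r t).
Proof. by move=> /andP[r0 r1]; apply/diskE; rewrite normc_circ ger0_norm. Qed.

Lemma analytic_comp f phi : analytic_on_disk f -> analytic_on_disk phi ->
  (forall z, disk z -> disk (phi z)) -> analytic_on_disk (f \o phi).
Proof.
move=> fa pa pd z dz; apply/derivable1_diffP; apply: (@differentiable_comp _ C^o C^o C^o).
  by apply/derivable1_diffP; exact: pa.
by apply/derivable1_diffP; apply: fa; exact: pd.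
Qed.

Lemma analytic_mul f g : analytic_on_disk f -> analytic_on_disk g ->
  analytic_on_disk (fun z => f z * g z).
Proof. by move=> fa ga z dz; apply: (@derivableM _ C^o); [exact: fa|exact: ga]. Qed.

Lemma analytic_add f g : analytic_on_disk f -> analytic_on_disk g ->
  analytic_on_disk (fun z => f z + g z).
Proof. by move=> fa ga z dz; apply: (@derivableD _ C^o C^o); [exact: fa|exact: ga]. Qed.

Lemma analytic_cst (a : C) : analytic_on_disk (fun=> a).
Proof. by move=> z dz; exact: derivable_cst. Qed.

Lemma analytic_id : analytic_on_disk (fun z : C => z).
Proof. by move=> z dz; exact: derivable_id. Qed.

Lemma continuous_circ_comp f r : analytic_on_disk f -> 0 <= r < 1 ->
  continuous ((fun t => f (circ r t)) : R -> C^o).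
Proof.
move=> fa rb; apply: derivable_continuous_circ => t; apply: fa; exact: disk_circ.
Qed.

Lemma continuous_normc2 (T : topologicalType) (h : T -> C^o) (x : T) : {for x, continuous h} ->
  {for x, continuous ((fun y : T => normc (h y) ^+ 2) : T -> R)}.
Proof.
move=> hc; rewrite (_ : (fun _ => _) = (fun y : T => Re (h y) ^+ 2 + Im (h y) ^+ 2)); last first.
  by apply/funext => y; rewrite sqr_normcE.
have cR : {for x, continuous ((fun y : T => Re (h y)) : T -> R)}.
  by apply: (@continuous_comp _ _ _ h) => //; exact: continuous_Re.
have cI : {for x, continuous ((fun y : T => Im (h y)) : T -> R)}.
  by apply: (@continuous_comp _ _ _ h) => //; exact: continuous_Im.
by apply: cvgD; apply: cvgM.
Qed.

Lemma exists_phase (z : C) : exists2 u : C, normc u = 1 & Re (u * z) = normc z.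
Proof.
have [->|z0] := eqVneq z 0.
  by exists 1; rewrite ?normc1 // mulr0 normc0.
have nz : normc z != 0 by apply: contra z0 => /eqP/eq0_normc/eqP.
exists (z^*%C / (normc z)%:C).
  by rewrite normcM normcV normc_real normc_conj ger0_norm ?normc_ge0 // divff.
rewrite mulrAC (mulrC z^*%C) mulc_conj expr2 rmorphM mulfK //.
by rewrite (fmorph_eq0 (@real_complex R)).
Qed.

(** Harnack's bounds: |circ r t - zeta| lies between r - |zeta| and r + |zeta|. *)
Lemma poisson_kernel_bounds zeta r t : normc zeta < r ->
  (r - normc zeta) / (r + normc zeta) <= poisson_kernel r zeta t <=
  (r + normc zeta) / (r - normc zeta).
Proof.
move=> zr; have r0 : 0 < r by apply: le_lt_trans zr; exact: normc_ge0.
have d0 : 0 < r - normc zeta by rewrite subr_gt0.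
have s0 : 0 < r + normc zeta by rewrite ltr_wpDr ?normc_ge0.
have := normcB_ge (circ r t) zeta; rewrite normc_circ gtr0_norm // => cz.
have cz0 : 0 < normc (circ r t - zeta) by apply: lt_le_trans cz.
have cz2 : normc (circ r t - zeta) <= r + normc zeta.
  by apply: le_trans (le_normcD _ _) _; rewrite normcN normc_circ gtr0_norm.
have n0 : 0 <= r ^+ 2 - normc zeta ^+ 2 by rewrite subr_sqr mulr_ge0 // ltW.
rewrite /poisson_kernel; apply/andP; split.
  have -> : (r - normc zeta) / (r + normc zeta) =
      (r ^+ 2 - normc zeta ^+ 2) / (r + normc zeta) ^+ 2 by field; rewrite gt_eqF.
  rewrite ler_wpM2l // lef_pV2 ?posrE ?exprn_gt0 // ler_pXn2r // nnegrE;
  exact: ltW.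
have -> : (r + normc zeta) / (r - normc zeta) =
    (r ^+ 2 - normc zeta ^+ 2) / (r - normc zeta) ^+ 2 by field; rewrite gt_eqF.
rewrite ler_wpM2l // lef_pV2 ?posrE ?exprn_gt0 // ler_pXn2r // nnegrE; exact: ltW.
Qed.

Lemma poisson_kernel_ge0 zeta r t : normc zeta < r -> 0 <= poisson_kernel r zeta t.
Proof.
move=> zr; rewrite divr_ge0 ?sqr_ge0 // subr_ge0 ler_pXn2r ?nnegrE ?normc_ge0 ?ltW //.
by apply: le_lt_trans zr; exact: normc_ge0.
Qed.

Lemma continuous_poisson_kernel zeta r : normc zeta < r -> continuous (poisson_kernel r zeta).
Proof.
move=> zr t; apply: cvgM; first exact: cvg_cst.
have cz := circB_neq0 zr t.
apply: cvgV; first by rewrite expf_neq0 //; apply: contra cz => /eqP/eq0_normc/eqP.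
apply: (@continuous_normc2 R (fun t => circ r t - zeta)).
by apply: cvgB; [exact: continuous_circ|exact: cvg_cst].
Qed.

(** Harnack's inequality for the positive harmonic function 1 - Re (u phi), where the unimodular [u]
    makes u phi(z) equal to |phi z|. The 2 bounds r + |z|, and [r] tends to 1. *)
Lemma normc_self_map phi z : analytic_on_disk phi -> (forall z, disk z -> disk (phi z)) ->
  disk z -> (1 - normc (phi 0)) * (1 - normc z) / 2 <= 1 - normc (phi z).
Proof.
move=> pa pd dz; have z1 := (diskE z).1 dz.
have p0 : normc (phi 0) < 1 by apply/diskE/pd/diskE; rewrite normc0.
suff H r : normc z < r -> r < 1 ->
    (1 - normc (phi 0)) * (r - normc z) / 2 <= 1 - normc (phi z).
  apply/ler_addgt0Pr => /= e e0.
  (* A radius strictly between |z| and 1, and within [e] of 1. *)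
  pose r := Num.max ((normc z + 1) / 2) (1 - e).
  have r1 : r < 1 by rewrite /r gt_max; apply/andP; split; lra.
  have zr : normc z < r by rewrite /r lt_max; apply/orP; left; lra.
  have re : 1 - e <= r by rewrite /r le_max lexx orbT.
  have := H r zr r1; have := normc_ge0 (phi 0) => q0 Hr.
  have : (1 - normc (phi 0)) * (1 - r) <= 1 * e by apply: ler_pM; lra.
  by lra.
move=> zr r1; have r0 : 0 < r by apply: le_lt_trans zr; exact: normc_ge0.
have [u u1 uz] := exists_phase (phi z).
pose g (z : C) := 1 - u * phi z.
have Reg z' : disk z' -> 1 - normc (phi z') <= Re (g z').
  move=> dz'; have -> : Re (g z') = 1 - Re (u * phi z') by rewrite /g; case: (u * _).
  rewrite lerD2l lerN2; apply: le_trans (ler_norm _) _; apply: le_trans (Re_le_normc _) _.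
  by rewrite normcM u1 mul1r.
have gd z' : normc z' <= r -> derivable (g : C^o -> C^o) z' 1.
  move=> z'r; have dz' : disk z' by apply/diskE; exact: le_lt_trans r1.
  apply: (@derivableB _ C^o C^o); first exact: derivable_cst.
  by apply: (@derivableM _ C^o); [exact: derivable_cst|exact: pa].
have cg : continuous (fun t => Re (g (circ r t))).
  move=> t; apply: (@continuous_comp _ _ _ (fun t => g (circ r t) : C^o)); last exact: continuous_Re.
  by apply: derivable_continuous_circ => t'; apply: gd; rewrite normc_circ gtr0_norm.
have := poisson_formula zr gd.
have -> : Re (g z) = 1 - normc (phi z) by rewrite -uz /g; case: (u * _).
have := mean_value r0 gd.
set K := (r - normc z) / (r + normc z).
have K0 : 0 <= K by rewrite divr_ge0 ?subr_ge0 ?addr_ge0 ?normc_ge0 // ltW.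
move=> mv pf.
have le : K * segint 0 (2 * pi) (fun t => Re (g (circ r t))) <=
     segint 0 (2 * pi) (fun t => poisson_kernel r z t * Re (g (circ r t))).
  rewrite -segintZ; last by move=> t _; exact: cg.
  apply: le_segint => [t _|t _|t _].
  - by apply: cvgM; [exact: cvg_cst|exact: cg].
  - by apply: cvgM; [exact: continuous_poisson_kernel|exact: cg].
  - apply: ler_wpM2r; last by case/andP: (poisson_kernel_bounds t zr).
    have dc : disk (circ r t) by apply: disk_circ; rewrite r1 ltW.
    by apply: le_trans (Reg _ dc); rewrite subr_ge0 ltW //; exact/diskE/pd.
rewrite mv pf mulrCA ler_pM2l ?mulr_gt0 ?pi_gt0 // in le.
apply: le_trans le; have d0 : disk (0 : C) by apply/diskE; rewrite normc0.
apply: (@le_trans _ _ (K * (1 - normc (phi 0)))); last by rewrite ler_wpM2l ?Reg.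
rewrite [K * _]mulrC -mulrA ler_pM2l ?subr_gt0 // /K ler_pM2l ?subr_gt0 //.
rewrite lef_pV2 ?posrE //; last by rewrite ltr_wpDr ?normc_ge0.
by have := normc_ge0 z; lra.
Qed.

(** Poisson's formula applied to u f^2, with [u] unimodular and u f(zeta)^2 = |f(zeta)|^2; elsewhere
    Re (u f^2) is at most |f|^2. *)
Lemma subharmonic_sqr f zeta r : analytic_on_disk f -> normc zeta < r -> r < 1 ->
  normc (f zeta) ^+ 2 <= (2 * pi)^-1 *
    segint 0 (2 * pi) (fun t => poisson_kernel r zeta t * normc (f (circ r t)) ^+ 2).
Proof.
move=> fa zr r1; have r0 : 0 < r by apply: le_lt_trans zr; exact: normc_ge0.
have [u u1 uz] := exists_phase (f zeta * f zeta).
have cf : continuous ((fun t => f (circ r t)) : R -> C^o).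
  by apply: continuous_circ_comp => //; rewrite r1 ltW.
have gd z : normc z <= r -> derivable ((fun z => u * (f z * f z)) : C^o -> C^o) z 1.
  move=> z'r; have dz' : disk z by apply/diskE; exact: le_lt_trans r1.
  apply: (@derivableM _ C^o); first exact: derivable_cst.
  by apply: (@derivableM _ C^o); exact: fa.
have pi2 : 0 < 2 * pi :> R by rewrite mulr_gt0 ?pi_gt0.
rewrite mulrC ler_pdivlMr // mulrC expr2 -normcM -uz -(poisson_formula zr gd).
apply: le_segint => [t _|t _|t _].
- apply: cvgM; first exact: continuous_poisson_kernel.
  apply: (@continuous_comp _ _ _ (fun t => u * (f (circ r t) * f (circ r t)) : C^o)); last exact: continuous_Re.
  by apply: cvgM; [exact: cvg_cst|apply: cvgM; exact: cf].
- apply: cvgM; first exact: continuous_poisson_kernel.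
  exact: (@continuous_normc2 _ (fun t => f (circ r t)) t (cf t)).
- apply: ler_wpM2l; first exact: poisson_kernel_ge0.
  apply: le_trans (ler_norm _) _; apply: le_trans (Re_le_normc _) _.
  by rewrite !normcM u1 mul1r expr2.
Qed.

(** With its circle point fixed, the Poisson kernel is the real part of (c + zeta) / (c - zeta),
    analytic in zeta. Composing with [phi] keeps this, so the mean value property applies. *)
Lemma mean_poisson_kernel phi (rho r t : R) : analytic_on_disk phi -> 0 < r -> r < 1 -> 0 < rho ->
  (forall z, normc z <= r -> normc (phi z) < rho) ->
  segint 0 (2 * pi) (fun s => poisson_kernel rho (phi (circ r s)) t) =
  2 * pi * poisson_kernel rho (phi 0) t.
Proof.
move=> pa r0 r1 rho0 pr.
pose h z := (circ rho t + phi z) / (circ rho t - phi z).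
have Reh z : normc z <= r -> Re (h z) = poisson_kernel rho (phi z) t.
  move=> zr; rewrite /h /poisson_kernel; move: (phi z) (circB_neq0 (pr _ zr) t) => v nz.
  have c2 : Re (circ rho t) ^+ 2 + Im (circ rho t) ^+ 2 = rho ^+ 2.
    by rewrite -sqr_normcE normc_circ real_normK ?num_real.
  have n0 : normc (circ rho t - v) ^+ 2 != 0.
    by rewrite expf_neq0 //; apply: contra nz => /eqP/eq0_normc/eqP.
  have -> : (circ rho t + v) / (circ rho t - v) =
     (normc (circ rho t - v) ^+ 2)^-1%:C * ((circ rho t + v) * (circ rho t - v)^*%C).
    rewrite rmorphV ?unitfE //= -mulc_conj; field.
    have ccz : (circ rho t)^*%C - v^*%C != 0 by rewrite -rmorphB conjc_eq0.
    by apply/andP; split; [exact: ccz|exact: nz].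
  rewrite mulrC -c2 !sqr_normcE; case: (circ rho t) (v) => a b [c d] /=; ring.
have hd z : normc z <= r -> derivable (h : C^o -> C^o) z 1.
  move=> zr; have dz : disk z by apply/diskE; exact: le_lt_trans r1.
  apply: (@derivableM _ C^o).
    by apply: (@derivableD _ C^o C^o); [exact: derivable_cst|exact: pa].
  apply: (@derivableV _ C^o); first exact: (circB_neq0 (pr _ zr)).
  by apply: (@derivableB _ C^o C^o); [exact: derivable_cst|exact: pa].
rewrite -Reh ?normc0 ?ltW // -(mean_value r0 hd).
by apply: eq_segint => s _; rewrite Reh // normc_circ gtr0_norm.
Qed.

End Analytic.

(** * Measurability, exchange of integrals and subordination *)

Section Littlewood.
Context {R : realType}.
Local Notation C := (R[i]).
Local Notation mu := (@lebesgue_measure R).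
Local Notation mR := (measurableTypeR R).
Implicit Types (z u v zeta : C) (f g : C -> C) (r t : R).

Lemma segint_EFin (a b : R) (f : R -> R) : segcont a b f ->
  (\int[mu]_(x in `[a, b]) (f x)%:E = (segint a b f)%:E)%E.
Proof.
move=> fc; rewrite /segint /Rintegral fineK //.
by apply: integrable_fin_num => //; exact: segcont_integrable.
Qed.

Lemma fubini_tonelli_setX (d1 d2 : measure_display) (T1 : measurableType d1)
    (T2 : measurableType d2) (m1 : {sigma_finite_measure set T1 -> \bar R})
    (m2 : {sigma_finite_measure set T2 -> \bar R})
    (A : set T1) (B : set T2) (F : T1 * T2 -> \bar R) :
  measurable A -> measurable B ->
  measurable_fun setT F -> (forall x, 0 <= F x)%E ->
  (\int[m1]_(x in A) \int[m2]_(y in B) F (x, y) =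
   \int[m2]_(y in B) \int[m1]_(x in A) F (x, y))%E.
Proof.
move=> mA mB mF F0.
pose G : T1 * T2 -> \bar R := F \_ (A `*` B).
have G0 x : (0 <= G x)%E by rewrite /G patchE; case: ifP.
have mG : measurable_fun setT G.
  apply/(measurable_restrictT _ _).1; first exact: measurableX.
  exact: measurable_funS mF.
have := @fubini_tonelli _ _ _ _ R m1 m2 G mG G0.
have GE x y : G (x, y) = (((fun x => ((fun y => F (x, y)) \_ B) y) \_ A) x).
  rewrite /G !patchE; have [/set_mem xA|xA] := boolP (x \in A); last first.
    by rewrite ifF //; apply/negbTE; apply: contra xA; rewrite !inE => -[].
  have [/set_mem yB|yB] := boolP (y \in B); first by rewrite ifT // inE.
  by rewrite ifF //; apply/negbTE; apply: contra yB; rewrite !inE => -[].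
move=> E; rewrite integral_mkcond [RHS]integral_mkcond.
transitivity (\int[m1]_x \int[m2]_y G (x, y))%E.
  apply: eq_integral => x _; rewrite patchE; case: ifPn => xA.
    by rewrite integral_mkcond; apply: eq_integral => y _; rewrite GE !patchE xA.
  by rewrite integral0_eq // => y _; rewrite GE !patchE (negbTE xA).
rewrite E; apply: eq_integral => y _; rewrite [RHS]patchE; case: ifPn => yB.
  rewrite [RHS]integral_mkcond; apply: eq_integral => x _; rewrite GE !patchE yB.
  by case: ifP.
by apply: integral0_eq => x _; rewrite GE !patchE (negbTE yB); case: ifP.
Qed.

Lemma measurable_integral_snd (B : set mR) (F : mR * mR -> \bar R) :
  measurable B -> measurable_fun setT F -> (forall x, 0 <= F x)%E ->
  measurable_fun setT (fun x => \int[mu]_(y in B) F (x, y))%E.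
Proof.
move=> mB mF F0; pose G : mR * mR -> \bar R := F \_ (setT `*` B).
have G0 x : (0 <= G x)%E by rewrite /G patchE; case: ifP.
have mG : measurable_fun setT G.
  apply/(measurable_restrictT _ _).1; first exact: measurableX.
  exact: measurable_funS mF.
have := @measurable_fun_fubini_tonelli_F _ _ _ _ R mu G mG G0.
apply: eq_measurable_fun => x _; rewrite /fubini_F [RHS]integral_mkcond.
apply: eq_integral => y _; rewrite /G !patchE.
by congr (if _ then _ else _); apply/idP/idP; rewrite !inE => // -[].
Qed.

Lemma measurable_integral_fst (A : set mR) (F : mR * mR -> \bar R) :
  measurable A -> measurable_fun setT F -> (forall x, 0 <= F x)%E ->
  measurable_fun setT (fun y => \int[mu]_(x in A) F (x, y))%E.
Proof.
move=> mA mF F0; apply: (@measurable_integral_snd A (fun p => F (p.2, p.1))) => //.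
by apply: (measurableT_comp mF); exact: measurable_fun_pair.
Qed.

Lemma measurable_continuous_fst (h : R -> R) : continuous h ->
  measurable_fun setT (fun p : mR * mR => h p.1).
Proof.
move=> hc; apply: (@measurableT_comp _ _ _ _ _ _ h setT (fst : mR * mR -> mR)) => //.
exact: continuous_measurable_fun.
Qed.

Lemma measurable_continuous_snd (h : R -> R) : continuous h ->
  measurable_fun setT (fun p : mR * mR => h p.2).
Proof.
move=> hc; apply: (@measurableT_comp _ _ _ _ _ _ h setT (snd : mR * mR -> mR)) => //.
exact: continuous_measurable_fun.
Qed.

Definition circle_int f r : \bar R :=
  (\int[mu]_(t in `[0%R, (2 * pi)%R]) (normc (f (circ r t)) ^+ 2)%:E)%E.

Lemma circle_intE f r : analytic_on_disk f -> 0 <= r < 1 ->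
  circle_int f r = (segint 0 (2 * pi) (fun t => normc (f (circ r t)) ^+ 2))%:E.
Proof.
move=> fa rb; apply: segint_EFin => t _.
apply: (@continuous_normc2 _ _ (fun t => f (circ r t)) t); exact: continuous_circ_comp.
Qed.

Lemma measurable_poisson rho (x : mR * mR -> C) (t : mR * mR -> R) :
  measurable_fun setT (fun p => Re (x p)) -> measurable_fun setT (fun p => Im (x p)) ->
  measurable_fun setT t -> measurable_fun setT (fun p => poisson_kernel rho (x p) (t p)).
Proof.
move=> mRe mIm mt.
have msqr (h : mR * mR -> R) : measurable_fun setT h -> measurable_fun setT (fun p => h p ^+ 2).
  by move=> mh; apply: measurable_funX.
(* The reciprocal is written as a power of exponent -1, which is measurable on the whole line and
   agrees with the inverse on nonnegative reals, 0 included. *)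
rewrite (_ : (fun _ => _) = (fun p => (rho ^+ 2 - (Re (x p) ^+ 2 + Im (x p) ^+ 2)) *
   powR ((rho * cos (t p) - Re (x p)) ^+ 2 + (rho * sin (t p) - Im (x p)) ^+ 2) (-1))); last first.
  apply/funext => p; rewrite /poisson_kernel powR_inv1 ?addr_ge0 ?sqr_ge0 // !sqr_normcE.
  by congr (_ / _); case: (x p).
have mc : measurable_fun setT (fun p => rho * cos (t p)).
  apply: measurable_funM => //; apply: (measurableT_comp _ mt).
  by apply: continuous_measurable_fun; exact: continuous_cos.
have ms : measurable_fun setT (fun p => rho * sin (t p)).
  apply: measurable_funM => //; apply: (measurableT_comp _ mt).
  by apply: continuous_measurable_fun; exact: continuous_sin.
apply: measurable_funM.
  by apply: measurable_funB => //; apply: measurable_funD; exact: msqr.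
apply: (@measurableT_comp _ _ _ _ _ _ (fun y => powR y (-1)) setT (fun p =>
  (rho * cos (t p) - Re (x p)) ^+ 2 + (rho * sin (t p) - Im (x p)) ^+ 2)).
  exact: measurable_powR.
by apply: measurable_funD; apply: msqr; apply: measurable_funB.
Qed.

(* |f (phi z)|^2 is at most the Poisson mean of |f|^2 on the circle of radius rho
   at phi z; averaging over |z| = r turns it into the Poisson mean at phi 0. *)
Theorem littlewood_circle f phi (r rho : R) : analytic_on_disk f -> analytic_on_disk phi ->
  (forall z, disk z -> disk (phi z)) ->
  0 < r -> r < 1 -> 0 < rho -> rho < 1 ->
  (forall z, normc z <= r -> normc (phi z) < rho) ->
  (circle_int (f \o phi) r <=
   ((rho + normc (phi 0)) / (rho - normc (phi 0)))%:E * circle_int f rho)%E.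
Proof.
move=> fa pa pd r0 r1 rho0 rho1 pr.
have cr : 0 <= r < 1 by rewrite ltW.
have crho : 0 <= rho < 1 by rewrite ltW.
have pc s : normc (phi (circ r s)) < rho by apply: pr; rewrite normc_circ gtr0_norm.
have p0 : normc (phi 0) < rho by apply: pr; rewrite normc0 ltW.
have pi2 : 0 < 2 * pi :> R by rewrite mulr_gt0 ?pi_gt0.
have cphi : continuous ((fun s => phi (circ r s)) : R -> C^o) by exact: continuous_circ_comp.
have cf : continuous ((fun s => f (circ rho s)) : R -> C^o) by exact: continuous_circ_comp.
have cf2 : continuous (fun s => normc (f (circ rho s)) ^+ 2).
  by move=> s; apply: (@continuous_normc2 _ _ (fun t => f (circ rho t)) s); exact: cf.
have mf2 := continuous_measurable_fun cf2.
pose P (p : mR * mR) := poisson_kernel rho (phi (circ r p.1)) p.2.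
have mP : measurable_fun setT P.
  apply: (@measurable_poisson rho (fun p => phi (circ r p.1)) snd) => //.
  - apply: (@measurable_continuous_fst (fun s => Re (phi (circ r s)))) => s.
    by apply: (@continuous_comp _ _ _ (fun s => phi (circ r s) : C^o)); [exact: cphi|exact: continuous_Re].
  - apply: (@measurable_continuous_fst (fun s => Im (phi (circ r s)))) => s.
    by apply: (@continuous_comp _ _ _ (fun s => phi (circ r s) : C^o)); [exact: cphi|exact: continuous_Im].
have P0 p : 0 <= P p by exact: poisson_kernel_ge0.
pose F (p : mR * mR) := ((2 * pi)^-1 * P p * normc (f (circ rho p.2)) ^+ 2)%:E.
have F0 p : (0 <= F p)%E.
  by rewrite lee_fin mulr_ge0 ?sqr_ge0 // mulr_ge0 // invr_ge0 ltW.
have mF : measurable_fun setT F.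
  apply/measurable_EFinP; apply: measurable_funM; first exact: measurable_funM.
  exact: (@measurable_continuous_snd (fun t => normc (f (circ rho t)) ^+ 2)).
have mD : measurable (`[0, 2 * pi]%classic : set R) by [].
apply: (@le_trans _ _ (\int[mu]_(s in `[0%R, (2 * pi)%R]) \int[mu]_(t in `[0%R, (2 * pi)%R]) F (s, t))%E).
  apply: ge0_le_integral => //.
  - by move=> s _; rewrite lee_fin sqr_ge0.
  - apply/measurable_EFinP; apply: measurable_funTS; apply: continuous_measurable_fun => s.
    apply: (@continuous_normc2 _ _ (fun t => (f \o phi) (circ r t)) s).
    exact: (@continuous_circ_comp _ (f \o phi) r (analytic_comp fa pa pd) cr s).
  - apply: measurable_funTS.
    exact: measurable_integral_snd.
  - move=> s _; rewrite segint_EFin; last first.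
      move=> t _; apply: cvgM; last exact: cf2.
      apply: cvgM; first exact: cvg_cst.
      exact: (@continuous_poisson_kernel _ (phi (circ r s)) rho (pc s) t).
    rewrite lee_fin; apply: le_trans (subharmonic_sqr fa (pc s) rho1) _.
    rewrite -segintZ; last first.
      move=> t _; apply: cvgM; last exact: cf2.
      exact: (@continuous_poisson_kernel _ (phi (circ r s)) rho (pc s) t).
    by rewrite le_eqVlt (eq_segint (g := fun t => (2 * pi)^-1 * P (s, t) * normc (f (circ rho t)) ^+ 2)) ?eqxx // => t _; rewrite mulrA.
rewrite fubini_tonelli_setX //.
rewrite -ge0_integralZl //; last 3 first.
- by apply/measurable_EFinP; exact: measurable_funTS.
- by move=> t _; rewrite lee_fin sqr_ge0.
- by rewrite lee_fin divr_ge0 ?subr_ge0 ?addr_ge0 ?normc_ge0 ?(ltW rho0) ?(ltW p0).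
apply: ge0_le_integral => //.
- by move=> t _; apply: integral_ge0 => s _; exact: F0.
- by apply: measurable_funTS; exact: measurable_integral_fst.
- apply: measurable_funTS; apply/measurable_EFinP; apply: measurable_funM => //.
move=> t _.
have cP s : {for s, continuous (fun s => P (s, t))}.
  apply: cvgM.
    apply: cvgB; first exact: cvg_cst.
    exact: (@continuous_normc2 _ _ (fun s => phi (circ r s)) s (cphi s)).
  apply: cvgV.
    have := circB_neq0 (pc s) t; apply: contra; rewrite expf_eq0 /= => /eqP/eq0_normc/eqP.
    exact.
  apply: (@continuous_normc2 _ _ (fun s => circ rho t - phi (circ r s)) s).
  by apply: cvgB; [exact: cvg_cst|exact: cphi].
under eq_integral do rewrite /F /= -mulrAC EFinM.
rewrite ge0_integralZl //; last 3 first.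
- by apply/measurable_EFinP; apply: measurable_funTS; apply: continuous_measurable_fun => s; exact: cP.
- by move=> s _; rewrite lee_fin.
- by rewrite lee_fin mulr_ge0 ?sqr_ge0 // invr_ge0 ltW.
rewrite segint_EFin; last by move=> s _; exact: cP.
rewrite (mean_poisson_kernel t pa r0 r1 rho0 pr) -EFinM lee_fin.
have E (c n k : R) : c != 0 -> c^-1 * n * (c * k) = k * n by move=> c0; field.
rewrite E ?gt_eqF // ler_wpM2r ?sqr_ge0 //.
by case/andP: (poisson_kernel_bounds t p0).
Qed.

End Littlewood.

(** * Power series and Parseval *)

Section PowerSeries.
Context {R : realType}.
Local Notation C := (R[i]).
Implicit Types (z u v zeta : C) (f g : C -> C) (r t s : R).

(** The wrapper fixes the topology [C^o] on the codomain and keeps continuity as one closed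
    statement under the rules below. *)
Variant ccont (h : R -> C) : Prop := Ccont of continuous (h : R -> C^o).

Lemma ccontM (h k : R -> C) : ccont h -> ccont k -> ccont (fun t => h t * k t).
Proof. by move=> [hc] [kc]; split=> t; apply: cvgM; [exact: hc|exact: kc]. Qed.
Lemma ccontD (h k : R -> C) : ccont h -> ccont k -> ccont (fun t => h t + k t).
Proof. by move=> [hc] [kc]; split=> t; apply: cvgD; [exact: hc|exact: kc]. Qed.
Lemma ccont_cst (a : C) : ccont (fun=> a).
Proof. by split=> t; exact: cvg_cst. Qed.
Lemma ccont_Re (h : R -> C) : ccont h -> continuous (fun t => Re (h t)).
Proof.
by move=> [hc] t; apply: (@continuous_comp _ _ _ (h : R -> C^o)); [exact: hc|exact: continuous_Re].
Qed.
Lemma ccont_Im (h : R -> C) : ccont h -> continuous (fun t => Im (h t)).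
Proof.
by move=> [hc] t; apply: (@continuous_comp _ _ _ (h : R -> C^o)); [exact: hc|exact: continuous_Im].
Qed.
Lemma ccontX (h : R -> C) n : ccont h -> ccont (fun t => h t ^+ n).
Proof.
move=> hc; elim: n => [|n IH]; first exact: ccont_cst.
rewrite (_ : (fun _ => _) = (fun t => h t * h t ^+ n)); first exact: ccontM.
by apply/funext => t; rewrite exprS.
Qed.
Lemma ccontV (h : R -> C) : (forall t, h t != 0) -> ccont h -> ccont (fun t => (h t)^-1).
Proof. by move=> h0 [hc]; split=> t; apply: (@cvgV C^o); [exact: h0|exact: hc]. Qed.
Lemma ccont_circ r : ccont (circ r).
Proof. by split; exact: continuous_circ. Qed.
Lemma ccont_sum (n : nat) (h : nat -> R -> C) : (forall k, ccont (h k)) ->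
  ccont (fun t => \sum_(k < n) h k t).
Proof.
move=> hc; elim: n => [|n IH].
  rewrite (_ : (fun _ => _) = fun=> 0); first exact: ccont_cst.
  by apply/funext => t; rewrite big_ord0.
rewrite (_ : (fun _ => _) = fun t => \sum_(k < n) h k t + h n t); first exact: ccontD.
by apply/funext => t; rewrite big_ord_recr.
Qed.
Lemma ccont_analytic f r : analytic_on_disk f -> 0 <= r < 1 -> ccont (fun t => f (circ r t)).
Proof. by move=> fa rb; split; exact: continuous_circ_comp. Qed.

Lemma normcX z n : normc (z ^+ n) = normc z ^+ n.
Proof. by elim: n => [|n IH]; rewrite ?expr0 ?normc1 // !exprS normcM IH. Qed.

Definition cint (h : R -> C) : C :=
  segint 0 (2 * pi) (fun t => Re (h t)) +i* segint 0 (2 * pi) (fun t => Im (h t)).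

Lemma eq_cint (h k : R -> C) : h =1 k -> cint h = cint k.
Proof. by move=> /funext ->. Qed.

(** Testing with a = -i recovers imaginary parts, since Re (-i z) = Im z; so identities proved for
    real parts only pass to complex integrals. *)
Lemma cint_ext (h k : R -> C) :
  (forall a : C, segint 0 (2 * pi) (fun t => Re (a * h t)) =
                 segint 0 (2 * pi) (fun t => Re (a * k t))) -> cint h = cint k.
Proof.
move=> H; have imE (z : C) : Re ((0 -i* 1) * z) = Im z by case: z => a b /=; ring.
have := H 1; rewrite /cint.
under eq_segint do rewrite mul1r; under [RHS]eq_segint do rewrite mul1r.
move=> ->; have := H (0 -i* 1).
by under eq_segint do rewrite imE; under [RHS]eq_segint do rewrite imE; move=> ->.
Qed.

Lemma cintD (h k : R -> C) : ccont h -> ccont k ->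
  cint (fun t => h t + k t) = cint h + cint k.
Proof.
move=> hc kc; apply/eqP; rewrite eq_complex /= -!segintD;
  try by move=> t _; (exact: ccont_Re || exact: ccont_Im).
by apply/andP; split; apply/eqP/eq_segint => t _; case: (h t) (k t) => ? ? [].
Qed.

Lemma cintZ (a : C) (h : R -> C) : ccont h -> cint (fun t => a * h t) = a * cint h.
Proof.
move=> hc; have cR := ccont_Re hc; have cI := ccont_Im hc.
have zc (x : R) (k : R -> R) : continuous k -> segcont 0 (2 * pi) (fun t => x * k t).
  by move=> kc t _; apply: cvgM; [exact: cvg_cst|exact: kc].
apply/eqP; rewrite eq_complex; case: a => a b /=.
rewrite -!segintZ; try by move=> t _; (exact: cR || exact: cI).
rewrite -segintB -?segintD; try exact: zc.
by apply/andP; split; apply/eqP/eq_segint => t _; case: (h t).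
Qed.

Lemma cint_sum (n : nat) (h : nat -> R -> C) : (forall k, ccont (h k)) ->
  cint (fun t => \sum_(k < n) h k t) = \sum_(k < n) cint (h k).
Proof.
move=> hc; elim: n => [|n IH].
  rewrite big_ord0; apply/eqP; rewrite eq_complex /=.
  have pi2 : 0 <= 2 * pi :> R by rewrite mulr_ge0 ?pi_ge0.
  by apply/andP; split; apply/eqP; rewrite -[RHS](mul0r (2 * pi - 0)) -segint_cst //;
    apply: eq_segint => t _; rewrite big_ord0.
rewrite big_ord_recr /= -IH -cintD //; last exact: ccont_sum.
by apply: eq_cint => t; rewrite big_ord_recr.
Qed.

Lemma normc_cint_le (h : R -> C) (M : R) : ccont h ->
  (forall t, 0 <= t <= 2 * pi -> normc (h t) <= M) -> normc (cint h) <= 4 * pi * M.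
Proof.
move=> hc hM; have pi2 : 0 <= 2 * pi :> R by rewrite mulr_ge0 ?pi_ge0.
apply: le_trans (normc_le_ReIm _) _ => /=.
have -> : 4 * pi * M = M * (2 * pi - 0) + M * (2 * pi - 0) by ring.
apply: lerD; apply: segint_norm_le => //.
- by move=> t _; exact: ccont_Re.
- by move=> t tb; apply: le_trans (Re_le_normc _) (hM t tb).
- by move=> t _; exact: ccont_Im.
- by move=> t tb; apply: le_trans (Im_le_normc _) (hM t tb).
Qed.

Lemma bounded_circle f r : analytic_on_disk f -> 0 <= r < 1 ->
  exists2 B : R, 0 <= B & forall t, 0 <= t <= 2 * pi -> normc (f (circ r t)) <= B.
Proof.
move=> fa rb; have pi2 : 0 <= 2 * pi :> R by rewrite mulr_ge0 ?pi_ge0.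
pose h t := normc (f (circ r t)) ^+ 2.
have hc : continuous h.
  by move=> t; apply: (@continuous_normc2 _ _ (fun t => f (circ r t)) t); exact: continuous_circ_comp.
have [c _ Hc] := @EVT_max R h _ _ pi2 (continuous_subspaceT hc).
exists (normc (f (circ r c))); first exact: normc_ge0.
move=> t tb; have := Hc t; rewrite in_itv /= => /(_ tb).
by rewrite /h ler_pXn2r // nnegrE normc_ge0.
Qed.

Lemma cint_cauchy f zeta r : normc zeta < r -> r < 1 -> analytic_on_disk f ->
  cint (fun t => f (circ r t) * cauchy_kernel zeta r t) = (2 * pi)%:C * f zeta.
Proof.
move=> zr r1 fa.
have fd z : normc z <= r -> derivable (f : C^o -> C^o) z 1.
  by move=> z'r; apply: fa; apply/diskE; exact: le_lt_trans r1.
apply/eqP; rewrite eq_complex /=; apply/andP; split; apply/eqP.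
  by rewrite (cauchy_formula zr fd); case: (f zeta) => ? ? /=; ring.
have gd z : normc z <= r -> derivable ((fun z => (0 -i* 1) * f z) : C^o -> C^o) z 1.
  by move=> zle; apply: (@derivableM _ C^o); [exact: derivable_cst|exact: fd].
have := cauchy_formula zr gd.
have imE (z : C) : Re ((0 -i* 1) * z) = Im z by case: z => a b /=; ring.
rewrite imE; under eq_segint do rewrite -mulrA imE.
by move=> ->; case: (f zeta) => ? ? /=; ring.
Qed.

Definition fourier_coef f r (k : nat) : C :=
  (2 * pi)^-1%:C * cint (fun t => f (circ r t) / circ r t ^+ k).

Lemma circ_neq0 r t : 0 < r -> circ r t != 0.
Proof.
by move=> r0; have := @circB_neq0 _ 0 r _ t; rewrite subr0 normc0; apply.
Qed.

Lemma circM r s t : circ (s * r) t = s%:C * circ r t.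
Proof. by apply/eqP; rewrite eq_complex /=; apply/andP; split; apply/eqP; ring. Qed.

(** The contraction of circles towards 0 applies to f(z) / z^k despite the pole, because
    [cauchy_kernel_homotopy] asks for differentiability only at ray parameters l > 0. *)
Lemma fourier_coef_indep f r s k : analytic_on_disk f -> 0 < s -> s <= r -> r < 1 ->
  fourier_coef f s k = fourier_coef f r k.
Proof.
move=> fa s0 sr r1; have r0 : 0 < r by exact: lt_le_trans sr.
have zr : normc (0 : C) < r by rewrite normc0.
have k1 t : cauchy_kernel 0 r t = 1 by rewrite /cauchy_kernel subr0 divff // circ_neq0.
have H (a : C) : segint 0 (2 * pi) (fun t => Re (a * (f (circ s t) / circ s t ^+ k))) =
   segint 0 (2 * pi) (fun t => Re (a * (f (circ r t) / circ r t ^+ k))).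
  have sr1 : 0 < s / r <= 1 by rewrite divr_gt0 // ler_pdivrMr // mul1r.
  pose g z := a * (f z / z ^+ k).
  have gd (l t : R) : 0 < l <= 1 -> derivable (g : C^o -> C^o) (0 + l%:C * (circ r t - 0)) 1.
    move=> /andP[l0 l1]; rewrite add0r subr0 -circM.
    have lr0 : 0 < l * r by rewrite mulr_gt0.
    apply: (@derivableM _ C^o); first exact: derivable_cst.
    apply: (@derivableM _ C^o).
      apply: fa; apply: disk_circ; rewrite ltW //=.
      by apply: le_lt_trans r1; rewrite ler_piMl // ltW.
    apply: (@derivableV _ C^o); first by rewrite expf_neq0 // circ_neq0.
    exact: exprn_derivable.
  have E := cauchy_kernel_homotopy zr sr1 gd.
  transitivity (segint 0 (2 * pi) (fun t =>
      Re (g (0 + (s / r)%:C * (circ r t - 0)) * cauchy_kernel 0 r t))).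
    apply: eq_segint => t _; rewrite k1 (mulr1 (g _)).
    have -> // : 0 + (s / r)%:C * (circ r t - 0) = circ s t.
    have r_neq0 : r != 0 by rewrite gt_eqF.
    by rewrite add0r subr0 -circM (divfK r_neq0).
  by rewrite E; apply: eq_segint => t _; rewrite k1 (mulr1 (g _)).
by rewrite /fourier_coef (cint_ext H).
Qed.

(** The radius 1/2 is an arbitrary choice: by [taylorE] every radius in ]0, 1[ gives the same
    value. *)
Definition taylor f (k : nat) : C := fourier_coef f 2^-1 k.
Definition csum (a : nat -> C) (n : nat) z : C := \sum_(k < n) a k * z ^+ k.

Lemma taylorE f r k : analytic_on_disk f -> 0 < r < 1 -> taylor f k = fourier_coef f r k.
Proof.
move=> fa /andP[r0 r1]; have [le|/ltW le] := leP 2^-1 r.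
  by apply: fourier_coef_indep => //; rewrite invr_gt0.
by symmetry; apply: fourier_coef_indep => //; rewrite invf_lt1 // ltr1n.
Qed.

(** Expanding the Cauchy kernel as a finite geometric sum leaves a remainder with the factor (z /
    circ r t)^n, uniformly at most (s / r)^n on |z| <= s once s < r < 1. *)
Lemma csum_cvg f s : analytic_on_disk f -> 0 <= s < 1 ->
  forall e : R, 0 < e -> exists N, forall n, (N <= n)%N -> forall z, normc z <= s ->
    normc (f z - csum (taylor f) n z) <= e.
Proof.
move=> fa /andP[s0 s1] e e0.
pose r := (s + 1) / 2; have sr : s < r by rewrite /r; lra.
have r1 : r < 1 by rewrite /r; lra.
have r0 : 0 < r by exact: le_lt_trans sr.
have rb : 0 <= r < 1 by rewrite ltW.
have [B B0 HB] := bounded_circle fa rb.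
pose q := s / r; have q0 : 0 <= q by rewrite divr_ge0 // ltW.
have q1 : q < 1 by rewrite ltr_pdivrMr // mul1r.
(* The 2 is 4 pi / (2 pi): [normc_cint_le] estimates real and imaginary parts separately. *)
pose K := 2 * (B * (r / (r - s))).
have rs0 : 0 <= r / (r - s) by rewrite divr_ge0 ?subr_ge0 ?(ltW r0) ?(ltW sr).
have K0 : 0 <= K by rewrite mulr_ge0 // mulr_ge0.
have [N HN] : exists N, forall n, (N <= n)%N -> K * q ^+ n <= e.
  have := @cvg_geometric R K q; rewrite ger0_norm // => /(_ q1) /cvgrPdist_le/(_ e e0)[N _ H].
  by exists N => n Nn; have := H n Nn; rewrite /= /geometric /= sub0r normrN; apply: le_trans; exact: ler_norm.
exists N => n Nn z zs; apply: le_trans (HN n Nn).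
have zr : normc z < r by exact: le_lt_trans sr.
have c0 t : circ r t != 0 by exact: circ_neq0.
have cfc : ccont (fun t => f (circ r t)) by exact: ccont_analytic.
have cVX k : ccont (fun t => (circ r t ^+ k)^-1).
  have cx0 t : circ r t ^+ k != 0 by rewrite expf_neq0.
  exact: (ccontV cx0 (ccontX k (ccont_circ r))).
have ck : ccont (cauchy_kernel z r) by by split; exact: continuous_cauchy_kernel.
pose E t := f (circ r t) * ((z / circ r t) ^+ n * cauchy_kernel z r t).
have cE : ccont E.
  apply: (ccontM cfc); apply: (ccontM _ ck); apply: ccontX.
  exact: (ccontM (ccont_cst z) (ccontV c0 (ccont_circ r))).
have cterm k : ccont (fun t => z ^+ k * (f (circ r t) / circ r t ^+ k)).
  exact: (ccontM (ccont_cst (z ^+ k)) (ccontM cfc (cVX k))).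
have key : (2 * pi)%:C * (f z - csum (taylor f) n z) = cint E.
  rewrite mulrBr -(cint_cauchy zr r1 fa) /csum mulr_sumr.
  have -> : \sum_(i < n) (2 * pi)%:C * (taylor f i * z ^+ i) =
     cint (fun t => \sum_(k < n) z ^+ k * (f (circ r t) / circ r t ^+ k)).
    rewrite (@cint_sum n (fun k t => z ^+ k * (f (circ r t) / circ r t ^+ k))) //.
    apply: eq_bigr => i _; rewrite cintZ; last exact: (ccontM cfc (cVX i)).
    rewrite (@taylorE f r) ?r0 // /fourier_coef mulrA mulrA -rmorphM /=.
    by rewrite mulfV ?mul1r 1?mulrC // mulf_neq0 // gt_eqF ?pi_gt0.
  apply/eqP; rewrite subr_eq -(cintD cE (@ccont_sum n _ cterm)).
  apply/eqP; apply: eq_cint => t.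
  have cz := circB_neq0 zr t.
  have -> : \sum_(k < n) z ^+ k * (f (circ r t) / circ r t ^+ k) =
     f (circ r t) * \sum_(k < n) (z / circ r t) ^+ k.
    by rewrite mulr_sumr; apply: eq_bigr => k _; rewrite expr_div_n; ring.
  rewrite /E -mulrDr; congr (_ * _).
  have q1' : 1 - z / circ r t != 0.
    apply: contra cz => /eqP h; rewrite -[circ r t]mulr1 -{1}(subrK (z / circ r t) 1) h add0r.
    by rewrite mulrCA divff // mulr1 subrr.
  have -> : cauchy_kernel z r t = (1 - z / circ r t)^-1.
    by rewrite /cauchy_kernel; field; rewrite c0 /=; rewrite cz.
  have := subrX1 (z / circ r t) n.
  set Q := z / circ r t in q1' *; set S := \sum_(_ < _) _ => hS.
  apply: (mulIf q1'); rewrite mulVf // mulrDl mulfVK //.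
  have -> : S * (1 - Q) = 1 - Q ^+ n by rewrite -[RHS]opprB hS; ring.
  by ring.
have pi2 : 0 < 2 * pi :> R by rewrite mulr_gt0 ?pi_gt0.
have le : normc (cint E) <= 4 * pi * (B * (q ^+ n * (r / (r - s)))).
  apply: normc_cint_le => // t tb; rewrite /E normcM [normc (_ ^+ n * _)]normcM.
  apply: ler_pM; rewrite ?mulr_ge0 ?normc_ge0 //; first exact: HB.
  apply: ler_pM; rewrite ?normc_ge0 //.
    rewrite normcX; apply: lerXn2r; rewrite ?nnegrE ?normc_ge0 //.
    by rewrite normcM normcV normc_circ gtr0_norm // ler_pM2r ?invr_gt0.
  apply: le_trans (normc_cauchy_kernel zr t) _; rewrite ler_pM2l //.
  by rewrite lef_pV2 ?posrE ?subr_gt0 // lerB.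
rewrite -key normcM normc_real gtr0_norm // in le.
rewrite -(ler_pM2l pi2); apply: le_trans le _.
have -> // : 4 * pi * (B * (q ^+ n * (r / (r - s)))) = 2 * pi * (K * q ^+ n).
by rewrite /K; ring.
Qed.

End PowerSeries.

(** * Circular means and Parseval's identity *)

Section Parseval.
Context {R : realType}.
Local Notation C := (R[i]).
Implicit Types (z u v zeta : C) (f g : C -> C) (r t s : R) (a : nat -> C).

Lemma twopi_gt0 : 0 < 2 * pi :> R.
Proof. by rewrite mulr_gt0 ?pi_gt0. Qed.

Definition cmean f s : R := (2 * pi)^-1 * segint 0 (2 * pi) (fun t => normc (f (circ s t)) ^+ 2).

Lemma ccont_normc2 (h : R -> C) : ccont h -> continuous (fun t => normc (h t) ^+ 2).
Proof. by move=> [hc] t; apply: (@continuous_normc2 _ _ h t); exact: hc. Qed.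

Lemma ccont_conj (h : R -> C) : ccont h -> ccont (fun t => (h t)^*%C).
Proof.
move=> hc; have cR := ccont_Re hc; have cI := ccont_Im hc.
rewrite (_ : (fun _ => _) = (fun t => Re (h t) +i* - Im (h t))); last first.
  by apply/funext => t; case: (h t).
by split=> t; apply: cvg_complex; [exact: cR|apply: cvgN; exact: cI].
Qed.

Lemma segcontT (a b : R) (h : R -> R) : continuous h -> segcont a b h.
Proof. by move=> hc t _; exact: hc. Qed.

Lemma circle_int_cmean f s : analytic_on_disk f -> 0 <= s < 1 ->
  circle_int f s = (2 * pi * cmean f s)%:E.
Proof.
by move=> fa sb; rewrite circle_intE // /cmean mulrA divff ?mul1r // gt_eqF // twopi_gt0.
Qed.

Lemma cmean_ge0 f s : 0 <= cmean f s.
Proof.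
rewrite mulr_ge0 ?invr_ge0 ?(ltW twopi_gt0) //.
by apply: Rintegral_ge0 => t _; exact: sqr_ge0.
Qed.

Lemma cmean_le_cst f s (M : R) : ccont (fun t => f (circ s t)) ->
  (forall t, normc (f (circ s t)) ^+ 2 <= M) -> cmean f s <= M.
Proof.
move=> fc fM; rewrite /cmean mulrC ler_pdivrMr ?twopi_gt0 //.
rewrite -[X in _ <= _ * X]subr0 -segint_cst ?(ltW twopi_gt0) //.
apply: le_segint => [||t _]; [|by apply: segcontT => t; exact: cvg_cst|exact: fM].
by apply: segcontT; exact: ccont_normc2.
Qed.

Lemma cmeanD_le f g s : ccont (fun t => f (circ s t)) -> ccont (fun t => g (circ s t)) ->
  cmean (fun z => f z + g z) s <= 2 * cmean f s + 2 * cmean g s.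
Proof.
move=> fc gc; rewrite /cmean !(mulrCA 2) -mulrDr ler_pM2l ?invr_gt0 ?twopi_gt0 //.
have f2 := ccont_normc2 fc; have g2 := ccont_normc2 gc.
have z2 (h : R -> R) : continuous h -> continuous (fun t => 2 * h t).
  by move=> hc t; apply: cvgM; [exact: cvg_cst|exact: hc].
rewrite -!segintZ; try exact: segcontT.
rewrite -segintD; try (apply: segcontT; exact: z2).
apply: le_segint.
- by apply: segcontT; apply: ccont_normc2; exact: ccontD.
- by apply: segcontT => t; apply: cvgD; [exact: (z2 _ f2)|exact: (z2 _ g2)].
move=> t _; rewrite !sqr_normcE; move: (f _) (g _) => [x y] [x' y'] /=.
rewrite -subr_ge0.
have -> : 2 * (x ^+ 2 + y ^+ 2) + 2 * (x' ^+ 2 + y' ^+ 2) - ((x + x') ^+ 2 + (y + y') ^+ 2)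
  = (x - x') ^+ 2 + (y - y') ^+ 2 by ring.
by rewrite addr_ge0 ?sqr_ge0.
Qed.

Lemma ccont_csum a n s : ccont (fun t => csum a n (circ s t)).
Proof.
apply: (@ccont_sum _ n (fun k t => a k * circ s t ^+ k)) => k.
by apply: ccontM; [exact: ccont_cst|apply: ccontX; exact: ccont_circ].
Qed.

Lemma derivable_csum a n z : derivable (csum a n : C^o -> C^o) z 1.
Proof.
rewrite (_ : csum a n = \sum_(k < n) (fun z => a k * z ^+ k : C)); last first.
  by apply/funext => y; rewrite fct_sumE.
apply: derivable_sum => k; apply: (@derivableM _ C^o); first exact: derivable_cst.
exact: exprn_derivable.
Qed.

Lemma csum_recr a n z : csum a n.+1 z = csum a n z + a n * z ^+ n.
Proof. by rewrite /csum big_ord_recr. Qed.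

(** Adding the term of degree n creates a cross term Re (a_n z^n conj(p)), with p of degree less
    than n. On the circle conj(z)^k = s^(2k) / z^k, so it is the real part of the polynomial [g],
    which vanishes at 0 and has mean zero. *)
Lemma cmean_csum a n s : 0 < s ->
  cmean (csum a n) s = \sum_(k < n) normc (a k) ^+ 2 * s ^+ (2 * k).
Proof.
move=> s0; elim: n => [|n IH].
  rewrite big_ord0 /cmean (@eq_segint _ _ _ _ (fun=> 0)).
    by rewrite segint_cst ?(ltW twopi_gt0) // mul0r mulr0.
  by move=> t _; rewrite /csum big_ord0 normc0 expr0n.
rewrite big_ord_recr /= -IH /cmean.
pose X t := circ s t ^+ n * (csum a n (circ s t))^*%C.
have pc : ccont (fun t => csum a n (circ s t)) by exact: ccont_csum.
pose g z := \sum_(k < n) (a n * (a k)^*%C * (s ^+ (2 * k))%:C) * z ^+ (n - k).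
have gX t : g (circ s t) = a n * X t.
  rewrite /g /X /csum rmorph_sum /= mulr_sumr mulr_sumr; apply: eq_bigr => k _.
  rewrite rmorphM /=.
  have -> : (s ^+ (2 * k))%:C = circ s t ^+ k * (circ s t ^+ k)^*%C.
    by rewrite mulc_conj normcX normc_circ gtr0_norm // -exprM mulnC.
  have -> : circ s t ^+ n = circ s t ^+ (n - k) * circ s t ^+ k.
    by rewrite -exprD subnK // ltnW.
  by move: (circ s t ^+ (n - k)) (_ ^*%C) (_ ^*%C) => x y y'; ring.
have gd z : normc z <= s -> derivable (g : C^o -> C^o) z 1.
  move=> _; rewrite (_ : g = \sum_(k < n) (fun z => (a n * (a k)^*%C * (s ^+ (2 * k))%:C) * z ^+ (n - k) : C)); last first.
    by apply/funext => y; rewrite fct_sumE.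
  apply: derivable_sum => k; apply: (@derivableM _ C^o); first exact: derivable_cst.
  exact: exprn_derivable.
have g0 : g 0 = 0.
  by apply: big1 => k _; rewrite expr0n subn_eq0 leqNgt ltn_ord mulr0.
have := mean_value s0 gd; rewrite g0 mulr0.
rewrite (@eq_segint _ _ _ _ (fun t => Re (a n * X t))) => [I0|t _]; last by rewrite gX.
have Xc : ccont (fun t => a n * X t).
  apply: ccontM; first exact: ccont_cst.
  by apply: ccontM; [apply: ccontX; exact: ccont_circ|exact: ccont_conj].
have E t : normc (csum a n.+1 (circ s t)) ^+ 2 =
   normc (csum a n (circ s t)) ^+ 2 + 2 * Re (a n * X t) + normc (a n) ^+ 2 * s ^+ (2 * n).
  have gen (p q : C) : normc (p + q) ^+ 2 = normc p ^+ 2 + 2 * Re (q * p^*%C) + normc q ^+ 2.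
    by rewrite !sqr_normcE; case: p q => [x y] [x' y'] /=; ring.
  by rewrite csum_recr gen normcM exprMn normcX normc_circ gtr0_norm // -exprM (mulnC n) /X mulrA.
under eq_segint do rewrite E.
have c1 : segcont 0 (2 * pi) (fun t => normc (csum a n (circ s t)) ^+ 2).
  by apply: segcontT; exact: ccont_normc2.
have c2 : segcont 0 (2 * pi) (fun t => 2 * Re (a n * X t)).
  by apply: segcontT => t; apply: cvgM; [exact: cvg_cst|exact: ccont_Re].
rewrite segintD; [|by move=> t tb; apply: cvgD; [exact: c1|exact: c2]|by move=> t _; exact: cvg_cst].
rewrite segintD // segintZ; last by apply: segcontT; exact: ccont_Re.
rewrite I0 mulr0 addr0 segint_cst ?(ltW twopi_gt0) // subr0 mulrDr; congr (_ + _).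
by rewrite mulrC mulfK // gt_eqF // twopi_gt0.
Qed.

Lemma cmean_cvg (h : nat -> C -> C) f s : 0 <= s ->
  ccont (fun t => f (circ s t)) -> (forall m, ccont (fun t => h m (circ s t))) ->
  (exists2 B : R, 0 <= B & forall t, 0 <= t <= 2 * pi -> normc (f (circ s t)) <= B) ->
  (forall e : R, 0 < e -> exists N, forall m, (N <= m)%N -> forall z, normc z <= s ->
    normc (f z - h m z) <= e) ->
  (fun m => cmean (h m) s) @ \oo --> cmean f s.
Proof.
move=> s0 fc hc [B B0 HB] hf; apply/cvgrPdist_le => e e0.
(* The squares differ by at most d (2 B + d), hence by at most d (2 B + 1) as d <= 1. *)
pose d := Num.min 1 (e / (2 * B + 1)).
have d0 : 0 < d by rewrite lt_min ltr01 divr_gt0 // ltr_wpDl // mulr_ge0.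
have d1 : d <= 1 by rewrite /d ge_min lexx.
have de : d * (2 * B + 1) <= e.
  by rewrite -ler_pdivlMr ?ltr_wpDl ?mulr_ge0 // /d ge_min lexx orbT.
have [N HN] := hf d d0; exists N => // m /= Nm.
have fs : segcont 0 (2 * pi) (fun t => normc (f (circ s t)) ^+ 2).
  by apply: segcontT; exact: ccont_normc2.
have hs : segcont 0 (2 * pi) (fun t => normc (h m (circ s t)) ^+ 2).
  by apply: segcontT; exact: (ccont_normc2 (hc m)).
rewrite /cmean -mulrBr normrM gtr0_norm ?invr_gt0 ?twopi_gt0 //.
rewrite mulrC ler_pdivrMr ?twopi_gt0 // -segintB //.
rewrite -[X in _ <= _ * X]subr0; apply: segint_norm_le; first exact: (ltW twopi_gt0).
  by move=> t tb; apply: cvgB; [exact: fs|exact: hs].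
move=> t tb; apply: le_trans de.
have fB := HB t tb.
have zs : normc (circ s t) <= s by rewrite normc_circ ger0_norm.
have := HN m Nm _ zs.
move: (f _) (h m _) fB => u v uB uv.
have u0 := normc_ge0 u; have v0 := normc_ge0 v.
have vu : `|normc u - normc v| <= d.
  rewrite ler_norml; apply/andP; split.
    by rewrite lerNl opprB; apply: le_trans (normcB_ge v u) _; rewrite -normcN opprB.
  exact: le_trans (normcB_ge u v) uv.
have vB : normc v <= B + d by move: vu; rewrite ler_norml => /andP[]; lra.
rewrite subr_sqr normrM; apply: ler_pM => //.
by rewrite ger0_norm ?addr_ge0 //; lra.
Qed.

(** Zeroing the first coefficients instead of shifting them keeps the exponents in Parseval's
    sums. *)
Definition tail a n k : C := if (n <= k)%N then a k else 0.

Lemma csum_tail a n m z : (n <= m)%N -> csum (tail a n) m z = csum a m z - csum a n z.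
Proof.
move=> /subnK <-; elim: (m - n)%N => [|k IH].
  rewrite add0n subrr /csum big1 // => k _.
  by rewrite /tail leqNgt ltn_ord mul0r.
by rewrite addSn !csum_recr IH /tail leq_addl addrAC.
Qed.

Lemma parseval f s n : analytic_on_disk f -> 0 < s < 1 ->
  (fun m => \sum_(k < m) normc (tail (taylor f) n k) ^+ 2 * s ^+ (2 * k)) @ \oo -->
  cmean (fun z => f z - csum (taylor f) n z) s.
Proof.
move=> fa /andP[s0 s1]; have sb : 0 <= s < 1 by rewrite ltW.
under eq_fun do rewrite -cmean_csum //.
have ga : analytic_on_disk (fun z => f z - csum (taylor f) n z).
  by move=> z dz; apply: (@derivableB _ C^o C^o); [exact: fa|exact: derivable_csum].
apply: cmean_cvg; rewrite ?(ltW s0) //.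
- exact: ccont_analytic ga sb.
- by move=> m; exact: ccont_csum.
- exact: (bounded_circle ga sb).
move=> e e0; have [N HN] := csum_cvg fa sb e0.
exists (maxn N n) => m; rewrite geq_max => /andP[Nm nm] z zs.
by rewrite csum_tail // opprB addrA subrK; exact: HN.
Qed.

Lemma sum_normc2_nondec a s : 0 <= s -> nondecreasing_seq
  (fun m => \sum_(k < m) normc (a k) ^+ 2 * s ^+ (2 * k)).
Proof.
move=> s0; apply/nondecreasing_seqP => m; rewrite big_ord_recr lerDl.
by rewrite mulr_ge0 ?sqr_ge0 ?exprn_ge0.
Qed.

Lemma bessel f s m : analytic_on_disk f -> 0 < s < 1 ->
  \sum_(k < m) normc (taylor f k) ^+ 2 * s ^+ (2 * k) <= cmean f s.
Proof.
move=> fa sb; have s0 : 0 <= s by case/andP: sb => /ltW.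
have := @parseval f s 0%N fa sb.
rewrite (_ : (fun z => f z - csum (taylor f) 0%N z) = f); last first.
  by apply/funext => z; rewrite /csum big_ord0 subr0.
move=> cv; rewrite -(cvg_lim _ cv) //.
have := @nondecreasing_cvgn_le R _ (sum_normc2_nondec (tail (taylor f) 0%N) s0).
by move=> /(_ _ m); apply; apply: cvgP cv.
Qed.

(** Dropping s^(2k) <= 1 makes the bound uniform in the radius, as the Hardy supremum demands. *)
Lemma cmean_remainder_le f s n (eta : R) : analytic_on_disk f -> 0 < s < 1 ->
  (forall m, \sum_(k < m) normc (tail (taylor f) n k) ^+ 2 <= eta) ->
  cmean (fun z => f z - csum (taylor f) n z) s <= eta.
Proof.
move=> fa sb le; have := @parseval f s n fa sb => cv.
rewrite -(cvg_lim _ cv) //; apply: limr_le; first exact: cvgP cv.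
apply: nearW => m; apply: le_trans (le m); apply: ler_sum => k _.
case/andP: sb => s0 s1; rewrite ler_piMr ?sqr_ge0 // exprn_ile1 ?ltW //.
Qed.

(** Parseval's sum for the remainder is part of the sum for [f]. This is the domination used for the
    Bergman integral. *)
Lemma cmean_remainder_le_self f s n : analytic_on_disk f -> 0 < s < 1 ->
  cmean (fun z => f z - csum (taylor f) n z) s <= cmean f s.
Proof.
move=> fa sb; have := @parseval f s n fa sb => cv.
rewrite -(cvg_lim _ cv) //; apply: limr_le; first exact: cvgP cv.
apply: nearW => m; apply: le_trans (@bessel f s m fa sb); apply: ler_sum => k _.
case/andP: sb => s0 s1; rewrite ler_wpM2r ?exprn_ge0 ?(ltW s0) //.
by rewrite /tail; case: ifP => // _; rewrite normc0 expr0n sqr_ge0.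
Qed.

Lemma cmean_remainder_cvg0 f s : analytic_on_disk f -> 0 < s < 1 ->
  (fun n => cmean (fun z => f z - csum (taylor f) n z) s) @ \oo --> 0.
Proof.
move=> fa /andP[s0 s1]; have sb : 0 <= s < 1 by rewrite ltW.
apply/cvgrPdist_le => e e0.
have e1 : 0 < Num.min 1 e by rewrite lt_min ltr01.
have [N HN] := csum_cvg fa sb e1; exists N => // n /= Nn.
rewrite sub0r normrN ger0_norm ?cmean_ge0 //; apply: cmean_le_cst.
  have ga : analytic_on_disk (fun z => f z - csum (taylor f) n z).
    by move=> z dz; apply: (@derivableB _ C^o C^o); [exact: fa|exact: derivable_csum].
  exact: ccont_analytic ga sb.
move=> t; have zs : normc (circ s t) <= s by rewrite normc_circ ger0_norm // ltW.
have := HN n Nn _ zs; set x := normc _; have x0 : 0 <= x by exact: normc_ge0.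
rewrite le_min => /andP[x1 xe]; rewrite expr2; apply: le_trans xe.
by rewrite ler_piMl.
Qed.

End Parseval.

(** * Area integrals in polar form *)

Section LebesgueAffine.
Context {R : realType}.
Local Open Scope ereal_scope.
Local Notation mu := (@lebesgue_measure R).
Local Notation mR := (measurableTypeR R).

Lemma measurable_affine (a b : R) : measurable_fun setT (fun x : mR => (a * x + b)%R : mR).
Proof. by apply: measurable_funD => //; exact: measurable_funM. Qed.

(** The rescaled pushforward agrees with Lebesgue measure on half-open intervals, hence everywhere
    by uniqueness. *)
Lemma lebesgue_affine (a b : R) (A : set mR) : (0 < a)%R -> measurable A ->
  a%:E * mu ((fun x : mR => (a * x + b)%R : mR) @^-1` A) = mu A.
Proof.
move=> a0 mA.
pose m := measure_function_pushforward__canonical__measure_function_Measure mu (measurable_affine a b).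
pose k : {nonneg R} := NngNum (ltW a0).
have := @lebesgue_measure_unique R (mscale k m) _ A mA.
rewrite /mscale /= /pushforward => -> //.
move=> _ [[c d] /= _ <-]; rewrite /mscale /= /pushforward.
have -> : (fun x : mR => (a * x + b)%R : mR) @^-1` `]c, d] = [set` `]((c - b) / a)%R, ((d - b) / a)%R]].
  apply/seteqP; split => x /=; rewrite !in_itv /= ltr_pdivrMr // ler_pdivlMr // [(x * a)%R]mulrC;
  by rewrite ltrBlDr lerBrDr.
have itvE u v := @lebesgue_measure_itv R `]u, v]; rewrite !itvE /= !lte_fin.
rewrite ltr_pM2r ?invr_gt0 // ltrD2r; case: ifP => _; last by rewrite mule0.
by rewrite -!EFinB -EFinM; congr (_%:E); field; rewrite gt_eqF.
Qed.

Lemma ge0_integral_affine (a b : R) (g : mR -> \bar R) : (0 < a)%R ->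
  measurable_fun setT g -> (forall x, 0 <= g x) ->
  \int[mu]_x g x = a%:E * \int[mu]_x g (a * x + b)%R.
Proof.
move=> a0 mg g0.
pose k : {nonneg R} := NngNum (ltW a0).
pose m := measure_function_pushforward__canonical__measure_function_Measure mu (measurable_affine a b).
transitivity (\int[mscale k m]_x g x).
  apply: eq_measure_integral => A mA _.
  exact/esym/(lebesgue_affine b a0 mA).
rewrite ge0_integral_mscale //; congr (_ * _).
rewrite (@ge0_integral_pushforward _ _ _ _ _ _ (measurable_affine a b)) //.
Qed.

Local Notation mu2 := (mu \x mu).

Lemma ge0_integral_shear1 (k : R) (G : mR * mR -> \bar R) :
  measurable_fun setT G -> (forall p, 0 <= G p) ->
  \int[mu2]_p G (p.1 + k * p.2, p.2)%R = \int[mu2]_p G p.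
Proof.
move=> mG G0.
have ms : measurable_fun setT (fun p : mR * mR => (p.1 + k * p.2, p.2)%R : mR * mR).
  apply: measurable_fun_pair => //.
  by apply: measurable_funD => //; apply: measurable_funM.
rewrite fubini_tonelli2; [|exact: (measurableT_comp mG ms)|by move=> p; exact: G0].
rewrite [RHS](fubini_tonelli2 _ mG G0); apply: eq_integral => y _; rewrite /fubini_G /=.
rewrite [RHS](@ge0_integral_affine 1 (k * y)) //.
- by rewrite mul1e; apply: eq_integral => x _; rewrite mul1r.
- by apply: (@measurableT_comp _ _ _ _ _ _ G setT (fun x : mR => (x, y))) => //; exact: measurable_fun_pair.
Qed.

Lemma ge0_integral_shear2 (k : R) (G : mR * mR -> \bar R) :
  measurable_fun setT G -> (forall p, 0 <= G p) ->
  \int[mu2]_p G (p.1, p.2 + k * p.1)%R = \int[mu2]_p G p.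
Proof.
move=> mG G0.
have ms : measurable_fun setT (fun p : mR * mR => (p.1, p.2 + k * p.1)%R : mR * mR).
  apply: measurable_fun_pair => //.
  by apply: measurable_funD => //; apply: measurable_funM.
rewrite fubini_tonelli1; [|exact: (measurableT_comp mG ms)|by move=> p; exact: G0].
rewrite [RHS](fubini_tonelli1 _ mG G0); apply: eq_integral => x _; rewrite /fubini_F /=.
rewrite [RHS](@ge0_integral_affine 1 (k * x)) //.
- by rewrite mul1e; apply: eq_integral => y _; rewrite mul1r.
- by apply: (@measurableT_comp _ _ _ _ _ _ G setT (fun y : mR => (x, y))) => //; exact: measurable_fun_pair.
Qed.

Lemma ge0_integral_dilation (a : R) (G : mR * mR -> \bar R) : (0 < a)%R ->
  measurable_fun setT G -> (forall p, 0 <= G p) ->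
  (a ^+ 2)%:E * \int[mu2]_p G (a * p.1, a * p.2)%R = \int[mu2]_p G p.
Proof.
move=> a0 mG G0.
have ms : measurable_fun setT (fun p : mR * mR => (a * p.1, a * p.2)%R : mR * mR).
  by apply: measurable_fun_pair; apply: measurable_funM.
have a_ge0 : 0 <= a%:E by rewrite lee_fin ltW.
have mGs := measurableT_comp mG ms.
rewrite (fubini_tonelli1 _ mGs); last by move=> p; exact: G0.
rewrite [RHS](fubini_tonelli1 _ mG G0).
rewrite [RHS](@ge0_integral_affine a 0) //; last 2 first.
- exact: measurable_fun_fubini_tonelli_F.
- by move=> x; exact: integral_ge0.
rewrite expr2 EFinM -muleA; congr (_ * _).
rewrite -ge0_integralZl //; last 2 first.
- by apply: (@measurable_fun_fubini_tonelli_F _ _ _ _ R mu _ mGs) => p; exact: G0.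
- by move=> x _; apply: integral_ge0 => y _; exact: G0.
apply: eq_integral => x _; rewrite /fubini_F /= addr0.
rewrite [RHS](@ge0_integral_affine a 0) //.
- by congr (_ * _); apply: eq_integral => y _; rewrite addr0.
- by apply: (@measurableT_comp _ _ _ _ _ _ G setT (fun y : mR => (a * x, y)%R)) => //; exact: measurable_fun_pair.
Qed.

(* A rotation is a product of three shears. *)
Lemma ge0_integral_rotation (c s : R) (G : mR * mR -> \bar R) :
  (c ^+ 2 + s ^+ 2 = 1)%R -> (s != 0)%R ->
  measurable_fun setT G -> (forall p, 0 <= G p) ->
  \int[mu2]_p G (c * p.1 - s * p.2, s * p.1 + c * p.2)%R = \int[mu2]_p G p.
Proof.
(* For c = cos x and s = sin x, [k] is -tan (x / 2), the parameter of the two outer shears. *)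
move=> cs1 s0 mG G0; pose k := ((c - 1) / s)%R.
have ms1 : measurable_fun setT (fun p : mR * mR => (p.1 + k * p.2, p.2)%R : mR * mR).
  apply: measurable_fun_pair => //.
  by apply: measurable_funD => //; apply: measurable_funM.
have ms2 : measurable_fun setT (fun p : mR * mR => (p.1, p.2 + s * p.1)%R : mR * mR).
  apply: measurable_fun_pair => //.
  by apply: measurable_funD => //; apply: measurable_funM.
have m1 := measurableT_comp mG ms1.
have m2 := measurableT_comp m1 ms2.
rewrite -[RHS](ge0_integral_shear1 k) //.
rewrite -[RHS](@ge0_integral_shear2 s (fun p => G (p.1 + k * p.2, p.2)%R)) //.
rewrite -[RHS](@ge0_integral_shear1 k (fun p => G (p.1 + k * (p.2 + s * p.1), p.2 + s * p.1)%R)) //.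
apply: eq_integral => -[x y] _ /=; congr (G (_, _)); rewrite /k; last by field.
have -> : (s * y = (s ^+ 2) * y / s)%R by field.
have -> : (s ^+ 2 = 1 - c ^+ 2)%R by rewrite -cs1 addrAC subrr add0r.
by field.
Qed.

(** The factorisation into shears divides by [s]. For s = 0 the rotation is either the identity or
    the half turn, a product of two quarter turns. *)
Lemma ge0_integral_rotationT (c s : R) (G : mR * mR -> \bar R) :
  (c ^+ 2 + s ^+ 2 = 1)%R -> measurable_fun setT G -> (forall p, 0 <= G p) ->
  \int[mu2]_p G (c * p.1 - s * p.2, s * p.1 + c * p.2)%R = \int[mu2]_p G p.
Proof.
move=> cs1 mG G0; have [s0|] := eqVneq s 0%R; last by move=> ?; exact: ge0_integral_rotation.
have /eqP : (c ^+ 2 = 1)%R by rewrite -cs1 s0 expr0n addr0.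
rewrite s0 sqrf_eq1 => /orP[] /eqP ->.
  by apply: eq_integral => -[x y] _ /=; rewrite !mul1r !mul0r subr0 add0r.
have cs01 : (0 ^+ 2 + 1 ^+ 2 = 1 :> R)%R by rewrite expr0n expr1n add0r.
have mq : measurable_fun setT (fun p : mR * mR => (0 * p.1 - 1 * p.2, 1 * p.1 + 0 * p.2)%R : mR * mR).
  apply: measurable_fun_pair; [apply: measurable_funB|apply: measurable_funD]; exact: measurable_funM.
rewrite -[RHS](ge0_integral_rotation cs01 (oner_neq0 R)) //.
rewrite -[RHS](@ge0_integral_rotation _ _ (fun p => G (0 * p.1 - 1 * p.2, 1 * p.1 + 0 * p.2)%R) cs01 (oner_neq0 R)) //.
  by apply: eq_integral => -[x y] _ /=; congr (G (_, _)); ring.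
exact: (measurableT_comp mG mq).
Qed.

End LebesgueAffine.

(** * Averaging area integrals over rotations *)

Section AreaAverage.
Context {R : realType}.
Local Notation C := (R[i]).
Local Notation mu := (@lebesgue_measure R).
Local Notation mR := (measurableTypeR R).
Local Notation mu2 := (mu \x mu)%E.
Implicit Types (z u w : C) (f g : C -> C) (a : nat -> C) (r s t : R).

Definition cpl (p : mR * mR) : C := p.1 +i* p.2.
Definition disk2 : set (mR * mR) := [set p | disk (cpl p)].
Definition sqn (p : mR * mR) : R := p.1 ^+ 2 + p.2 ^+ 2.

Lemma normc_cpl p : normc (cpl p) ^+ 2 = sqn p.
Proof. by rewrite sqr_normcE. Qed.

Lemma normc_cplE p : normc (cpl p) = Num.sqrt (sqn p).
Proof. by []. Qed.

Lemma sqn_ge0 p : 0 <= sqn p.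
Proof. by rewrite addr_ge0 ?sqr_ge0. Qed.

Lemma disk2E p : disk2 p <-> sqn p < 1.
Proof.
rewrite /disk2 /= diskE normc_cplE -{1}(sqrtr1 R) ltr_sqrt //.
Qed.

Lemma measurable_sqn : measurable_fun setT sqn.
Proof. by apply: measurable_funD; apply: measurable_funX. Qed.

Lemma measurable_disk2 : measurable disk2.
Proof.
have -> : disk2 = sqn @^-1` `]-oo, 1[.
  by apply/seteqP; split => p /=; rewrite in_itv /= => /disk2E.
by rewrite -[X in measurable X]setTI; apply: measurable_sqn.
Qed.

Variant cmeasurable (h : mR * mR -> C) : Prop := CMeasurable of
  measurable_fun setT (fun p => Re (h p)) & measurable_fun setT (fun p => Im (h p)).

Lemma cmeasurable_cst (a : C) : cmeasurable (fun=> a).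
Proof. by split. Qed.

Lemma cmeasurable_cpl : cmeasurable cpl.
Proof. by split; [exact: measurable_fst|exact: measurable_snd]. Qed.

Lemma cmeasurableD h k : cmeasurable h -> cmeasurable k -> cmeasurable (fun p => h p + k p).
Proof.
move=> [hR hI] [kR kI]; split.
  rewrite (_ : (fun _ => _) = (fun p => Re (h p) + Re (k p))); first exact: measurable_funD.
  by apply/funext => p; case: (h p) (k p) => ? ? [].
rewrite (_ : (fun _ => _) = (fun p => Im (h p) + Im (k p))); first exact: measurable_funD.
by apply/funext => p; case: (h p) (k p) => ? ? [].
Qed.

Lemma cmeasurableM h k : cmeasurable h -> cmeasurable k -> cmeasurable (fun p => h p * k p).
Proof.
move=> [hR hI] [kR kI]; split.
  rewrite (_ : (fun _ => _) = (fun p => Re (h p) * Re (k p) - Im (h p) * Im (k p))).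
    by apply: measurable_funB; exact: measurable_funM.
  by apply/funext => p; case: (h p) (k p) => ? ? [].
rewrite (_ : (fun _ => _) = (fun p => Re (h p) * Im (k p) + Im (h p) * Re (k p))).
  by apply: measurable_funD; exact: measurable_funM.
by apply/funext => p; case: (h p) (k p) => ? ? [].
Qed.

Lemma cmeasurableX h n : cmeasurable h -> cmeasurable (fun p => h p ^+ n).
Proof.
move=> hm; elim: n => [|n IH]; first exact: cmeasurable_cst.
rewrite (_ : (fun _ => _) = (fun p => h p * h p ^+ n)); first exact: cmeasurableM.
by apply/funext => t; rewrite exprS.
Qed.

Lemma cmeasurable_csum a n : cmeasurable (fun p => csum a n (cpl p)).
Proof.
elim: n => [|n IH].
  rewrite (_ : (fun _ => _) = (fun=> 0)); first exact: cmeasurable_cst.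
  by apply/funext => p; rewrite /csum big_ord0.
rewrite (_ : (fun _ => _) = (fun p => csum a n (cpl p) + a n * cpl p ^+ n)).
  apply: cmeasurableD => //; apply: cmeasurableM; first exact: cmeasurable_cst.
  exact: cmeasurableX cmeasurable_cpl.
by apply/funext => p; rewrite csum_recr.
Qed.

Lemma measurable_normc2 h : cmeasurable h -> measurable_fun setT (fun p => normc (h p) ^+ 2).
Proof.
move=> [hR hI]; rewrite (_ : (fun _ => _) = (fun p => Re (h p) ^+ 2 + Im (h p) ^+ 2)).
  by apply: measurable_funD; apply: measurable_funX.
by apply/funext => p; rewrite sqr_normcE.
Qed.

Lemma csum_cvg_pt f z : analytic_on_disk f -> disk z ->
  (fun n => normc (csum (taylor f) n z) ^+ 2) @ \oo --> normc (f z) ^+ 2.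
Proof.
move=> fa /diskE z1; have zb : 0 <= normc z < 1 by rewrite normc_ge0.
have cv : (fun n => normc (csum (taylor f) n z)) @ \oo --> normc (f z).
  apply/cvgrPdist_le => e e0; have [N HN] := csum_cvg fa zb e0.
  exists N => // n /= Nn; have := HN n Nn z (lexx _); move: (f z) (csum _ _ _) => u v uv.
  rewrite ler_norml; apply/andP; split.
    by rewrite lerNl opprB; apply: le_trans (normcB_ge v u) _; rewrite -normcN opprB.
  exact: le_trans (normcB_ge u v) uv.
under eq_fun do rewrite expr2.
by rewrite expr2; apply: cvgM.
Qed.

(** On the disk [f] is the pointwise limit of its Taylor polynomials, whose measurability is
    algebraic. *)
Lemma measurable_analytic f : analytic_on_disk f ->
  measurable_fun disk2 (fun p => normc (f (cpl p)) ^+ 2).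
Proof.
move=> fa; apply: (measurable_fun_cvg (h := fun n p => normc (csum (taylor f) n (cpl p)) ^+ 2)).
- by move=> n; apply: measurable_funTS; apply: measurable_normc2; exact: cmeasurable_csum.
- by move=> p dp; exact: csum_cvg_pt.
Qed.

(** Replacing z by z u multiplies Taylor coefficients by unimodular numbers, which Parseval does not
    see; no shift of the angle in the integral is required. *)
Lemma cmean_rotation f u s : analytic_on_disk f -> normc u = 1 -> 0 < s < 1 ->
  cmean (fun z => f (z * u)) s = cmean f s.
Proof.
move=> fa u1 /andP[s0 s1]; have sb : 0 <= s < 1 by rewrite ltW.
have d z : disk z -> disk (z * u).
  by move=> /diskE dz; apply/diskE; rewrite normcM u1 mulr1.
have ga : analytic_on_disk (fun z => f (z * u)).
  have ma : analytic_on_disk (fun z => z * u).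
    by move=> z _; apply: (@derivableM _ C^o); [exact: derivable_id|exact: derivable_cst].
  exact: (@analytic_comp _ f (fun z => z * u) fa ma d).
pose b k := taylor f k * u ^+ k.
have cb n z : csum b n z = csum (taylor f) n (z * u).
  by apply: eq_bigr => k _; rewrite /b exprMn; ring.
have c1 : (fun m => cmean (csum b m) s) @ \oo --> cmean (fun z => f (z * u)) s.
  apply: cmean_cvg; rewrite ?(ltW s0) //.
  - exact: ccont_analytic ga sb.
  - by move=> m; exact: ccont_csum.
  - exact: (bounded_circle ga sb).
  move=> e e0; have [N HN] := csum_cvg fa sb e0; exists N => m Nm z zs.
  by rewrite cb; apply: HN => //; rewrite normcM u1 mulr1.
have c2 : (fun m => cmean (csum (taylor f) m) s) @ \oo --> cmean f s.
  apply: cmean_cvg; rewrite ?(ltW s0) //.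
  - exact: ccont_analytic fa sb.
  - by move=> m; exact: ccont_csum.
  - exact: (bounded_circle fa sb).
  exact: csum_cvg.
have E : (fun m => cmean (csum b m) s) = (fun m => cmean (csum (taylor f) m) s).
  apply/funext => m; rewrite !cmean_csum //; apply: eq_bigr => k _.
  by rewrite /b normcM normcX u1 expr1n mulr1.
by rewrite E in c1; apply: (cvg_unique _ c1 c2).
Qed.

Definition area_density f (v : R -> R) : mR * mR -> \bar R :=
  (fun p => (normc (f (cpl p)) ^+ 2 * v (sqn p))%:E) \_ disk2.

Definition mean_density f (v : R -> R) : mR -> \bar R :=
  (fun x => (cmean f (Num.sqrt x) * v x)%:E) \_ (`[0%R, 1%R[%classic : set mR).

(** By Parseval the mean is a limit of polynomials in the squared radius on ]0, 1[; the point 0 is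
    added separately because Parseval is stated for positive radii. *)
Lemma measurable_cmean_sqrt f : analytic_on_disk f ->
  measurable_fun (`[0, 1[%classic : set mR) ((fun x => cmean f (Num.sqrt x)) : mR -> R).
Proof.
move=> fa; rewrite -(@setU1itv _ R (BLeft 1) 0 false); last by rewrite bnd_simp.
apply/measurable_funU => //; split; first exact: measurable_fun_set1.
apply: (measurable_fun_cvg (h := fun n (x : mR) =>
  \sum_(k < n) normc (taylor f k) ^+ 2 * x ^+ k)).
  by move=> n; apply: measurable_funTS; apply: measurable_sum => k;
    apply: measurable_funM => //; exact: measurable_funX.
move=> x xI; have /andP[x0 x1] : 0 < x < 1 by move: xI; rewrite /= in_itv.
have sb : 0 < Num.sqrt x < 1 by rewrite sqrtr_gt0 x0 -(sqrtr1 R) ltr_sqrt.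
have sq2 : Num.sqrt (x : R) ^+ 2 = x by apply: sqr_sqrtr; exact: ltW.
have := @parseval _ f (Num.sqrt x) 0%N fa sb.
rewrite (_ : (fun z => f z - csum (taylor f) 0%N z) = f); last first.
  by apply/funext => z; rewrite /csum big_ord0 subr0.
rewrite (_ : (fun m => \sum_(k < m) normc (tail (taylor f) 0%N k) ^+ 2 * _) =
  (fun m => \sum_(k < m) normc (taylor f k) ^+ 2 * x ^+ k)) //.
by apply/funext => m; apply: eq_bigr => k _; rewrite /tail leq0n exprM sq2.
Qed.

Lemma measurable_mean_density f (v : R -> R) : analytic_on_disk f -> measurable_fun setT v ->
  measurable_fun setT (mean_density f v).
Proof.
move=> fa mv; apply/(measurable_restrictT _ _).1 => //.
apply/measurable_EFinP; apply: measurable_funM; first exact: measurable_cmean_sqrt.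
exact: measurable_funTS.
Qed.

Lemma mean_density_ge0 f (v : R -> R) x : (forall x, 0 <= v x) -> (0 <= mean_density f v x)%E.
Proof.
move=> v0; rewrite /mean_density patchE; case: ifP => // _.
by rewrite lee_fin mulr_ge0 ?cmean_ge0.
Qed.

Lemma measurable_area_density f (v : R -> R) : analytic_on_disk f -> measurable_fun setT v ->
  measurable_fun setT (area_density f v).
Proof.
move=> fa mv; apply/(measurable_restrictT _ _).1; first exact: measurable_disk2.
apply/measurable_EFinP; apply: measurable_funM; first exact: measurable_analytic.
by apply: measurable_funTS; apply: (measurableT_comp mv measurable_sqn).
Qed.

Lemma area_density_ge0 f (v : R -> R) p : (forall x, 0 <= v x) -> (0 <= area_density f v p)%E.
Proof.
move=> v0; rewrite /area_density patchE; case: ifP => // _.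
by rewrite lee_fin mulr_ge0 ?sqr_ge0.
Qed.

(** Allows Tonelli's theorem between the angle and the plane; squares of an exhausting sequence of
    the line exhaust the plane. *)
Lemma sigma_finite_mu2 : sigma_finite setT mu2.
Proof.
have /sigma_finiteP[F [TF ndF Foo]] := sigma_finiteT mu.
exists (fun n => F n `*` F n).
  apply/esym; rewrite -subTset => -[x y] _; have : (\bigcup_n F n) x by rewrite -TF.
  have : (\bigcup_n F n) y by rewrite -TF.
  move=> [n _ Fny] [k _ Fkx]; exists (maxn n k) => //; split.
    by move: x Fkx; exact/subsetPset/ndF/leq_maxr.
  by move: y Fny; exact/subsetPset/ndF/leq_maxl.
move=> n; have [mF Fn] := Foo n; split; first exact: measurableX.
by rewrite product_measure1E // lte_mul_pinfty // ge0_fin_numE.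
Qed.

(** Area measure is rotation invariant, so the integral equals its average over all angles.
    Exchanging the two integrals puts the angle inside, where the integrand at [p] averages to the
    mean of |f|^2 over the circle through [p]. *)
Theorem area_average f (v : R -> R) : analytic_on_disk f -> measurable_fun setT v ->
  (forall x, 0 <= v x) ->
  (\int[mu2]_p area_density f v p = \int[mu2]_p mean_density f v (sqn p))%E.
Proof.
move=> fa mv v0.
have mG := measurable_area_density fa mv.
have G0 p := area_density_ge0 f p v0.
set G := area_density f v in mG G0 *.
pose rot (q : mR * (mR * mR)) : mR * mR :=
  (cos q.1 * q.2.1 - sin q.1 * q.2.2, sin q.1 * q.2.1 + cos q.1 * q.2.2).
have mrot : measurable_fun setT rot.
  have m21 : measurable_fun setT (fun q : mR * (mR * mR) => q.2.1).
    exact: (@measurableT_comp _ _ _ _ _ _ fst setT snd).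
  have m22 : measurable_fun setT (fun q : mR * (mR * mR) => q.2.2).
    exact: (@measurableT_comp _ _ _ _ _ _ snd setT snd).
  have mcos : measurable_fun setT (fun q : mR * (mR * mR) => cos q.1).
    apply: (@measurableT_comp _ _ _ _ _ _ (cos : mR -> mR) setT fst) => //.
    by apply: continuous_measurable_fun; exact: continuous_cos.
  have msin : measurable_fun setT (fun q : mR * (mR * mR) => sin q.1).
    apply: (@measurableT_comp _ _ _ _ _ _ (sin : mR -> mR) setT fst) => //.
    by apply: continuous_measurable_fun; exact: continuous_sin.
  apply: measurable_fun_pair; [apply: measurable_funB|apply: measurable_funD]; exact: measurable_funM.
pose F q := G (rot q).
have mF : measurable_fun setT F by exact: (measurableT_comp mG mrot).
have mD : measurable (`[0, 2 * pi]%classic : set mR) by [].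
pose mu2' : {sigma_finite_measure set (mR * mR)%type -> \bar R} :=
  HB.pack mu2 (Measure_isSigmaFinite.Build _ _ _ mu2 sigma_finite_mu2).
have Fub : (\int[mu]_(t in `[0%R, (2 * pi)%R]) \int[mu2]_p F (t, p) =
    \int[mu2]_p \int[mu]_(t in `[0%R, (2 * pi)%R]) F (t, p))%E.
  exact: (@fubini_tonelli_setX _ _ _ _ _ mu mu2' _ setT F mD measurableT mF (fun q => G0 _)).
move: Fub.
have -> : (\int[mu]_(t in `[0%R, (2 * pi)%R]) \int[mu2]_p F (t, p) =
    (2 * pi)%:E * \int[mu2]_p G p)%E.
  under eq_integral => t _.
    rewrite /F /rot /= (@ge0_integral_rotationT _ (cos t) (sin t) G) ?cos2Dsin2 //.
    over.
  rewrite integral_cst // muleC; congr (_ * _)%E.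
  have := @lebesgue_measure_itv R `[0, 2 * pi]; rewrite /= lte_fin twopi_gt0 => ->.
  by rewrite sube0.
have -> : (\int[mu2]_p \int[mu]_(t in `[0%R, (2 * pi)%R]) F (t, p) =
    (2 * pi)%:E * \int[mu2]_p mean_density f v (sqn p))%E.
  rewrite -ge0_integralZl //; last 3 first.
  - apply: (measurableT_comp _ measurable_sqn); exact: measurable_mean_density.
  - by move=> p _; exact: mean_density_ge0.
  - by rewrite lee_fin (ltW twopi_gt0).
  apply: eq_integral => p _; rewrite /F /rot /= /G /area_density /mean_density.
  have sqrot t : sqn (cos t * p.1 - sin t * p.2, sin t * p.1 + cos t * p.2) = sqn p.
    rewrite /sqn /=; transitivity ((cos t ^+ 2 + sin t ^+ 2) * (p.1 ^+ 2 + p.2 ^+ 2)); first by ring.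
    by rewrite cos2Dsin2 mul1r.
  have [dp|dp] := boolP (p \in disk2); last first.
    rewrite patchE ifF ?mule0; last first.
      by apply/negbTE; apply: contra dp; rewrite !inE /= in_itv /= => /andP[_ ?]; apply/disk2E.
    apply: integral0_eq => t _; rewrite patchE.
    case: ifP => //; rewrite inE => /disk2E; rewrite sqrot => /disk2E dp'.
    by case/negP: dp; exact: mem_set.
  have p1 : sqn p < 1 by apply/disk2E; exact: set_mem.
  rewrite patchE ifT; last by rewrite inE /= in_itv /= sqn_ge0.
  set s := Num.sqrt (sqn p).
  have s0 : 0 <= s by exact: sqrtr_ge0.
  have s1 : s < 1 by rewrite /s -(sqrtr1 R) ltr_sqrt.
  (* [u] is the direction of the point; at the origin any unit would do. *)
  have [u u1 uE] : exists2 u : C, normc u = 1 & cpl p = s%:C * u.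
    have [s00|sn0] := eqVneq s 0.
      exists 1; first exact: normc1.
      by rewrite s00 mul0r; apply: eq0_normc; rewrite normc_cplE.
    exists (cpl p / s%:C).
      by rewrite normcM normcV normc_real ger0_norm // normc_cplE divff.
    by rewrite mulrC divfK // (fmorph_eq0 (@real_complex R)).
  have rotE t : cpl (cos t * p.1 - sin t * p.2, sin t * p.1 + cos t * p.2) = circ s t * u.
    transitivity (circ 1 t * cpl p).
      by apply/eqP; rewrite eq_complex /=; apply/andP; split; apply/eqP; ring.
    by rewrite uE mulrA (mulrC (circ 1 t)) -circM mulr1.
  have du z : disk z -> disk (z * u).
    by move=> /diskE dz; apply/diskE; rewrite normcM u1 mulr1.
  have ga : analytic_on_disk (fun z => f (z * u)).
    have ma : analytic_on_disk (fun z => z * u).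
      by move=> z _; apply: (@derivableM _ C^o); [exact: derivable_id|exact: derivable_cst].
    exact: (@analytic_comp _ f (fun z => z * u) fa ma du).
  have sb : 0 <= s < 1 by rewrite s0.
  have cmE : cmean (fun z => f (z * u)) s = cmean f s.
    have [s00|sn0] := eqVneq s 0; last first.
      by apply: cmean_rotation => //; rewrite s1 lt_neqAle eq_sym sn0 s0.
    rewrite /cmean; congr (_ * _); apply: eq_segint => t _.
    have -> : circ s t = 0 by apply/eqP; rewrite eq_complex /= s00 !mul0r eqxx.
    by rewrite mul0r.
  transitivity (\int[mu]_(t in `[0%R, (2 * pi)%R]) ((v (sqn p))%:E * (normc (f (circ s t * u)) ^+ 2)%:E))%E.
    apply: eq_integral => t _; rewrite patchE ifT.
      by rewrite rotE sqrot mulrC EFinM.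
    by rewrite inE; apply/disk2E; rewrite sqrot.
  rewrite ge0_integralZl //; last 3 first.
  - apply/measurable_EFinP; apply: measurable_funTS; apply: continuous_measurable_fun.
    exact: (ccont_normc2 (ccont_analytic ga sb)).
  - by move=> t _; rewrite lee_fin sqr_ge0.
  - by rewrite lee_fin.
  have := circle_int_cmean ga sb; rewrite /circle_int => ->.
  by rewrite cmE -!EFinM; congr (_%:E); ring.
move=> /(congr1 (fun x => (2 * pi)^-1%:E * x)%E).
by rewrite !muleA -!EFinM mulVf ?mul1e // gt_eqF // twopi_gt0.
Qed.

End AreaAverage.

(** * Radial integrals in the variable |z|^2 *)

Section Radial.
Context {R : realType}.
Local Open Scope ereal_scope.
Local Notation mu := (@lebesgue_measure R).
Local Notation mR := (measurableTypeR R).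
Local Notation mu2 := (mu \x mu).

(** The parameter is the squared radius, which makes the area linear in [s]. *)
Let ball (s : R) : set (mR * mR) := [set p | (sqn p <= s)%R].

Let measurable_ball s : measurable (ball s).
Proof.
have -> : ball s = @sqn R @^-1` `]-oo, s] by apply/seteqP; split => p /=; rewrite in_itv.
by rewrite -[X in measurable X]setTI; apply: measurable_sqn.
Qed.

Let itvE (u v : R) : mu `]u, v] = if (u < v)%R then (v - u)%:E else 0.
Proof. by have := @lebesgue_measure_itv R `]u, v]; rewrite /= lte_fin EFinB. Qed.

Let ball1_fin : mu2 (ball 1) < +oo.
Proof.
pose I : set mR := `](-2)%R, 1%R]%classic.
have mI : measurable I by rewrite /I.
apply: (@le_lt_trans _ _ (mu2 (I `*` I))).
  apply: le_measure; [by rewrite inE; exact: measurable_ball|by rewrite inE; exact: measurableX|].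
  move=> [x y]; rewrite /ball /I /sqn /= => h; rewrite !in_itv /=.
  have x0 := sqr_ge0 x; have y0 := sqr_ge0 y.
  by split; apply/andP; split; nra.
have -> : mu2 (I `*` I) = mu I * mu I by exact: product_measure1E.
rewrite /I itvE.
have -> : (-2 < 1 :> R)%R by lra.
by rewrite -EFinM ltry.
Qed.

Let ball1_gt0 : 0 < mu2 (ball 1).
Proof.
pose I : set mR := `]0%R, (2^-1)%R]%classic.
have mI : measurable I by rewrite /I.
apply: (@lt_le_trans _ _ (mu2 (I `*` I))).
  have -> : mu2 (I `*` I) = mu I * mu I by exact: product_measure1E.
rewrite /I itvE.
  have -> : (0 < 2^-1 :> R)%R by rewrite invr_gt0.
  by rewrite -EFinM lte_fin subr0 mulr_gt0 // invr_gt0.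
apply: le_measure; [by rewrite inE; exact: measurableX|by rewrite inE; exact: measurable_ball|].
move=> [x y]; rewrite /I /= !in_itv /= => -[/andP[x0 x1] /andP[y0 y1]].
have h : (2^-1 + 2^-1 = 1 :> R)%R by lra.
rewrite /ball /sqn /=; nra.
Qed.

(** The area of the unit disk, kept as an unevaluated positive constant. *)
Let kappa : R := fine (mu2 (ball 1)).

Let kappa_gt0 : (0 < kappa)%R.
Proof. by rewrite /kappa fine_gt0 // ball1_gt0 ball1_fin. Qed.

Let ball1E : mu2 (ball 1) = kappa%:E.
Proof. by rewrite /kappa fineK // ge0_fin_numE. Qed.

Let ball_measure_gt0 s : (0 < s)%R -> mu2 (ball s) = (kappa * s)%:E.
Proof.
move=> s0; pose a := Num.sqrt s; have a0 : (0 < a)%R by rewrite sqrtr_gt0.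
have a2 : (a ^+ 2 = s)%R by rewrite sqr_sqrtr // ltW.
have := @ge0_integral_dilation R a (fun p => (\1_(ball s) p)%:E) a0.
rewrite (_ : \int[mu2]_p (\1_(ball s) p)%:E = mu2 (ball s)); last first.
  by rewrite integral_indic // setIT.
move=> <-; last 2 first.
- by apply/measurable_EFinP; exact: measurable_indic.
- by move=> p; rewrite lee_fin.
rewrite (eq_integral (fun p => (\1_(ball 1) p)%:E)); last first.
  move=> p _; rewrite !indicE; congr ((_ %:R)%:E); congr nat_of_bool.
  have E : (sqn (a * p.1, a * p.2) = s * sqn p)%R by rewrite /sqn /= -a2; ring.
  by apply/idP/idP; rewrite !inE /ball /= E; rewrite -{2}[s]mulr1 ler_pM2l.
rewrite integral_indic // setIT a2; transitivity (s%:E * mu2 (ball 1)) => //.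
by rewrite ball1E -EFinM mulrC.
Qed.

(** For s <= 0 the set is contained in balls of arbitrarily small area [e], so its measure
    vanishes. *)
Let ball_measure s : mu2 (ball s) = (kappa * Num.max s 0)%:E.
Proof.
have [s0|s0] := ltP 0%R s; first exact: ball_measure_gt0.
rewrite mulr0; apply/eqP; rewrite eq_le measure_ge0 andbT.
apply/lee_addgt0Pr => e e0; rewrite add0e.
apply: (@le_trans _ _ (mu2 (ball (e / kappa)))).
  apply: le_measure; [by rewrite inE; exact: measurable_ball|by rewrite inE; exact: measurable_ball|].
  move=> p; rewrite /ball /= => h; apply: le_trans h _; apply: le_trans s0 _.
  by rewrite divr_ge0 // ltW.
rewrite ball_measure_gt0 ?divr_gt0 // mulrC divfK //.
by rewrite gt_eqF.
Qed.

Let msqn : measurable_fun setT ((fun p => sqn p) : mR * mR -> mR).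
Proof. exact: measurable_sqn. Qed.
Let m1 := measure_function_pushforward__canonical__measure_function_Measure mu2 msqn.
Let mneg : measurable (`]-oo, 0%R]%classic : set mR). Proof. by []. Qed.
Let m2 := measure_function_mrestr__canonical__measure_function_Measure mu mneg.
Let kV : {nonneg R} := NngNum (ltW (etrans (invr_gt0 kappa) kappa_gt0)).

(* lebesgue_measure_unique needs a measure on the whole line, hence the summand m2
   carrying the negative half-line. *)
Let sqn_pushforward (A : set mR) : measurable A ->
  mu A = measure_add (mscale kV m1) m2 A.
Proof.
apply: (@lebesgue_measure_unique R (measure_add (mscale kV m1) m2)).
move=> _ [[c d] /= _ <-].
transitivity (kappa^-1%:E * mu2 (((fun p => sqn p) : mR * mR -> mR) @^-1` `]c, d]%classic) +
  mu (`]c, d] `&` `]-oo, 0%R])); last by symmetry; exact: measure_addE.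
have [dc|cd] := leP d c.
  have -> : `]c, d]%classic = set0 :> set R by rewrite set_itv_ge // bnd_simp -leNgt.
  by rewrite preimage_set0 set0I !measure0 mule0 adde0.
have -> : `]c, d] `&` `]-oo, 0%R] = `]c, Num.min d (0:R)%R]%classic :> set R.
  apply/seteqP; split => x /=; rewrite !in_itv /= le_min.
    by move=> [/andP[-> ->] ->].
  by move=> /andP[-> /andP[-> ->]].
have D : mu2 (ball d) = mu2 (ball c) + mu2 (((fun p => sqn p) : mR * mR -> mR) @^-1` `]c, d]%classic).
  rewrite -measureU //.
  - congr (mu2 _); apply/seteqP; split => p; rewrite /ball /= in_itv /=.
      by move=> pd; have [pc|cp] := leP (sqn p) c; [left|right; rewrite pd].
    by move=> [pc|/andP[]//]; apply: le_trans pc _; exact: ltW.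
  - by rewrite -[X in measurable X]setTI; apply: measurable_sqn.
  - by apply/seteqP; split => p //; rewrite /ball /= in_itv /= => -[pc /andP[]]; rewrite ltNge pc.
have -> : mu2 (((fun p => sqn p) : mR * mR -> mR) @^-1` `]c, d]%classic) = (kappa * (Num.max d 0 - Num.max c 0))%:E.
  move: D; rewrite !ball_measure => D.
  have : mu2 (((fun p => sqn p) : mR * mR -> mR) @^-1` `]c, d]%classic) \is a fin_num.
    rewrite ge0_fin_numE //; rewrite ltNge; apply/negP => h.
    by move: D; rewrite leye_eq in h; rewrite (eqP h).
  move=> /fineK Fk; move: D; rewrite -Fk -EFinD => -[D].
  by congr (_%:E); rewrite mulrBr D addrAC subrr add0r.
rewrite !itvE cd -EFinM mulKf ?gt_eqF //.
have [d0|d0] := leP d 0%R; have [c0|c0] := leP c 0%R.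
- by rewrite cd subrr add0e.
- by have := lt_trans c0 cd; rewrite ltNge d0.
- by case: ltP => c0'; rewrite -?EFinD ?adde0; congr (_%:E); lra.
- by rewrite ltNge (ltW c0) /= adde0.
Qed.

(** The pushforward of area under the squared modulus is [kappa] times Lebesgue measure on the
    half-line, since both have the same distribution function. *)
Theorem radial_integral : exists2 k : R, (0 < k)%R &
  forall Psi : mR -> \bar R, measurable_fun setT Psi -> (forall x, 0 <= Psi x) ->
    (forall x, (x < 0)%R -> Psi x = 0) ->
    \int[mu2]_p Psi (sqn p) = k%:E * \int[mu]_x Psi x.
Proof.
exists kappa => // Psi mP P0 Pneg.
have -> : \int[mu2]_p Psi (sqn p) = \int[pushforward mu2 ((fun p => sqn p) : mR * mR -> mR)]_x Psi x.
  by rewrite ge0_integral_pushforward //; exact: msqn.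
have -> : \int[mu]_x Psi x = \int[mu]_(x in `[0%R, +oo[) Psi x.
  rewrite [RHS]integral_mkcond; apply: eq_integral => x _; rewrite patchE.
  case: ifPn => // xn; apply: Pneg; rewrite ltNge; apply: contra xn => x0.
  by rewrite inE /= in_itv /= x0.
have -> : \int[pushforward mu2 ((fun p => sqn p) : mR * mR -> mR)]_x Psi x =
    \int[pushforward mu2 ((fun p => sqn p) : mR * mR -> mR)]_(x in `[0%R, +oo[) Psi x.
  rewrite [RHS]integral_mkcond; apply: eq_integral => x _; rewrite patchE.
  case: ifPn => // xn; apply: Pneg; rewrite ltNge; apply: contra xn => x0.
  by rewrite inE /= in_itv /= x0.
have -> : \int[mu]_(x in `[0%R, +oo[) Psi x = \int[mscale kV m1]_(x in `[0%R, +oo[) Psi x.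
  apply: eq_measure_integral => A mA A0.
  rewrite -[RHS]adde0; have := sqn_pushforward mA; rewrite measure_addE => E.
  rewrite [LHS]E; congr (_ + _).
  (* On subsets of [0, +oo[ the auxiliary summand charges at most the point 0, a null set. *)
  apply/eqP; rewrite eq_le measure_ge0 andbT -(lebesgue_measure_set1 (0:R)).
  apply: le_measure; [by rewrite inE; exact: measurableI|by rewrite inE|].
  move=> x [/A0 /=]; rewrite !in_itv /= andbT => x0 x0'.
  by apply/eqP; rewrite eq_le x0 x0'.
rewrite ge0_integral_mscale //; last exact: measurable_funTS.
by rewrite muleA -EFinM mulfV ?mul1e // gt_eqF.
Qed.

End Radial.

(** * The two norms as functionals of circular means *)

Section BergmanWeight.
Context {R : realType}.
Local Notation mu := (@lebesgue_measure R).
Local Notation mR := (measurableTypeR R).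
Implicit Types (beta x : R).

Definition bergman_weight beta x : R := (beta + 1) * (1 - x) `^ beta.

Lemma bergman_weight_ge0 beta x : -1 < beta -> 0 <= bergman_weight beta x.
Proof. by move=> b1; rewrite mulr_ge0 ?powR_ge0 //; lra. Qed.

Lemma measurable_bergman_weight beta :
  measurable_fun setT (bergman_weight beta : mR -> mR).
Proof.
apply: measurable_funM => //.
apply: (@measurableT_comp _ _ _ _ _ _ (@powR R ^~ beta)); first exact: measurable_powR.
exact: measurable_funB.
Qed.

Lemma is_derive_bergman_weight beta x : x < 1 ->
  is_derive x 1 (fun y : R => - (1 - y) `^ (beta + 1)) (bergman_weight beta x).
Proof.
move=> x1; have x0 : 0 < 1 - x by rewrite subr_gt0.
have d1 : is_derive x 1 (fun y : R => 1 - y) (0 - 1) by apply: is_deriveB.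
have d2 := is_derive1_powR (beta + 1) x0.
have := @is_derive1_comp _ (fun y => y `^ (beta + 1)) (fun y : R => 1 - y) x _ _ d2 d1.
rewrite addrK sub0r mulrN1 => d3.
by rewrite -[bergman_weight beta x]opprK; exact: is_deriveN.
Qed.

Lemma continuous_bergman_weight beta x : x < 1 -> {for x, continuous (bergman_weight beta)}.
Proof.
move=> x1; have x0 : 0 < 1 - x by rewrite subr_gt0.
have cp : {for 1 - x, continuous (fun y : R => y `^ beta)}.
  apply: differentiable_continuous; apply/derivable1_diffP.
  by apply: derivable_powR; rewrite in_itv /= andbT.
apply: cvgM; first exact: cvg_cst.
apply: (@cvg_comp _ _ _ (fun y : R => 1 - y) (fun y => y `^ beta) (nbhs x) (nbhs (1 - x))) => //.
by apply: cvgB; [exact: cvg_cst|exact: cvg_id].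
Qed.

Lemma bergman_weight_partial beta (b : R) : 0 < b < 1 ->
  (\int[mu]_(x in `[0%R, b]) (bergman_weight beta x)%:E = (1 - (1 - b) `^ (beta + 1))%:E)%E.
Proof.
move=> /andP[b0 b1].
have l1 (x : R) : x <= b -> x < 1 by move=> xb; exact: le_lt_trans xb b1.
have cF (x : R) : x < 1 -> {for x, continuous (fun y : R => - (1 - y) `^ (beta + 1))}.
  by move=> x1; apply: differentiable_continuous; apply/derivable1_diffP; case: (is_derive_bergman_weight beta x1).
rewrite (@continuous_FTC2 _ _ (fun y : R => - (1 - y) `^ (beta + 1))) //.
- by rewrite subr0 powR1 -EFinB opprK addrC.
- apply: continuous_in_subspaceT => x; rewrite inE /= in_itv /= => /andP[_ /l1].
  exact: continuous_bergman_weight.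
- split.
  + move=> x; rewrite in_itv /= => /andP[_ /ltW/l1 x1].
    by case: (is_derive_bergman_weight beta x1).
  + by apply: cvg_at_right_filter; exact: cF.
  + by apply: cvg_at_left_filter; exact: cF.
- move=> x; rewrite in_itv /= => /andP[_ /ltW/l1 x1].
  by rewrite derive1E; case: (is_derive_bergman_weight beta x1).
Qed.

(** For negative beta the weight is unbounded near 1, so the primitive is used on [0, 1 - 1/(n+2)]
    and monotone convergence does the rest; each partial integral is 1 minus a nonnegative power. *)
Lemma bergman_weight_integral beta : -1 < beta ->
  (\int[mu]_(x in `]0%R, 1%R[) (bergman_weight beta x)%:E <= 1)%E.
Proof.
move=> b1; pose F (n : nat) : set mR := `[0, 1 - n.+2%:R^-1]%classic.
have n0 (n : nat) : 0 < (n.+2%:R^-1 : R) < 1.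
  by rewrite invr_gt0 ltr0n /= invf_lt1 ?ltr0n // ltr1n.
have mw (A : set mR) : measurable_fun A (fun x : mR => (bergman_weight beta x)%:E).
  by apply: measurable_funTS; apply/measurable_EFinP; exact: measurable_bergman_weight.
have w0 x : (0 <= (bergman_weight beta x)%:E)%E by rewrite lee_fin bergman_weight_ge0.
have mF n : measurable (F n) by rewrite /F.
have ndF : nondecreasing_seq F.
  apply/nondecreasing_seqP => n; rewrite subsetEset => x; rewrite /F /= !in_itv /= => /andP[-> h] /=.
  apply: le_trans h _; rewrite lerD2l lerN2 lef_pV2 ?posrE ?ltr0n // ler_nat.
  exact: leqnSn.
apply: (@le_trans _ _ (\int[mu]_(x in \bigcup_n F n) (bergman_weight beta x)%:E)%E).
  apply: ge0_subset_integral => //; first exact: bigcup_measurable.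
  move=> x /=; rewrite in_itv /= => /andP[x0 x1].
  have x1' : 0 < 1 - x by rewrite subr_gt0.
  have [n _ nx] := near_infty_natSinv_lt (PosNum x1').
  exists n => //; rewrite /F /= in_itv /= (ltW x0) /=.
  by have /= /ltW := nx n.+1 (leqnSn n); rewrite lerBrDl -lerBrDr.
have cv := @ge0_nondecreasing_set_cvg_integral _ mR R F (fun x => (bergman_weight beta x)%:E)
  mu ndF mF (fun i => mw _) (fun i x _ => w0 x).
rewrite -(cvg_lim _ cv) //; apply: lime_le; first exact: cvgP cv.
apply: nearW => n; rewrite bergman_weight_partial; last first.
  by have /andP[i0 i1] := n0 n; rewrite subr_gt0 gtrBl i0 i1.
by rewrite lee_fin gerDl oppr_le0 powR_ge0.
Qed.
End BergmanWeight.

(** * Gauges of radial profiles *)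

Section RadialGauge.
Context {R : realType}.
Local Notation C := (R[i]).
Local Notation mu := (@lebesgue_measure R).
Local Notation mR := (measurableTypeR R).
Implicit Types (m : mR -> R) (f : C -> C) (x : R).

Definition radial_profile m : Prop :=
  measurable_fun (`]0, 1[%classic : set mR) (m : mR -> mR) /\ forall x, 0 < x < 1 -> 0 <= m x.

Definition radial_mean f : mR -> R := fun x => cmean f (Num.sqrt x).

Lemma radial_profile_mean f : analytic_on_disk f -> radial_profile (radial_mean f).
Proof.
move=> fa; split; last by move=> x _; exact: cmean_ge0.
apply: (measurable_funS _ _ (measurable_cmean_sqrt fa)) => //.
by move=> x /=; rewrite !in_itv /= => /andP[/ltW -> ->].
Qed.

Definition taylor_remainder f n : C -> C := fun z => f z - csum (taylor f) n z.

(* The argument of a gauge is the mean of |f|^2 over circles as a function of the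
   squared radius. *)
Record radial_gauge := RadialGauge {
  gauge :> (mR -> R) -> \bar R;
  gauge_ge0 m : radial_profile m -> (0 <= gauge m)%E;
  gauge_le m m' : radial_profile m -> radial_profile m' ->
    (forall x, 0 < x < 1 -> m x <= m' x) -> (gauge m <= gauge m')%E;
  gauge_lin m m' (a b : R) : radial_profile m -> radial_profile m' -> 0 <= a -> 0 <= b ->
    (gauge (fun x => a * m x + b * m' x)%R <= a%:E * gauge m + b%:E * gauge m')%E;
  gauge_cst : exists2 c : R, 0 <= c &
    forall M : R, 0 <= M -> (gauge (fun=> M) <= (c * M)%:E)%E;
  gauge_affine (c : R) : 0 < c < 1 -> exists2 K : R, 0 <= K &
    forall m, radial_profile m -> (gauge (fun x => m (1 - c * (1 - x))%R) <= K%:E * gauge m)%E;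
  gauge_taylor f : analytic_on_disk f -> (gauge (radial_mean f) < +oo)%E ->
    gauge (radial_mean (taylor_remainder f n)) @[n --> \oo] --> 0%E
}.

(** The substitution multiplies the distance 1 - x to the boundary by [c]; this is the enlargement
    of the radius that subordination by a self-map costs. *)
Lemma radial_profile_affine m (c : R) : 0 < c < 1 -> radial_profile m ->
  radial_profile (fun x => m (1 - c * (1 - x))).
Proof.
move=> /andP[c0 c1] [mm m0].
have sub x : 0 < x < 1 -> 0 < 1 - c * (1 - x) < 1.
  by move=> /andP[x0 x1]; apply/andP; split; nra.
split; last by move=> x /sub; exact: m0.
apply: (@measurable_comp _ _ _ _ _ _ (`]0, 1[%classic : set mR) m _
  (fun x : mR => 1 - c * (1 - x) : mR)) => //.
  by move=> _ [x /= + <-]; rewrite !in_itv /=; exact: sub.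
by apply: measurable_funB => //; apply: measurable_funM => //; apply: measurable_funB.
Qed.

Definition hardy_gauge_fun m : \bar R := ereal_sup [set (m x)%:E | x in `]0%R, 1%R[%classic].

Lemma hardy_gauge_leP m (M : \bar R) :
  (hardy_gauge_fun m <= M)%E <-> forall x, 0 < x < 1 -> ((m x)%:E <= M)%E.
Proof.
split=> h.
  by move=> x x01; apply: le_trans h; apply: ereal_sup_ubound; exists x; rewrite //= in_itv.
by apply: ge_ereal_sup => _ [x /= x01 <-]; apply: h; rewrite in_itv in x01.
Qed.

Lemma hardy_gauge_ubound m x : 0 < x < 1 -> ((m x)%:E <= hardy_gauge_fun m)%E.
Proof. by move=> x01; apply/(hardy_gauge_leP m _).1. Qed.

Lemma sum_tail (a : nat -> C) n k :
  \sum_(j < k) normc (tail a n j) ^+ 2 =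
  \sum_(j < maxn n k) normc (a j) ^+ 2 - \sum_(j < n) normc (a j) ^+ 2.
Proof.
elim: k => [|k IH]; first by rewrite maxn0 subrr big_ord0.
rewrite big_ord_recr IH /= /tail; case: leqP => [nk|kn].
  have -> : maxn n k.+1 = k.+1 by apply/maxn_idPr; exact: leqW.
  by rewrite big_ord_recr /= addrAC.
by rewrite (maxn_idPl kn) normc0 expr0n addr0.
Qed.

(** Bessel's inequality at radius s, in the limit s -> 1. *)
Lemma sum_taylor_le f (M : R) k : analytic_on_disk f ->
  (forall x, 0 < x < 1 -> radial_mean f x <= M) -> \sum_(j < k) normc (taylor f j) ^+ 2 <= M.
Proof.
move=> fa fM; pose p (s : R) := \sum_(j < k) normc (taylor f j) ^+ 2 * s ^+ (2 * j).
have -> : \sum_(j < k) normc (taylor f j) ^+ 2 = p 1.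
  by apply: eq_bigr => j _; rewrite expr1n mulr1.
have cp : p x @[x --> 1^'-] --> p 1.
  apply: cvg_at_left_filter; rewrite /p; elim: k {p} => [|k IH].
    by under eq_fun do rewrite big_ord0; rewrite big_ord0; exact: cvg_cst.
  under eq_fun do rewrite big_ord_recr; rewrite big_ord_recr; apply: cvgD => //.
  by apply: cvgM; [exact: cvg_cst|exact: exprn_continuous].
rewrite -(cvg_lim _ cp) //; apply: limr_le; first exact: cvgP cp.
near=> s.
have s01 : 0 < s < 1 by apply/andP; split; near: s; [exact: nbhs_left_gt|exact: nbhs_left_lt].
have /andP[s0 s1] := s01.
apply: le_trans (@bessel _ f s k fa s01) _.
have -> : cmean f s = radial_mean f (s ^+ 2) by rewrite /radial_mean sqrtr_sqr ger0_norm // ltW.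
by apply: fM; rewrite exprn_gt0 //= exprn_ilt1 // ltW.
Unshelve. all: by end_near. Qed.

(** The squared coefficients are summable, and the tail of their series bounds the mean of the
    remainder at all radii at once. *)
Lemma hardy_gauge_taylor f : analytic_on_disk f -> (hardy_gauge_fun (radial_mean f) < +oo)%E ->
  hardy_gauge_fun (radial_mean (taylor_remainder f n)) @[n --> \oo] --> 0%E.
Proof.
move=> fa foo.
have h0 g : (0 <= hardy_gauge_fun (radial_mean g))%E.
  apply: le_trans (@hardy_gauge_ubound (radial_mean g) 2^-1 _); first by rewrite lee_fin cmean_ge0.
  by apply/andP; split; lra.
pose M := fine (hardy_gauge_fun (radial_mean f)).
have ME : hardy_gauge_fun (radial_mean f) = M%:E by rewrite fineK // ge0_fin_numE.
have fM x : 0 < x < 1 -> radial_mean f x <= M.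
  by move=> x01; rewrite -lee_fin -ME; exact: hardy_gauge_ubound.
pose S k : R := \sum_(j < k) normc (taylor f j) ^+ 2.
have ndS : nondecreasing_seq S.
  by apply/nondecreasing_seqP => k; rewrite /S big_ord_recr lerDl sqr_ge0.
have cS : cvgn S.
  apply: nondecreasing_is_cvgn => //; exists M => _ [k _ <-]; exact: sum_taylor_le.
have SL k : S k <= limn S by exact: nondecreasing_cvgn_le.
have D n : (hardy_gauge_fun (radial_mean (taylor_remainder f n)) <= (limn S - S n)%:E)%E.
  apply/hardy_gauge_leP => x /andP[x0 x1]; rewrite lee_fin; apply: cmean_remainder_le => //.
    by rewrite sqrtr_gt0 x0 -(sqrtr1 R) ltr_sqrt.
  by move=> k; rewrite sum_tail lerD2r; exact: SL.
apply: (@squeeze_cvge _ _ _ _ (fun=> 0%E) _ (fun n => (limn S - S n)%:E)).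
- by apply: nearW => n; rewrite h0 D.
- exact: cvg_cst.
- apply: cvg_EFin; first exact: nearW.
  by rewrite -(subrr (limn S)); apply: cvgB => //; exact: cvg_cst.
Qed.

End RadialGauge.

Section Gauges.
Context {R : realType}.
Local Notation C := (R[i]).
Local Notation mu := (@lebesgue_measure R).
Local Notation mR := (measurableTypeR R).
Local Notation mu2 := (mu \x mu)%E.
Implicit Types (m : mR -> R) (f : C -> C) (x : R).

Lemma half_in01 : 0 < (2^-1 : R) < 1.
Proof. by apply/andP; split; lra. Qed.

Definition hardy_gauge : radial_gauge (R := R).
Proof.
apply: (@RadialGauge _ (@hardy_gauge_fun R)).
- move=> m [_ m0]; apply: le_trans (hardy_gauge_ubound m half_in01).
  by rewrite lee_fin m0 // half_in01.
- move=> m m' _ _ mm'; apply/hardy_gauge_leP => x x01.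
  by apply: le_trans (hardy_gauge_ubound m' x01); rewrite lee_fin mm'.
- move=> m m' a b _ _ a0 b0; apply/hardy_gauge_leP => x x01.
  by rewrite EFinD !EFinM; apply: leeD; apply: lee_wpmul2l; rewrite ?lee_fin //; exact: hardy_gauge_ubound.
- by exists 1 => // M M0; apply/hardy_gauge_leP => x _; rewrite mul1r.
- move=> c /andP[c0 c1]; exists 1 => // m _; rewrite mul1e.
  apply/hardy_gauge_leP => x /andP[x0 x1].
  by apply: hardy_gauge_ubound; apply/andP; split; nra.
- exact: hardy_gauge_taylor.
Defined.

Lemma hardy_normE f : analytic_on_disk f -> hardy_norm f = sqrte (hardy_gauge (radial_mean f)).
Proof.
move=> fa; rewrite /hardy_norm /= /hardy_gauge_fun; congr (sqrte (ereal_sup _)).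
have E (r : R) : 0 < r -> r < 1 ->
    (((2 * pi)^-1)%:E * \int[mu]_(t in `[0%R, (2 * pi)%R])
       (normc (f ((r * cos t) +i* (r * sin t))) ^+ 2)%:E)%E = (cmean f r)%:E.
  move=> r0 r1; have -> : (\int[mu]_(t in `[0%R, (2 * pi)%R])
       (normc (f ((r * cos t) +i* (r * sin t))) ^+ 2)%:E)%E = circle_int f r by [].
  rewrite circle_int_cmean // ?(ltW r0) // -EFinM mulKf // gt_eqF // twopi_gt0 //.
apply/seteqP; split => _ [r /= + <-]; rewrite in_itv /= => /andP[r0 r1].
  exists (r ^+ 2); first by rewrite /= in_itv /= exprn_gt0 //= exprn_ilt1 // ltW.
  by rewrite /radial_mean sqrtr_sqr ger0_norm ?(ltW r0) // E.
have sr : Num.sqrt r < 1 by rewrite -(sqrtr1 R) ltr_sqrt.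
exists (Num.sqrt r); first by rewrite /= in_itv /= sqrtr_gt0 r0.
by rewrite E // sqrtr_gt0.
Qed.

Section Bergman.
Context (beta : R) (k : R).
Context (beta1 : -1 < beta) (k0 : 0 <= k).
Local Notation v := (bergman_weight beta).

Definition bergman_gauge_fun m : \bar R :=
  (k%:E * \int[mu]_(x in `]0%R, 1%R[) (m x * v x)%:E)%E.

Let mv m : radial_profile m ->
  measurable_fun (`]0, 1[%classic : set mR) (fun x : mR => (m x * v x)%:E).
Proof.
move=> [mm _]; apply/measurable_EFinP; apply: measurable_funM => //.
by apply: measurable_funTS; exact: measurable_bergman_weight.
Qed.

Let v0 x : 0 <= v x. Proof. exact: bergman_weight_ge0. Qed.

Let mv0 m : radial_profile m -> forall x, (`]0, 1[%classic : set mR) x -> (0 <= (m x * v x)%:E)%E.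
Proof. by move=> [_ m0] x /=; rewrite in_itv => x01; rewrite lee_fin mulr_ge0 // m0. Qed.

Lemma bergman_gauge_ge0 m : radial_profile m -> (0 <= bergman_gauge_fun m)%E.
Proof. by move=> pm; apply: mule_ge0; rewrite ?lee_fin //; apply: integral_ge0; exact: mv0. Qed.

Lemma bergman_gauge_le m m' : radial_profile m -> radial_profile m' ->
  (forall x, 0 < x < 1 -> m x <= m' x) -> (bergman_gauge_fun m <= bergman_gauge_fun m')%E.
Proof.
move=> pm pm' mm'; apply: lee_wpmul2l; rewrite ?lee_fin //.
apply: ge0_le_integral => //; [exact: mv0|exact: mv|exact: mv|].
by move=> x /=; rewrite in_itv => x01; rewrite lee_fin ler_wpM2r // mm'.
Qed.

Lemma bergman_gauge_lin m m' (a b : R) : radial_profile m -> radial_profile m' ->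
  0 <= a -> 0 <= b -> (bergman_gauge_fun (fun x => a * m x + b * m' x)%R <=
    a%:E * bergman_gauge_fun m + b%:E * bergman_gauge_fun m')%E.
Proof.
move=> pm pm' a0 b0; rewrite /bergman_gauge_fun !(muleCA _ k%:E) -muleDr //; last first.
  by apply: ge0_adde_def; rewrite inE mule_ge0 ?lee_fin //; apply: integral_ge0; exact: mv0.
apply: lee_wpmul2l; rewrite ?lee_fin // le_eqVlt; apply/orP; left; apply/eqP.
rewrite -!ge0_integralZl //; [|exact: mv|exact: mv0|exact: mv|exact: mv0].
rewrite -ge0_integralD //.
- by apply: eq_integral => x _; rewrite -!EFinM -EFinD; congr (_%:E); ring.
- by move=> x x01; apply: mule_ge0; rewrite ?lee_fin //; exact: mv0.
- by apply: measurable_funeM; exact: mv.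
- by move=> x x01; apply: mule_ge0; rewrite ?lee_fin //; exact: mv0.
- by apply: measurable_funeM; exact: mv.
Qed.

Lemma bergman_gauge_cst : exists2 c : R, 0 <= c &
  forall M : R, 0 <= M -> (bergman_gauge_fun (fun=> M) <= (c * M)%:E)%E.
Proof.
exists k => // M M0; rewrite EFinM; apply: lee_wpmul2l; rewrite ?lee_fin //.
under eq_integral do rewrite EFinM.
rewrite ge0_integralZl //; first 1 last.
- by apply: measurable_funTS; apply/measurable_EFinP; exact: measurable_bergman_weight.
- by move=> x _; rewrite lee_fin.
- by rewrite -[leRHS]mule1; apply: lee_wpmul2l; [rewrite lee_fin|exact: bergman_weight_integral].
Qed.

(** The substitution y = 1 - c (1 - x) maps ]0, 1[ onto ]1 - c, 1[; it contributes 1 / c from the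
    measure and c^(-beta) from the weight, and extending the range of y back to ]0, 1[ only
    increases the integral. *)
Lemma bergman_gauge_affine (c : R) : 0 < c < 1 -> exists2 K : R, 0 <= K &
  forall m, radial_profile m ->
    (bergman_gauge_fun (fun x => m (1 - c * (1 - x))%R) <= K%:E * bergman_gauge_fun m)%E.
Proof.
move=> c01; have /andP[c0 c1] := c01.
have cb0 : 0 < c `^ beta by exact: powR_gt0.
exists ((c `^ beta)^-1 * c^-1); first by rewrite mulr_ge0 ?invr_ge0 ?(ltW cb0) ?(ltW c0).
move=> m pm; have pm' := radial_profile_affine c01 pm.
rewrite /bergman_gauge_fun muleCA; apply: lee_wpmul2l; rewrite ?lee_fin //.
pose g : mR -> \bar R := (fun x => (m x * v x)%:E) \_ (`]0, 1[%classic : set mR).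
have g0 x : (0 <= g x)%E by rewrite /g; apply: erestrict_ge0; exact: mv0.
have mg : measurable_fun setT g by apply/(measurable_restrictT _ _).1 => //; exact: mv.
have -> : (\int[mu]_(x in `]0%R, 1%R[) (m x * v x)%:E = \int[mu]_x g x)%E.
  exact: integral_mkcond.
rewrite (@ge0_integral_affine _ c (1 - c) g) //.
rewrite muleA -EFinM mulfVK ?gt_eqF //.
rewrite -ge0_integralZl //; first last.
- by rewrite lee_fin invr_ge0 ltW.
- apply: (measurableT_comp mg); exact: measurable_affine.
pose h : mR -> \bar R := (fun x => (m (1 - c * (1 - x)) * v x)%:E) \_ (`]0, 1[%classic : set mR).
have -> : (\int[mu]_(x in `]0%R, 1%R[) (m (1 - c * (1 - x)) * v x)%:E = \int[mu]_x h x)%E.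
  exact: integral_mkcond.
apply: (@ge0_le_integral _ mR R mu setT measurableT h) => //.
- by move=> x _; apply: erestrict_ge0; exact: mv0.
- by apply/(measurable_restrictT _ _).1 => //; exact: mv.
- by apply: measurable_funeM; apply: (measurableT_comp mg); exact: measurable_affine.
move=> x _; rewrite /h patchE; case: ifPn => [|_]; last by rewrite mule_ge0 // lee_fin invr_ge0 ltW.
rewrite inE /= in_itv /= => /andP[x0 x1].
have E : c * x + (1 - c) = 1 - c * (1 - x) by ring.
rewrite /g patchE ifT; last first.
  by rewrite inE /= in_itv /= E; apply/andP; split; nra.
rewrite -EFinM lee_fin E /bergman_weight.
have -> : 1 - (1 - c * (1 - x)) = c * (1 - x) by ring.
rewrite powRM ?(ltW c0) ?subr_ge0 ?(ltW x1) //.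
rewrite le_eqVlt; apply/orP; left; apply/eqP.
by have cbN := lt0r_neq0 cb0; field.
Qed.

(** Dominated convergence: the means of the remainders tend to 0 at each radius and stay below those
    of [f]. *)
Lemma bergman_gauge_taylor f : analytic_on_disk f -> (bergman_gauge_fun (radial_mean f) < +oo)%E ->
  bergman_gauge_fun (radial_mean (taylor_remainder f n)) @[n --> \oo] --> 0%E.
Proof.
(* Finiteness of the gauge gives finiteness of the integral only when the factor [k] is positive. *)
move=> fa foo; have [k00|kn0] := eqVneq k 0.
  by rewrite /bergman_gauge_fun k00; under eq_fun do rewrite mul0e; exact: cvg_cst.
have kp : 0 < k by rewrite lt_neqAle eq_sym kn0.
have ra n : analytic_on_disk (taylor_remainder f n).
  move=> z dz; apply: (@derivableB _ C^o C^o); first exact: fa.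
  exact: derivable_csum.
have pr n := radial_profile_mean (ra n).
have pf := radial_profile_mean fa.
have sx x : 0 < x < 1 -> 0 < Num.sqrt x < 1.
  by move=> /andP[x0 x1]; rewrite sqrtr_gt0 x0 -(sqrtr1 R) ltr_sqrt.
have -> : 0%E = (k%:E * \int[mu]_(x in (`]0%R, 1%R[%classic : set mR)) (cst 0 x))%E.
  by rewrite integral0 mule0.
apply: cvgeZl => //.
apply: (@dominated_cvg _ mR R mu (`]0, 1[%classic : set mR) _
  (fun n x => (radial_mean (taylor_remainder f n) x * v x)%:E) _
  (fun x => (radial_mean f x * v x)%:E)) => //.
- by move=> n; exact: mv.
- move=> x /=; rewrite in_itv => x01; apply: cvg_EFin; first exact: nearW.
  rewrite -(mul0r (v x)); apply: cvgM; last exact: cvg_cst.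
  by apply: cmean_remainder_cvg0 => //; exact: sx.
- apply/integrableP; split; first exact: mv.
  have ioo : (\int[mu]_(x in `]0%R, 1%R[) (radial_mean f x * v x)%:E < +oo)%E.
    move: foo; rewrite /bergman_gauge_fun; case: (\int[mu]_(x in _) _)%E => [r||] //.
      by move=> _; exact: ltry.
    by rewrite gt0_muley // lte_fin.
  apply: le_lt_trans ioo; rewrite le_eqVlt; apply/orP; left; apply/eqP.
  by apply: eq_integral => x /set_mem x01; rewrite gee0_abs //; exact: mv0.
- move=> n x /=; rewrite in_itv => x01; rewrite lee_fin ger0_norm; last by rewrite mulr_ge0 // cmean_ge0.
  by rewrite ler_wpM2r //; apply: cmean_remainder_le_self => //; exact: sx.
Qed.

Definition bergman_gauge : radial_gauge (R := R) :=
  RadialGauge bergman_gauge_ge0 bergman_gauge_le bergman_gauge_lin bergman_gauge_cst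
    bergman_gauge_affine bergman_gauge_taylor.
End Bergman.

(** [area_average] replaces |f|^2 by its circular means and [radial_integral] reduces the plane to
    the squared radius; [k] is 1 / pi times the constant of the latter. *)
Lemma bergman_normE (beta : R) (beta1 : -1 < beta) : exists (k : R) (k0 : 0 <= k),
  forall f, analytic_on_disk f ->
    bergman_norm beta f = sqrte (bergman_gauge beta1 k0 (radial_mean f)).
Proof.
have [k1 k10 radial] := @radial_integral R.
have k0 : 0 <= pi^-1 * k1 by rewrite mulr_ge0 ?invr_ge0 ?pi_ge0 ?(ltW k10).
exists (pi^-1 * k1), k0 => f fa; congr sqrte.
pose v := bergman_weight beta.
have v0 x : 0 <= v x by exact: bergman_weight_ge0.
have mv := measurable_bergman_weight beta.
rewrite /= /bergman_gauge_fun EFinM -muleA; congr (_ * _)%E.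
transitivity (\int[mu2]_p area_density f v p)%E.
  rewrite integral_mkcond; apply: eq_integral => p _.
  rewrite /area_density !patchE; case: ifPn => // _; by rewrite normc_cpl.
rewrite area_average //.
rewrite radial //; first 1 last.
- exact: measurable_mean_density.
- by move=> x; exact: mean_density_ge0.
- move=> x x0; rewrite /mean_density patchE memNset //= in_itv /= => /andP[].
  by rewrite leNgt x0.
congr (_ * _)%E.
transitivity (\int[mu]_(x in (`[0%R, 1%R[%classic : set mR)) (cmean f (Num.sqrt x) * v x)%:E)%E.
  by symmetry; exact: integral_mkcond.
symmetry; apply: integral_itv_obnd_cbnd.
apply/measurable_EFinP; apply: measurable_funM; first by case: (radial_profile_mean fa).
by apply: measurable_funTS; exact: measurable_bergman_weight.
Qed.
End Gauges.

(** * Squared norms and boundedness of composition *)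

Section SquareNorm.
Context {R : realType}.
Local Notation C := (R[i]).
Local Notation mR := (measurableTypeR R).
Implicit Types (f g : C -> C) (x : R) (L : radial_gauge (R := R)).

Lemma analytic_eq_disk f g : (forall z, disk z -> f z = g z) ->
  analytic_on_disk f -> analytic_on_disk g.
Proof.
move=> fg fa z dz; have e0 : 0 < 1 - `|z| by rewrite subr_gt0.
apply: (@near_eq_derivable _ C^o C^o f) (fa z dz) => //.
exists (1 - `|z|) => //= y yz; apply: fg; rewrite /disk /=.
rewrite -[y](subrK z); apply: le_lt_trans (ler_normD _ _) _.
by rewrite -ltrBrDr distrC.
Qed.

Definition square_norm L f : \bar R := L (radial_mean f).

Lemma square_norm_ge0 L f : analytic_on_disk f -> (0 <= square_norm L f)%E.
Proof. by move=> fa; apply: gauge_ge0; exact: radial_profile_mean. Qed.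

Lemma square_norm_le L f g (a : R) : analytic_on_disk f -> analytic_on_disk g -> 0 <= a ->
  (forall z, disk z -> normc (f z) ^+ 2 <= a * normc (g z) ^+ 2) ->
  (square_norm L f <= a%:E * square_norm L g)%E.
Proof.
move=> fa ga a0 fg; have pf := radial_profile_mean fa; have pg := radial_profile_mean ga.
(* The zero second term lets [gauge_lin] serve as homogeneity. *)
have pa : radial_profile (fun x => a * radial_mean g x + 0 * radial_mean g x).
  case: pg => mg g0; split; last by move=> x x01; rewrite mul0r addr0 mulr_ge0 // g0.
  by apply: measurable_funD; exact: measurable_funM.
apply: (@le_trans _ _ (L (fun x => a * radial_mean g x + 0 * radial_mean g x)%R)).
  apply: gauge_le => // x /andP[x0 x1]; rewrite mul0r addr0 /radial_mean /cmean.
  have sb : 0 <= Num.sqrt x < 1 by rewrite sqrtr_ge0 -(sqrtr1 R) ltr_sqrt.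
  rewrite mulrCA ler_pM2l ?invr_gt0 ?twopi_gt0 // -segintZ; last first.
    by apply: segcontT; apply: ccont_normc2; exact: ccont_analytic.
  apply: le_segint.
  - by apply: segcontT; apply: ccont_normc2; exact: ccont_analytic.
  - by apply: segcontT => t; apply: cvgM; [exact: cvg_cst|apply: ccont_normc2; exact: ccont_analytic].
  - by move=> t _; apply: fg; apply: disk_circ.
apply: le_trans (gauge_lin L pg pg a0 (lexx 0)) _.
by rewrite mul0e adde0.
Qed.

Lemma square_normD L f g : analytic_on_disk f -> analytic_on_disk g ->
  (square_norm L (fun z => f z + g z)%R <= 2%:E * square_norm L f + 2%:E * square_norm L g)%E.
Proof.
move=> fa ga; have pf := radial_profile_mean fa; have pg := radial_profile_mean ga.
have pa : radial_profile (fun x => 2 * radial_mean f x + 2 * radial_mean g x).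
  case: pg pf => mg g0 [mf f0]; split.
    by apply: measurable_funD; exact: measurable_funM.
  by move=> x x01; rewrite addr_ge0 // mulr_ge0 // ?g0 ?f0.
apply: (@le_trans _ _ (L (fun x => 2 * radial_mean f x + 2 * radial_mean g x)%R)).
  apply: gauge_le => //.
    by apply: radial_profile_mean; exact: (analytic_add fa ga).
  move=> x /andP[x0 x1].
  have sb : 0 <= Num.sqrt x < 1 by rewrite sqrtr_ge0 -(sqrtr1 R) ltr_sqrt.
  by apply: cmeanD_le; exact: ccont_analytic.
exact: gauge_lin.
Qed.

Lemma square_norm_bounded L : exists2 c : R, 0 <= c & forall f (M : R), analytic_on_disk f -> 0 <= M ->
  (forall z, disk z -> normc (f z) <= M) -> (square_norm L f <= (c * M ^+ 2)%:E)%E.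
Proof.
have [c c0 cM] := gauge_cst L; exists c => // f M fa M0 fM.
apply: le_trans (cM _ (sqr_ge0 M)); apply: gauge_le.
- exact: radial_profile_mean.
- by split => // x _; exact: sqr_ge0.
move=> x /andP[x0 x1].
have sb : 0 <= Num.sqrt x < 1 by rewrite sqrtr_ge0 -(sqrtr1 R) ltr_sqrt.
apply: cmean_le_cst; first exact: ccont_analytic.
by move=> t; rewrite ler_pXn2r ?nnegrE ?normc_ge0 //; apply: fM; exact: disk_circ.
Qed.

(** [littlewood_circle] compares the mean of the composite at radius [r] with that of [f] at a
    larger radius [rho], and [gauge_affine] pays for the passage from [r] to [rho]. *)
Lemma square_norm_comp L phi : analytic_on_disk phi -> (forall z, disk z -> disk (phi z)) ->
  exists2 K : R, 0 <= K & forall f, analytic_on_disk f ->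
    (square_norm L (f \o phi) <= K%:E * square_norm L f)%E.
Proof.
move=> pa pd; have p01 : normc (phi 0) < 1 by apply/diskE/pd/diskE; rewrite normc0.
have p00 := normc_ge0 (phi 0).
(* With this [c], [normc_self_map] reads |phi z| <= 1 - 4 c (1 - |z|), ample room below [rho]. *)
pose c : R := (1 - normc (phi 0)) / 8.
have c01 : 0 < c < 1 by rewrite /c; apply/andP; split; lra.
have /andP[c0 c1] := c01; have c8 : c <= 8^-1 by rewrite /c; lra.
have p0E : normc (phi 0) = 1 - 8 * c by rewrite /c; lra.
(* With rho^2 = 1 - c (1 - r^2), the bound on 1 - |phi z| gives |phi z| < rho for
   |z| <= r, while rho stays away from |phi 0|. *)
have [K K0 KL] := gauge_affine L c01.
(* Bounds the Harnack factor: rho + |phi 0| <= 2, while rho >= 1 - c and |phi 0| = 1 - 8 c give rho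
   - |phi 0| >= 7 c. *)
pose k : R := 2 / (7 * c).
have k0 : 0 <= k by rewrite divr_ge0 // mulr_ge0 // ltW.
exists (k * K); first exact: mulr_ge0.
move=> f fa; have pf := radial_profile_mean fa.
have fpa : analytic_on_disk (f \o phi) by apply: analytic_comp.
have pc := radial_profile_affine c01 pf.
pose m x : R := radial_mean f (1 - c * (1 - x)).
have pkm : radial_profile (fun x => k * m x + 0 * m x).
  case: pc => mc m0; split; last by move=> x x01; rewrite mul0r addr0 mulr_ge0 // m0.
  by apply: measurable_funD; exact: measurable_funM.
apply: (@le_trans _ _ (L (fun x => k * m x + 0 * m x)%R)); last first.
  apply: le_trans (gauge_lin L pc pc k0 (lexx 0)) _.
  rewrite mul0e adde0 (EFinM k K) -muleA; apply: lee_wpmul2l (KL _ pf).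
  by rewrite lee_fin.
apply: gauge_le => //; first exact: radial_profile_mean.
move=> x /andP[x0 x1]; rewrite mul0r addr0 /m /radial_mean.
set r := Num.sqrt x; set rho := Num.sqrt _.
have r0 : 0 < r by rewrite sqrtr_gt0.
have r1 : r < 1 by rewrite -(sqrtr1 R) ltr_sqrt.
have r2 : r ^+ 2 = x by rewrite sqr_sqrtr // ltW.
have y0 : 0 < 1 - c * (1 - x) by nra.
have y1 : 1 - c * (1 - x) < 1 by nra.
have rho0 : 0 < rho by rewrite sqrtr_gt0.
have rho1 : rho < 1 by rewrite -(sqrtr1 R) ltr_sqrt.
have rho2 : rho ^+ 2 = 1 - c * (1 - x) by rewrite sqr_sqrtr // ltW.
have pr z : normc z <= r -> normc (phi z) < rho.
  move=> zr; have dz : disk z by apply/diskE; exact: le_lt_trans zr r1.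
  have := normc_self_map pa pd dz; rewrite p0E => h.
  have h1 : normc (phi z) <= 1 - 4 * c * (1 - r) by nra.
  apply: le_lt_trans h1 _; rewrite ltNge; apply/negP => h2.
  have h3 : rho ^+ 2 <= (1 - 4 * c * (1 - r)) ^+ 2.
    by rewrite ler_pXn2r // nnegrE; [exact: ltW|exact: le_trans (ltW rho0) h2].
  move: h3; rewrite rho2 -r2 => h3; clear -c0 c8 r0 r1 h3.
  have [d0 d1] : 0 < 1 - r /\ 1 - r < 1 by split; lra.
  have cd0 : 0 < c * (1 - r) by exact: mulr_gt0.
  have cd1 : c * (1 - r) <= 8^-1 by nra.
  (* With d = 1 - r, this product is 1 - c d (2 - d) minus (1 - 4 c d)^2, so its positivity
     contradicts [h3]. *)
  have : 0 < c * (1 - r) * (6 - 16 * (c * (1 - r)) + (1 - r)) by apply: mulr_gt0 => //; lra.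
  lra.
have := littlewood_circle fa pa pd r0 r1 rho0 rho1 pr.
rewrite !circle_int_cmean ?(ltW r0) ?(ltW rho0) // -EFinM lee_fin.
rewrite [leRHS]mulrCA ler_pM2l ?twopi_gt0 // => h; apply: le_trans h _.
apply: ler_wpM2r; first exact: cmean_ge0.
have rhoc : 1 - c <= rho by clear -rho0 rho1 rho2 c0 x0 x1; nra.
rewrite /k ler_pdivrMr; last by rewrite p0E; lra.
rewrite mulrAC ler_pdivlMr; last by rewrite mulr_gt0.
by rewrite p0E; nra.
Qed.

End SquareNorm.

(** * Li-Yorke chaos *)

Section Countability.
Context {R : realType}.

(** Each condition removes at most one real. Were the remaining set countable, so would be the line,
    against its infinite Lebesgue measure. *)
Lemma uncountable_avoiding (I : countType) (P : I -> R -> Prop) :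
  (forall i s t, P i s -> P i t -> s = t) -> ~ countable [set t | forall i, ~ P i t].
Proof.
move=> P1 cG; have cB : countable (\bigcup_(i in [set: I]) [set t | P i t]).
  apply: bigcup_countable => [|i _]; first exact: countableP.
  have [[s Ps]|/forallNP nP] := pselect (exists s, P i s).
    by apply: sub_countable (countable1 s); apply: subset_card_le => t /= Pt; exact: P1 Pt Ps.
  by apply: sub_countable (@countable0 R); apply: subset_card_le => t /nP.
have cT : countable [set: R].
  have -> : [set: R] = \bigcup_(b in [set: bool])
      (if b then [set t | forall i, ~ P i t] else \bigcup_(i in [set: I]) [set t | P i t]).
    apply/seteqP; split => // t _; have [h|/existsNP[i /contrapT Pt]] := pselect (forall i, ~ P i t).
      by exists true.
    by exists false => //; exists i.
  by apply: bigcup_countable => [|[] _]; first exact: countableP.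
have := countable_lebesgue_measure0 cT; rewrite -set_itvNyy lebesgue_measure_itv /=.
by [].
Qed.

Lemma exists_avoiding (I : countType) (P : I -> R -> Prop) :
  (forall i s t, P i s -> P i t -> s = t) -> exists t, forall i, ~ P i t.
Proof.
move=> P1; apply: contrapT => nex; apply: (uncountable_avoiding P1).
apply: sub_countable (@countable0 R); apply: subset_card_le => t /= h.
by exfalso; apply: nex; exists t.
Qed.

Lemma inj_nat_unbounded (f : nat -> nat) K : injective f -> exists k, (K <= f k)%N.
Proof.
move=> fi; apply: contrapT => /forallNP h.
have lt k : (f k < K)%N by rewrite ltnNge; apply/negP; exact: h.
pose g (k : 'I_K.+1) : 'I_K := Ordinal (lt k).
have gi : injective g by move=> i j /(congr1 val) /= /fi; exact: val_inj.
by have := leq_card g gi; rewrite !card_ord ltnn.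
Qed.

Lemma limn_einf_eq0 (u : nat -> \bar R) : (forall n, (0 <= u n)%E) ->
  (forall e : R, 0 < e -> forall m, exists2 n, (m <= n)%N & (u n < e%:E)%E) ->
  limn_einf u = 0%E.
Proof.
move=> u0 h; rewrite limn_einf_lim; apply/eqP; rewrite eq_le; apply/andP; split; last first.
  apply: lime_ge; first exact: is_cvg_einfs.
  by apply: nearW => n; apply: le_ereal_inf_tmp => _ [k /= _ <-].
apply: lime_le; first exact: is_cvg_einfs.
apply: nearW => m; apply/lee_addgt0Pr => e e0; rewrite add0e.
have [n mn une] := h e e0 m; apply: le_trans (ltW une).
by apply: ereal_inf_lbound; exists n.
Qed.

Lemma limn_esup_gt0 (u : nat -> \bar R) : (forall n, (0 <= u n)%E) ->
  ~ (u @ \oo --> 0%E) -> (0 < limn_esup u)%E.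
Proof.
by move=> u0 ncv; rewrite ltNge; apply/negP => h; apply: ncv; exact: limn_esup_le_cvg.
Qed.

End Countability.

(** * Iterates of the weighted composition operator *)

Section Iterates.
Context {R : realType}.
Local Notation C := (R[i]).
Context (phi w : C -> C).
Context (pa : analytic_on_disk phi) (pd : forall z, disk z -> disk (phi z)).
Context (wa : analytic_on_disk w).
Local Notation T := (wcomp w phi).

Lemma iter_disk n z : disk z -> disk (iter n phi z).
Proof. by move=> dz; elim: n => //= n; exact: pd. Qed.

Lemma analytic_iter n : analytic_on_disk (fun z => iter n phi z).
Proof.
elim: n => [|n IH]; first exact: analytic_id.
have da z : disk z -> disk (iter n phi z) by exact: iter_disk.
exact: (@analytic_comp _ phi (fun z => iter n phi z) pa IH da).
Qed.

Lemma analytic_weight n : analytic_on_disk (weight w phi n).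
Proof.
elim: n => [|n IH].
  rewrite (_ : weight w phi 0 = fun=> 1); first exact: analytic_cst.
  by apply/funext => z; rewrite /weight big_ord0.
rewrite (_ : weight w phi n.+1 = fun z => weight w phi n z * w (iter n phi z)); last first.
  by apply/funext => z; rewrite /weight big_ord_recr.
have da z : disk z -> disk (iter n phi z) by exact: iter_disk.
have wi := @analytic_comp _ w (fun z => iter n phi z) wa (@analytic_iter n) da.
exact: (@analytic_mul _ (weight w phi n) (w \o (fun z => iter n phi z)) IH wi).
Qed.

Lemma iter_wcompE n (h : C -> C^o) z : disk z ->
  iter n T h z = weight w phi n z * h (iter n phi z).
Proof.
elim: n h z => [|n IH] h z dz; first by rewrite /weight big_ord0 mul1r.
rewrite iterS /wcomp; have -> : (`|z| < 1) = true by exact: dz.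
rewrite IH; last exact: pd.
rewrite /weight big_ord_recl mulrA -iterSr; congr (_ * _ * _).
by apply: eq_bigr => j _; rewrite -iterSr.
Qed.

Lemma wcomp_linear (a : C) (f g : C -> C^o) : T (a *: f + g) = a *: T f + T g.
Proof.
apply/funext => z; rewrite /wcomp fctE /= !fctE; case: ifP => _; last by rewrite scaler0 addr0.
by rewrite mulrDr; congr (_ + _); rewrite /GRing.scale /= mulrCA.
Qed.

Lemma iter_wcompB n (f g : C -> C^o) : iter n T f - iter n T g = iter n T (f - g).
Proof.
elim: n => //= n IH; rewrite -IH -scaleN1r addrC -wcomp_linear.
by rewrite scaleN1r addrC.
Qed.

Lemma wcomp_analytic (f : C -> C^o) : analytic_on_disk f -> analytic_on_disk (T f).
Proof.
move=> fa; apply: (@analytic_eq_disk _ (fun z => w z * f (phi z))).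
  by move=> z dz; rewrite /wcomp; have -> : (`|z| < 1) = true by exact: dz.
exact: (@analytic_mul _ w (f \o phi) wa (@analytic_comp _ f phi fa pa pd)).
Qed.

Lemma iter_wcomp_analytic n (f : C -> C^o) : analytic_on_disk f -> analytic_on_disk (iter n T f).
Proof.
by move=> fa; elim: n => [|n IH]; [exact: fa|exact: (@wcomp_analytic (iter n T f) IH)].
Qed.

Lemma wcomp_disk_function (f : C -> C^o) : disk_function (T f).
Proof. by move=> z /negP nz; rewrite /wcomp (negbTE nz). Qed.

End Iterates.

Section Extended.
Context {R : realType}.

Lemma sqrte_lt (x : \bar R) (e : R) : (0 <= x)%E -> 0 < e ->
  (sqrte x < e%:E)%E = (x < (e ^+ 2)%:E)%E.
Proof.
move=> x0 e0; case: x x0 => [r||] //= r0; rewrite !lte_fin.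
by rewrite -[X in _ < X](ger0_norm (ltW e0)) -sqrtr_sqr ltr_sqrt ?exprn_gt0 // sqrtr_sqr ger0_norm // ltW.
Qed.

Lemma sqrte_lty (x : \bar R) : (sqrte x < +oo)%E = (x < +oo)%E.
Proof. by case: x => [r||] //=; rewrite !ltry. Qed.

End Extended.

(** * Bounded functions on the disk and rational polynomials *)

Section RationalPolynomials.
Context {R : realType}.
Local Notation C := (R[i]).
Implicit Types (s : seq (rat * rat)) (z : C) (c : R).

Lemma analytic_sub (f g : C -> C^o) : analytic_on_disk f -> analytic_on_disk g ->
  analytic_on_disk (f - g).
Proof. by move=> fa ga z dz; apply: (@derivableB _ C^o C^o); [exact: fa|exact: ga]. Qed.

Lemma square_normB (L : radial_gauge (R := R)) (f g : C -> C^o) :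
  analytic_on_disk f -> analytic_on_disk g ->
  (square_norm L (f - g)%R <= 2%:E * square_norm L f + 2%:E * square_norm L g)%E.
Proof.
move=> fa ga; pose g' : C -> C := fun z => - g z.
have ga' : analytic_on_disk g' by move=> z dz; apply: (@derivableN _ C^o C^o); exact: ga.
apply: le_trans (square_normD L fa ga') _; apply: leeD => //; apply: lee_wpmul2l => //.
rewrite -[leRHS]mul1e; apply: square_norm_le => // z _.
by rewrite mul1r normcN.
Qed.

Definition disk_extend (f : C -> C) : C -> C^o := fun z => if `|z| < 1 then f z else 0.

Lemma disk_extendE f z : disk z -> disk_extend f z = f z.
Proof. by move=> dz; rewrite /disk_extend; have -> : (`|z| < 1) = true by exact: dz. Qed.

Definition bounded_on_disk (h : C -> C^o) : Prop :=
  [/\ disk_function h, analytic_on_disk h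
    & exists2 M : R, 0 <= M & forall z, disk z -> normc (h z) <= M].

Lemma bounded_extend f M : analytic_on_disk f -> 0 <= M ->
  (forall z, disk z -> normc (f z) <= M) -> bounded_on_disk (disk_extend f).
Proof.
move=> fa M0 fM; split.
- by move=> z /negP nz; rewrite /disk_extend (negbTE nz).
- by apply: (@analytic_eq_disk _ f) => // z dz; rewrite disk_extendE.
- by exists M => // z dz; rewrite disk_extendE // fM.
Qed.

Lemma boundedB f g : bounded_on_disk f -> bounded_on_disk g -> bounded_on_disk (f - g).
Proof.
move=> [f0 fa [M M0 fM]] [g0 ga [M' M0' gM]]; split.
- by move=> z nz; rewrite fctE /= fctE f0 // g0 // subrr.
- exact: analytic_sub.
- exists (M + M'); first exact: addr_ge0.
  move=> z dz; apply: le_trans (le_normcD _ _) _.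
  by rewrite normcN lerD // ?fM ?gM.
Qed.

Lemma boundedD f g : bounded_on_disk f -> bounded_on_disk g -> bounded_on_disk (f + g).
Proof.
move=> [f0 fa [M M0 fM]] [g0 ga [M' M0' gM]]; split.
- by move=> z nz; rewrite fctE f0 // g0 // addr0.
- exact: (analytic_add fa ga).
- exists (M + M'); first exact: addr_ge0.
  by move=> z dz; apply: le_trans (le_normcD _ _) _; rewrite lerD // ?fM ?gM.
Qed.

Definition disk_cst c : C -> C^o := disk_extend (fun=> c%:C).

Lemma bounded_disk_cst c : bounded_on_disk (disk_cst c).
Proof.
apply: (@bounded_extend _ `|c|) => [|//|z _]; first exact: analytic_cst.
by rewrite normc_real.
Qed.

Definition rat_coef s (j : nat) : C := ratr (nth (0, 0) s j).1 +i* ratr (nth (0, 0) s j).2.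

Definition rat_poly s : C -> C^o := disk_extend (csum (rat_coef s) (size s)).

Lemma normc_csum_le (a : nat -> C) n z : disk z ->
  normc (csum a n z) <= \sum_(j < n) normc (a j).
Proof.
move=> /diskE z1; elim: n => [|n IH]; first by rewrite /csum !big_ord0 normc0.
rewrite csum_recr big_ord_recr; apply: le_trans (le_normcD _ _) _; apply: lerD => //.
by rewrite normcM normcX ler_piMr ?normc_ge0 // exprn_ile1 ?normc_ge0 // ltW.
Qed.

Lemma bounded_rat_poly s : bounded_on_disk (rat_poly s).
Proof.
apply: (@bounded_extend _ (\sum_(j < size s) normc (rat_coef s j))).
- by move=> z _; exact: derivable_csum.
- by apply: sumr_ge0 => j _; exact: normc_ge0.
- by move=> z dz; exact: normc_csum_le.
Qed.

Lemma rat_coef_dense (a : nat -> C) m (d : R) : 0 < d ->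
  exists2 s, size s = m & forall j, (j < m)%N -> normc (a j - rat_coef s j) <= d.
Proof.
move=> d0; have d2 : 0 < d / 2 by rewrite divr_gt0.
have near (x : R) : exists r : rat, `|x - ratr r| <= d / 2.
  have [r] := @rat_in_itvoo R (x - d / 2) (x + d / 2) ltac:(lra).
  rewrite in_itv /= => /andP[h1 h2]; exists r.
  by rewrite ler_norml; apply/andP; split; lra.
have /choice[r hr] : forall j, exists r : rat * rat, normc (a j - (ratr r.1 +i* ratr r.2)) <= d.
  move=> j; have [r1 h1] := near (Re (a j)); have [r2 h2] := near (Im (a j)).
  exists (r1, r2); apply: le_trans (normc_le_ReIm _) _.
  move: h1 h2; case: (a j) => x y /= h1 h2.
  by rewrite [d]splitr lerD.
exists (mkseq r m); first by rewrite size_mkseq.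
by move=> j jm; rewrite /rat_coef nth_mkseq.
Qed.

Lemma csumB (a b : nat -> C) n z : csum (fun j => a j - b j) n z = csum a n z - csum b n z.
Proof.
elim: n => [|n IH]; first by rewrite /csum !big_ord0 subr0.
by rewrite !csum_recr IH mulrBl; ring.
Qed.

Lemma rat_poly_dense (a : nat -> C) m (e : R) : 0 < e ->
  exists s, forall z, disk z -> normc (csum a m z - rat_poly s z) <= e.
Proof.
(* The error [e] is shared among m coefficients; m + 1 covers m = 0. *)
move=> e0; have d0 : 0 < e / m.+1%:R by rewrite divr_gt0 // ltr0n.
have [s sm hs] := rat_coef_dense a m d0; exists s => z dz.
rewrite /rat_poly disk_extendE // sm -csumB; apply: le_trans (normc_csum_le _ _ dz) _.
apply: (@le_trans _ _ (\sum_(j < m) (e / m.+1%:R))).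
  by apply: ler_sum => j _; exact: hs.
rewrite sumr_const card_ord -[_ *+ m]mulr_natr -mulrA ler_piMr ?(ltW e0) //.
by rewrite mulrC ler_pdivrMr ?ltr0n // mul1r ler_nat.
Qed.

End RationalPolynomials.

(** * The chaos argument for an arbitrary gauge *)

Section RadialLiYorke.
Context {R : realType}.
Local Notation C := (R[i]).
Context (L : radial_gauge (R := R)) (phi w : C -> C).
Context (pa : analytic_on_disk phi) (pd : forall z, disk z -> disk (phi z)).
Context (wH : Hinfty w).
Local Notation T := (wcomp w phi).
Local Notation q := (square_norm L).
Implicit Types (f g h : C -> C^o) (z : C) (t : R).

Let wa : analytic_on_disk w := wH.1.

Lemma Hinfty_bound : exists2 M : R, 1 <= M & forall z, disk z -> normc (w z) <= M.
Proof.
have [_ [M wM]] := wH; exists (Num.max M 1); first by rewrite le_max lexx orbT.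
by move=> z dz; rewrite le_max wM.
Qed.

Lemma square_norm_wcomp : exists2 A : R, 0 <= A &
  forall f, analytic_on_disk f -> (q (T f) <= A%:E * q f)%E.
Proof.
have [M M1 wM] := Hinfty_bound; have M0 : 0 <= M by exact: le_trans M1.
have [K K0 qK] := square_norm_comp L pa pd.
exists (M ^+ 2 * K); first by rewrite mulr_ge0 // sqr_ge0.
move=> f fa; have fpa := @analytic_comp _ f phi fa pa pd.
rewrite EFinM -muleA; apply: (@le_trans _ _ ((M ^+ 2)%:E * q (f \o phi))%E).
  apply: square_norm_le; [exact: wcomp_analytic|exact: fpa|exact: sqr_ge0|].
  move=> z dz; rewrite /wcomp; have -> : (`|z| < 1) = true by exact: dz.
  rewrite normcM exprMn ler_wpM2r ?sqr_ge0 //.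
  by rewrite ler_pXn2r ?nnegrE ?normc_ge0 // wM.
by apply: lee_wpmul2l; [rewrite lee_fin sqr_ge0|exact: qK].
Qed.

(** On bounded analytic functions this is membership in Z; [q] being the square of the norm,
    convergence to 0 means the same for both. *)
Definition orbit_vanishes h : Prop := forall e : R, 0 < e ->
  exists m, forall n, (m <= n)%N -> (q (iter n T h) < e%:E)%E.

Let ana n f (fa : analytic_on_disk f) : analytic_on_disk (iter n T f) :=
  @iter_wcomp_analytic _ phi w pa pd wa n f fa.

Lemma orbit_vanishesB f g : analytic_on_disk f -> analytic_on_disk g ->
  orbit_vanishes f -> orbit_vanishes g -> orbit_vanishes (f - g).
Proof.
move=> fa ga f0 g0 e e0; have e4 : 0 < e / 4 by rewrite divr_gt0.
have [m1 h1] := f0 _ e4; have [m2 h2] := g0 _ e4; exists (maxn m1 m2) => n.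
rewrite geq_max => /andP[n1 n2]; rewrite -iter_wcompB.
apply: le_lt_trans (square_normB L (@ana n f fa) (@ana n g ga)) _.
have -> : e%:E = (2%:E * (e / 4)%:E + 2%:E * (e / 4)%:E)%E.
  by rewrite -EFinM -EFinD; congr (_%:E); lra.
by apply: lteD; rewrite lte_pmul2l ?lte_fin //; [exact: h1|exact: h2].
Qed.

(** On the disk the n-th iterate of the constant t is t times the n-th weight. *)
Lemma weight_le_iter n t : (q (weight w phi n) * (t ^+ 2)%:E <= q (iter n T (disk_cst t)))%E.
Proof.
have [-> | t0] := eqVneq t 0.
  rewrite expr0n mule0; apply: square_norm_ge0; apply: ana.
  by case: (bounded_disk_cst (0 : R)).
have t2 : 0 < t ^+ 2 by rewrite exprn_even_gt0.
rewrite muleC -lee_pdivlMl //; apply: square_norm_le.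
- exact: analytic_weight.
- by apply: ana; case: (bounded_disk_cst t).
- by rewrite invr_ge0 ltW.
move=> z dz; rewrite (@iter_wcompE _ phi w pd) // /disk_cst disk_extendE; last exact: (@iter_disk _ phi pd).
by rewrite normcM normc_real exprMn real_normK ?num_real // mulrCA mulVf ?mulr1 // gt_eqF.
Qed.

(** Makes every initial segment of the weights bounded, so that a sufficiently large weight must
    have a large index. *)
Lemma weight_bounded m : exists B : R, forall n, (n <= m)%N -> (q (weight w phi n) <= B%:E)%E.
Proof.
have [M M1 wM] := Hinfty_bound; have M0 : 0 <= M by exact: le_trans M1.
have [c c0 qc] := square_norm_bounded L.
exists (c * (M ^+ m) ^+ 2) => n nm; apply: qc; [exact: analytic_weight|exact: exprn_ge0|].
move=> z dz; apply: (@le_trans _ _ (M ^+ n)); last by rewrite ler_weXn2l.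
elim: n {nm} => [|n IH]; first by rewrite /weight big_ord0 -[1]/(1%:C) normc_real normr1.
rewrite exprSr /weight big_ord_recr normcM ler_pM ?normc_ge0 //.
by apply: wM; exact: (@iter_disk _ phi pd).
Qed.

Context (weight_recurs : forall (e : R) m, 0 < e ->
  exists2 n, (m <= n)%N & (q (weight w phi n) < e%:E)%E).
Context (weight_unbounded : forall B : R, exists n, (B%:E < q (weight w phi n))%E).

(** A bound [M] on [h] gives |T^n h| <= M |w^(n)| on the disk; M^2 + 1 replaces M^2 to have a
    positive divisor. *)
Lemma orbit_recurs h (e : R) m : bounded_on_disk h -> 0 < e ->
  exists2 n, (m <= n)%N & (q (iter n T h) < e%:E)%E.
Proof.
move=> [h0 ha [M M0 hM]] e0; have M1 : 0 < M ^+ 2 + 1 by rewrite ltr_wpDl ?sqr_ge0.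
have [n mn qn] := weight_recurs m (divr_gt0 e0 M1); exists n => //.
apply: (@le_lt_trans _ _ ((M ^+ 2 + 1)%:E * q (weight w phi n))%E).
  apply: square_norm_le; [exact: ana|exact: analytic_weight|exact: ltW|].
  move=> z dz; rewrite (@iter_wcompE _ phi w pd) // normcM exprMn mulrC ler_wpM2r ?sqr_ge0 //.
  apply: (@le_trans _ _ (M ^+ 2)); last by rewrite lerDl.
  by rewrite ler_pXn2r ?nnegrE ?normc_ge0 //; apply: hM; exact: (@iter_disk _ phi pd).
by rewrite -lte_pdivlMl // -EFinM mulrC.
Qed.

Lemma disk_cst_not_vanishing t : orbit_vanishes (disk_cst t) -> t = 0.
Proof.
move=> tv; apply/eqP/negPn/negP => t0.
have t2 : 0 < t ^+ 2 by rewrite exprn_even_gt0.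
have [m hm] := tv _ t2; have [B hB] := weight_bounded m.
(* Exceeding [B] forces n > m. There t^2 q(w^(n)) is at most the squared norm of the iterate, which
   is below t^2, against q(w^(n)) > 1. *)
have [n hn] := weight_unbounded (Num.max B 1).
have [nm|mn] := leqP n m.
  have := lt_le_trans hn (hB n nm); rewrite lte_fin gt_max ltxx //.
have := le_lt_trans (weight_le_iter n t) (hm n (ltnW mn)).
rewrite -[ltRHS]mul1e lte_pmul2r ?lte_fin // => /(lt_trans hn).
by rewrite lte_fin gt_max ltxx andbF.
Qed.

Local Notation index := (seq (rat * rat) * nat)%type.
(* The nat component only repeats each polynomial, with weights a i tending to 0. *)
Let a (i : index) : R := (pickle i).+1%:R^-1.
Let s t (i : index) : C -> C^o := rat_poly i.1 + disk_cst (t * a i).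

Let a_inj : injective a.
Proof.
by move=> i j /invr_inj /eqP; rewrite eqr_nat eqSS => /eqP /(pcan_inj pickleK).
Qed.

Let bounded_s t i : bounded_on_disk (s t i).
Proof. by apply: boundedD; [exact: bounded_rat_poly|exact: bounded_disk_cst]. Qed.

Let bounded_analytic h : bounded_on_disk h -> analytic_on_disk h.
Proof. by case. Qed.

(** For a fixed pair, the differences at parameters t1 and t2 differ by the constant (t1 - t2) (a i
    - a j). If both vanish along their orbits, that constant is 0, and injectivity of [a] gives t1 =
    t2; so each pair excludes at most one t. *)
Let exists_t : exists t, forall i j, i != j -> ~ orbit_vanishes (s t i - s t j).
Proof.
pose P (ij : index * index) t := ij.1 != ij.2 /\ orbit_vanishes (s t ij.1 - s t ij.2).
have [t ht] : exists t, forall ij, ~ P ij t.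
  apply: exists_avoiding => -[i j] t1 t2 [/= ij v1] [_ v2].
  have an (t : R) : analytic_on_disk (s t i - s t j).
    by apply: bounded_analytic; apply: boundedB.
  have E : (s t1 i - s t1 j) - (s t2 i - s t2 j) = disk_cst ((t1 - t2) * (a i - a j)).
    apply/funext => z; rewrite /s /disk_cst /disk_extend !fctE /=.
    case: ifP => _; last by rewrite !addr0 subrr.
    case: (rat_poly i.1 z) (rat_poly j.1 z) => [x y] [x' y'].
    by apply/eqP; rewrite eq_complex /=; apply/andP; split; apply/eqP; ring.
  have := orbit_vanishesB (an t1) (an t2) v1 v2; rewrite E => /disk_cst_not_vanishing /eqP.
  rewrite mulf_eq0 !subr_eq0 => /orP[/eqP //|/eqP /a_inj /eqP].
  by rewrite (negbTE ij).
by exists t => i j ij v; apply: (ht (i, j)).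
Qed.

Context (N : (C -> C^o) -> \bar R).
Context (NE : forall f, analytic_on_disk f -> N f = sqrte (q f)).
Let X : set (C -> C^o) := [set f | [/\ disk_function f, analytic_on_disk f & (N f < +oo)%E]].

Let bounded_X h : bounded_on_disk h -> X h.
Proof.
move=> [h0 ha [M M0 hM]]; split; [exact: h0|exact: ha|rewrite (NE ha) sqrte_lty].
have [c c0 qc] := square_norm_bounded L.
by apply: le_lt_trans (qc h M ha M0 hM) _; rewrite ltry.
Qed.

Let bounded_operator_wcomp : bounded_operator X N T.
Proof.
have [A A0 qA] := square_norm_wcomp.
have TN f : analytic_on_disk f -> (N (T f) <= (Num.sqrt A)%:E * N f)%E.
  move=> fa; have ta := @ana 1 f fa; rewrite (NE ta) (NE fa).
  have -> : (Num.sqrt A)%:E = sqrte A%:E by [].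
  have q0 : (0 <= A%:E * q f)%E by apply: mule_ge0; [rewrite lee_fin|exact: square_norm_ge0].
  by rewrite -sqrteM ?lee_fin // (lee_sqrt _ q0); exact: qA.
split.
- move=> f [f0 fa foo]; split; first exact: wcomp_disk_function.
    exact: (@wcomp_analytic _ phi w pa pd wa f fa).
  apply: le_lt_trans (TN f fa) _; rewrite lte_mul_pinfty ?lee_fin ?sqrtr_ge0 //.
- by move=> c f g _ _; exact: wcomp_linear.
- by exists (Num.sqrt A) => f [_ fa _]; exact: TN.
Qed.

(** Three approximations: [f] by a Taylor polynomial in norm, that polynomial by a rational one
    uniformly on the disk, and a late repetition of the latter to make the constant perturbation
    small. *)
Let dense_s t f (e : R) : X f -> 0 < e -> exists i, (N (f - s t i)%R < e%:E)%E.
Proof.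
move=> [f0 fa foo] e0; have e2 : 0 < e ^+ 2 by rewrite exprn_gt0.
have [c c0 qc] := square_norm_bounded L.
have qf : (L (radial_mean f) < +oo)%E by move: foo; rewrite (NE fa) sqrte_lty.
have rem n : analytic_on_disk (taylor_remainder f n).
  move=> z dz; apply: (@derivableB _ C^o C^o); first exact: fa.
  exact: derivable_csum.
have [m qm] : exists m, (q (taylor_remainder f m) < (e ^+ 2 / 4)%:E)%E.
  have e4 : 0 < e ^+ 2 / 4 by rewrite divr_gt0.
  have /fine_cvgP[[m1 _ fin] /cvgrPdist_lt/(_ _ e4)[m2 _ hm]] := gauge_taylor fa qf.
  exists (maxn m1 m2); have := fin (maxn m1 m2) (leq_maxl _ _) => /= fm.
  rewrite /square_norm -(fineK fm) lte_fin.
  have := hm (maxn m1 m2) (leq_maxr _ _); rewrite /= sub0r normrN; apply: le_lt_trans.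
  exact: ler_norm.
(* A function bounded by [d] has squared norm at most c d^2 <= (c + 1) d <= e^2 / 16; with the e^2 /
   4 of the remainder, the total 2 (e^2 / 4 + e^2 / 16) stays below e^2. *)
pose d : R := Num.min 1 (e ^+ 2 / (16 * (c + 1))).
have c1 : 0 < c + 1 by rewrite ltr_wpDl.
have d0 : 0 < d by rewrite lt_min ltr01 divr_gt0 // mulr_gt0.
have d1 : d <= 1 by rewrite ge_min lexx.
have d2 : d <= e ^+ 2 / (16 * (c + 1)) by rewrite ge_min lexx orbT.
have [r hr] := rat_poly_dense (taylor f) m (divr_gt0 d0 (ltr0n R 2)).
(* Once the code of the index reaches [K], the perturbation |t| / (code + 1) is at most d / 2. *)
pose K := (Num.truncn (2 * `|t| / d)).+1.
have [k hk] : exists k : nat, (K <= pickle ((r, k) : index))%N.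
  by apply: (@inj_nat_unbounded (fun k => pickle ((r, k) : index)) K) => k1 k2 /(pcan_inj pickleK) [].
have ta : `|t * a (r, k)| <= d / 2.
  rewrite normrM /a normfV (ger0_norm (ler0n _ _)) ler_pdivrMr ?ltr0n //.
  have h : 2 * `|t| / d < K%:R by rewrite truncnS_gt.
  have hK : (K%:R : R) <= (pickle ((r, k) : index)).+1%:R by rewrite ler_nat ltnW.
  have := le_trans (ltW h) hK; rewrite ler_pdivrMr // => h3.
  by rewrite mulrAC ler_pdivlMr ?ltr0n //; lra.
exists (r, k).
pose b : C -> C^o := fun z => s t (r, k) z - csum (taylor f) m z.
have ba : analytic_on_disk b.
  move=> z dz; apply: (@derivableB _ C^o C^o); last exact: derivable_csum.
  exact: (bounded_analytic (bounded_s t (r, k))).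
have bd z : disk z -> normc (b z) <= d.
  move=> dz; rewrite /b /s !fctE /=.
  have -> : rat_poly r z + disk_cst (t * a (r, k)) z - csum (taylor f) m z =
    (t * a (r, k))%:C - (csum (taylor f) m z - rat_poly r z).
    by rewrite /disk_cst disk_extendE //; ring.
  rewrite [d]splitr; apply: le_trans (le_normcD _ _) _.
  by rewrite normcN normc_real lerD // hr.
have E : f - s t (r, k) = (taylor_remainder f m : C -> C^o) - b.
  by apply/funext => z; rewrite !fctE /= /b /taylor_remainder opprB addrA subrK.
have rb : analytic_on_disk ((taylor_remainder f m : C -> C^o) - b) by exact: (analytic_sub (rem m) ba).
rewrite E (NE rb) (sqrte_lt (square_norm_ge0 L rb) e0).
apply: le_lt_trans (square_normB L (rem m) ba) _.
have qb : (q b <= (e ^+ 2 / 16)%:E)%E.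
  apply: le_trans (qc b d ba (ltW d0) bd) _; rewrite lee_fin.
  apply: (@le_trans _ _ ((c + 1) * d)).
    by apply: ler_pM => //; rewrite ?sqr_ge0 ?lerDl // expr2 ler_piMr // ltW.
  move: d2; rewrite ler_pdivlMr ?mulr_gt0 //; lra.
apply: (@lt_le_trans _ _ (2%:E * (e ^+ 2 / 4)%:E + 2%:E * (e ^+ 2 / 16)%:E)%E).
  apply: lte_leD => //; [|by rewrite lte_pmul2l ?lte_fin|by apply: lee_wpmul2l].
  rewrite fin_numM // ge0_fin_numE; first by apply: le_lt_trans qb _; rewrite ltry.
  exact: square_norm_ge0.
by rewrite -!EFinM -EFinD lee_fin; lra.
Qed.

Theorem radial_Li_Yorke : densely_Li_Yorke_chaotic X N T.
Proof.
split; first exact: bounded_operator_wcomp.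
have [t ht] := exists_t.
pose G := [set c : R | forall i, ~ orbit_vanishes (disk_cst c - s t i)].
have bc c : bounded_on_disk (disk_cst c : C -> C^o) by exact: bounded_disk_cst.
have cstB c c' : disk_cst c - disk_cst c' = disk_cst (c - c') :> (C -> C^o).
  apply/funext => z; rewrite /disk_cst /disk_extend !fctE.
  case: ifP => _; last by rewrite subrr.
  by apply/eqP; rewrite eq_complex /= subrr !eqxx.
have uG : ~ countable G.
  (* Two constants excluded by the same index differ by a constant whose orbit vanishes, hence are
     equal. *)
  apply: uncountable_avoiding => i c c' v v'.
  have := orbit_vanishesB (bounded_analytic (boundedB (bc c) (bounded_s t i)))
    (bounded_analytic (boundedB (bc c') (bounded_s t i))) v v'.
  rewrite opprB addrA subrK cstB => /disk_cst_not_vanishing /eqP.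
  by rewrite subr_eq0 => /eqP.
exists (range (s t) `|` (@disk_cst R @` G)).
have bS f : (range (s t) `|` (@disk_cst R @` G)) f -> bounded_on_disk f.
  by move=> [[i _ <-]|[c _ <-]].
split.
- by move=> f /bS /bounded_X.
- move=> cS; apply: uG; apply: (sub_countable _ cS).
  have inj : injective (@disk_cst R).
    move=> c c' /(congr1 (fun f => f 0)); rewrite /disk_cst.
    have d0 : disk (0 : C) by rewrite /disk /= normr0 ltr01.
    by rewrite !disk_extendE // => /complexI.
  apply: (@card_le_trans _ _ _ (@disk_cst R @` G)); last first.
    by apply: subset_card_le; exact: subsetUr.
  have /card_eqPle[_] : (@disk_cst R @` G #= G)%card by apply: inj_card_eq => x y _ _; exact: inj.
  exact.
- move=> f e Xf e0; have [i hi] := dense_s t Xf e0.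
  by exists (s t i) => //; left; exists i.
move=> f g Sf Sg fg; have bf := bS f Sf; have bg := bS g Sg.
have bfg := boundedB bf bg.
have an n : analytic_on_disk (iter n T (f - g)) by apply: ana; exact: bounded_analytic.
have nv : ~ orbit_vanishes (f - g).
  have vN h1 h2 : bounded_on_disk h1 -> bounded_on_disk h2 -> orbit_vanishes (h1 - h2) ->
      orbit_vanishes (h2 - h1).
    move=> b1 b2 v; have a12 := bounded_analytic (boundedB b1 b2).
    (* Stability under differences suffices for negation: 0 = x - x vanishes, hence so does 0 -
       x. *)
    have v0 : orbit_vanishes ((h1 - h2) - (h1 - h2)) by exact: orbit_vanishesB.
    have := orbit_vanishesB (bounded_analytic (boundedB (boundedB b1 b2) (boundedB b1 b2))) a12 v0 v.
    by rewrite subrr sub0r opprB.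
  case: Sf Sg fg => [[i _ <-]|[c Gc <-]] [[j _ <-]|[c' Gc' <-]] fg.
  - by apply: ht; apply/eqP => ij; apply: fg; rewrite ij.
  - by move=> v; apply: (Gc' i); apply: vN v.
  - exact: Gc.
  - rewrite cstB => /disk_cst_not_vanishing /eqP; rewrite subr_eq0 => /eqP cc.
    by apply: fg; rewrite cc.
have -> : (fun n => N (iter n T f - iter n T g)) = (fun n => sqrte (q (iter n T (f - g)))).
  by apply/funext => n; rewrite iter_wcompB (NE (an n)).
have q0 n : (0 <= q (iter n T (f - g)%R))%E by exact: (square_norm_ge0 L (an n)).
split.
- apply: limn_einf_eq0 => [n|e e0 m]; first exact: sqrte_ge0.
  have [n mn qn] := orbit_recurs m bfg (exprn_gt0 2 e0); exists n => //.
  by rewrite sqrte_lt.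
(* A zero upper limit would mean convergence of the norms to 0, that is, a vanishing orbit of f -
   g. *)
- apply: limn_esup_gt0 => [n|cv]; first exact: sqrte_ge0.
  apply: nv => e e0; have se0 : 0 < Num.sqrt e by rewrite sqrtr_gt0.
  have /fine_cvgP[[m1 _ fin] /cvgrPdist_lt/(_ _ se0)[m2 _ hm]] := cv.
  exists (maxn m1 m2) => n; rewrite geq_max => /andP[n1 n2].
  have := hm n n2; rewrite /= sub0r normrN => h.
  rewrite -[e]sqr_sqrtr ?(ltW e0) // -sqrte_lt // -(fineK (fin n n1)) lte_fin.
  by apply: le_lt_trans h; exact: ler_norm.
Qed.

End RadialLiYorke.

(** Each mean is at most the Hardy supremum, and a gauge is monotone and controlled on constants.
    The factor c + 1 is positive, which also settles an infinite Hardy norm. This inequality carries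
    smallness from H^2 to A^2_beta and unboundedness back. *)
Lemma square_norm_le_hardy {R : realType} (L : radial_gauge (R := R)) :
  exists2 c : R, 0 < c & forall f, analytic_on_disk f ->
    (square_norm L f <= c%:E * square_norm hardy_gauge f)%E.
Proof.
have [c c0 cM] := gauge_cst L; have c1 : 0 < c + 1 by rewrite ltr_wpDl.
exists (c + 1) => // f fa; have := square_norm_ge0 hardy_gauge fa.
case E : (square_norm hardy_gauge f) => [r||] // r0; last by rewrite gt0_muley ?lte_fin // leey.
rewrite lee_fin in r0.
apply: (@le_trans _ _ (c * r)%:E); last by rewrite -EFinM lee_fin ler_wpM2r // lerDl.
apply: le_trans (cM r r0); apply: gauge_le; first exact: radial_profile_mean.
  by split => // x _.
by move=> x x01; rewrite -lee_fin -E; exact: hardy_gauge_ubound.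
Qed.

Unset Implicit Arguments.

Theorem corollary3 (R : realType) (beta : R) (phi w : R[i] -> R[i])
    (hbeta : -1 < beta)
    (phi_analytic : analytic_on_disk phi)
    (phi_self : forall z, disk z -> disk (phi z))
    (w_Hinfty : Hinfty w)
    (nk : nat -> nat)
    (nk_gt0 : forall k, (0 < nk k)%N)
    (nk_incr : forall k l, (k < l)%N -> (nk k < nk l)%N)
    (hardy_lim : (fun k => hardy_norm (weight w phi (nk k))) @ \oo --> 0%E)
    (bergman_sup : ereal_sup
       [set bergman_norm beta (weight w phi n) | n in [set n | (0 < n)%N]]
       = +oo%E) :
  densely_Li_Yorke_chaotic hardy hardy_norm (wcomp w phi) /\
  densely_Li_Yorke_chaotic (bergman beta) (bergman_norm beta) (wcomp w phi).
Proof.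
have [k [k0 bE]] := bergman_normE hbeta.
pose LB := bergman_gauge hbeta k0; pose LH : radial_gauge (R := R) := hardy_gauge.
have wan n : analytic_on_disk (weight w phi n).
  exact: (@analytic_weight _ phi w phi_analytic phi_self w_Hinfty.1 n).
have recursH (e : R) m : 0 < e ->
    exists2 n, (m <= n)%N & (square_norm LH (weight w phi n) < e%:E)%E.
  move=> e0; have se0 : 0 < Num.sqrt e by rewrite sqrtr_gt0.
  (* A strictly increasing sequence dominates its index, so small weights occur beyond any [m]. *)
  have nk_ge l : (l <= nk l)%N.
    by elim: l => // l IH; apply: leq_ltn_trans IH (nk_incr _ _ (ltnSn l)).
  have /fine_cvgP[[m1 _ fin] /cvgrPdist_lt/(_ _ se0)[m2 _ hm]] := hardy_lim.
  pose l := maxn m (maxn m1 m2).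
  have [l0 l1 l2] : [/\ (m <= l)%N, (m1 <= l)%N & (m2 <= l)%N].
    by rewrite /l !leq_max !leqnn !orbT.
  exists (nk l); first exact: leq_trans l0 (nk_ge l).
  have := hm l l2; have := fin l l1; rewrite /= sub0r normrN => fl h.
  rewrite -[e]sqr_sqrtr ?(ltW e0) // -(sqrte_lt (square_norm_ge0 LH (wan (nk l))) se0).
  rewrite -(hardy_normE (wan (nk l))) -(fineK fl) lte_fin.
  by apply: le_lt_trans h; exact: ler_norm.
have [c c0 LBH] := square_norm_le_hardy LB.
have recursB (e : R) m : 0 < e ->
    exists2 n, (m <= n)%N & (square_norm LB (weight w phi n) < e%:E)%E.
  move=> e0; have [n mn hn] := recursH (c^-1 * e) m ltac:(by rewrite mulr_gt0 ?invr_gt0).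
  exists n => //; apply: le_lt_trans (LBH _ (wan n)) _.
  by rewrite -lte_pdivlMl // -EFinM.
have unboundedB (B : R) : exists n, (B%:E < square_norm LB (weight w phi n))%E.
  (* A uniform bound [B] on the squared norms would make the supremum of the norms finite. *)
  apply: contrapT => /forallNP h.
  have : (ereal_sup [set bergman_norm beta (weight w phi n) | n in [set n | (0 < n)%N]]
      <= sqrte (Num.max B 0)%:E)%E.
    apply: ge_ereal_sup => _ [n _ <-]; rewrite (bE _ (wan n)) lee_sqrt ?lee_fin ?le_max ?lexx ?orbT //.
    apply: (@le_trans _ _ B%:E); last by rewrite lee_fin le_max lexx.
    by rewrite leNgt; apply/negP; exact: h.
  by rewrite bergman_sup leNgt /= ltry.
have unboundedH (B : R) : exists n, (B%:E < square_norm LH (weight w phi n))%E.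
  have [n hn] := unboundedB (c * B); exists n.
  by move: (lt_le_trans hn (LBH _ (wan n))); rewrite EFinM lte_pmul2l ?lte_fin.
split.
- exact: (radial_Li_Yorke phi_analytic phi_self w_Hinfty recursH unboundedH (@hardy_normE R)).
- exact: (radial_Li_Yorke phi_analytic phi_self w_Hinfty recursB unboundedB bE).
Qed.
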